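(* Let $G$ be a finite group that contains a unique subgroup $A$ of order $2$, and let $\omega\in Z^3(G,\mathbb{C}^\times)$ be a normalized $3$-cocycle with class $[\omega]\in H^3(G,\mathbb{C}^\times)$. Then, for any choice of $\omega$-admissible pair for $A$ used to define $D^\omega(G,A)$, the following are equivalent: (a) $D^\omega(G,A)$ is a modular quasi-Hopf algebra; (b) $[\omega]$ contains a $2$-generator. Moreover, exactly one half of the classes in $H^3(G,\mathbb{C}^\times)$ satisfy (b).
   Context: Notation. All groups are finite; $\mathbb{C}^\times$ has trivial action; $g^x=x^{-1}gx$; $\widehat G=\mathrm{Hom}(G,\mathbb{C}^\times)$. A normalized $3$-cocycle is $\omega:G^3\to\mathbb{C}^\times$ with $\omega(y,z,w)\,\omega(x,yz,w)\,\omega(x,y,z)=\omega(xy,z,w)\,\omega(x,y,zw)$ and value $1$ whenever an argument is $1$. Put $$\theta_g(x,y)=\frac{\omega(g,x,y)\,\omega(x,y,g^{xy})}{\omega(x,g^x,y)},\qquad \gamma_g(x,y)=\frac{\omega(x,y,g)\,\omega(g,x^g,y^g)}{\omega(x,g,y^g)}.$$ For a $1$-cochain $f$, $\delta f(x,y)=f(x)f(y)/f(xy)$. If $g\in Z(G)$ then $\theta_g=\gamma_g$ is a $2$-cocycle on $G$; $Z_\omega(G)=\{g\in Z(G):\gamma_g\in B^2(G,\mathbb{C}^\times)\}$. Admissibility. An $\omega$-admissible pair for a subgroup $A\subseteq Z_\omega(G)$ is $(\tau,\nu)$ with $\tau=\{\tau_a\}_{a\in A}$ maps $\tau_a:G\to\mathbb{C}^\times$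 with $\tau_a(1)=1$, $\delta\tau_a=\theta_a$, and $\nu:A\to\widehat G$ with $\nu(1)=1$, such that $\nu(a)(g)\nu(b)(g)/\nu(ab)(g)=\beta_\tau(a,b)(g):=\theta_g(a,b)\tau_a(g)\tau_b(g)/\tau_{ab}(g)$ for all $a,b\in A$, $g\in G$. A subgroup $A\subseteq Z(G)$ is $\omega$-admissible if $A\subseteq Z_\omega(G)$ and such a pair exists. Twisted doubles. $D^\omega(G)$ is the quasitriangular quasi-Hopf algebra over $\mathbb{C}$ with basis $e_gx$ ($g,x\in G$), product $(e_gx)(e_hy)=\theta_g(x,y)\delta_{g^x,h}\,e_g\,xy$, coproduct $\Delta(e_gx)=\sum_{hk=g}\gamma_x(h,k)\,e_hx\otimes e_kx$, unit $\sum_g e_g1$, counit $e_gx\mapsto\delta_{g,1}$, associator $\sum\omega(g,h,k)^{-1}e_g1\otimes e_h1\otimes e_k1$, universal $R$-matrix $\sum_{g,h}e_g1\otimes e_hg$, and antipode $S(e_gx)=\theta_{g^{-1}}(x,x^{-1})^{-1}\gamma_x(g,g^{-1})^{-1}e_{x^{-1}g^{-1}x}x^{-1}$ with $\alpha=1$, $\beta=\sum_g\omega(g,g^{-1},g)e_g1$. Given an $\omega$-admissible pair $(\tau,\nu)$ for $A$, the elements $s(a)=\sum_{g}\tau_a(g)\nu(a)(g)^{-1}e_ga$ ($a\in A$) form a group of central group-like elements isomorphic to $A$, and $D^\omega(G,A)$ is the quotient quasitriangular quasi-Hopf algebra of $D^\omega(G)$ by the ideal generated by all $s(a)-1$ (a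 cleft extension $\mathbb{C}^G_\omega\#_c\mathbb{C}(G/A)$). $D^\omega(G,A)$ is called a quasi-Hopf algebra exactly when $A$ is $\omega$-admissible. Thus $\mathrm{Rep}(D^\omega(G,A))$ is a braided fusion subcategory of $\mathrm{Rep}(D^\omega(G))$. Modularity. A braided fusion category (here always pseudounitary, with its canonical spherical structure) with braiding $c$ is modular if the only simple object $X$ with $c_{Y,X}\circ c_{X,Y}=\mathrm{id}$ for all simple $Y$ is the unit object. A quasitriangular quasi-Hopf algebra $H$ is modular if $\mathrm{Rep}(H)$ is. $2$-generators. If $G$ has a unique subgroup of order $2$, the $2$-primary part $H^3(G,\mathbb{C}^\times)_2$ is cyclic of order $|G|_2$ (the $2$-part of $|G|$). Any generator of it is a $2$-generator; a class $\alpha\in H^3(G,\mathbb{C}^\times)$ contains a $2$-generator if the subgroup $\langle\alpha\rangle$ does. *)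

(* Defs.v *)
From HB Require Import structures.
From mathcomp Require Import all_boot all_order all_algebra all_fingroup all_solvable all_field.
From mathcomp Require Import generic_quotient ring_quotient ring.
From mathcomp Require Import mxtens complex.
From mathcomp Require Import finmap boolp classical_sets cardinality reals.

Set Implicit Arguments.
Unset Strict Implicit.
Unset Printing Implicit Defensive.

Import GRing.Theory.
Local Open Scope ring_scope.
Local Open Scope quotient_scope.

Section Cohomology.
Variables (gT : finGroupType) (F : fieldType).

Definition cocycle3 (w : {ffun gT * gT * gT -> F}) : bool :=
  [forall p, w p != 0] &&
  [forall x, forall y, forall z, forall t,
     (w (y, z, t) * w (x, (y * z)%g, t) * w (x, y, z) ==
      w ((x * y)%g, z, t) * w (x, y, (z * t)%g))].

Record Z3 := MkZ3 { Z3fun :> {ffun gT * gT * gT -> F}; _ : cocycle3 Z3fun }.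

HB.instance Definition _ := [isSub for Z3fun].
HB.instance Definition _ := [Choice of Z3 by <:].

Lemma Z3_neq0 (w : Z3) p : w p != 0.
Proof. by case: w => w /= /andP[/forallP]. Qed.

Lemma Z3E (w : Z3) x y z t :
  (w (y, z, t) * w (x, (y * z)%g, t) * w (x, y, z) =
   w ((x * y)%g, z, t) * w (x, y, (z * t)%g)).
Proof.
case: w => w /= /andP[_ /forallP/(_ x)/forallP/(_ y)/forallP/(_ z)/forallP/(_ t)].
by move/eqP.
Qed.

Lemma Z3one_subproof : cocycle3 [ffun=> 1].
Proof.
apply/andP; split; first by apply/forallP => p; rewrite ffunE oner_neq0.
by do 4!apply/forallP => ?; rewrite !ffunE !mulr1.
Qed.

Lemma Z3inv_subproof (w : Z3) : cocycle3 [ffun p => (w p)^-1].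
Proof.
apply/andP; split; first by apply/forallP => p; rewrite ffunE invr_eq0 Z3_neq0.
apply/forallP => x; apply/forallP => y; apply/forallP => z; apply/forallP => t.
by rewrite !ffunE -!invfM Z3E.
Qed.

Lemma Z3mul_subproof (v w : Z3) : cocycle3 [ffun p => (v p * w p)].
Proof.
apply/andP; split.
  by apply/forallP => p; rewrite ffunE mulf_neq0 ?Z3_neq0.
apply/forallP => x; apply/forallP => y; apply/forallP => z; apply/forallP => t.
rewrite !ffunE; apply/eqP.
transitivity ((v ((x * y)%g, z, t) * v (x, y, (z * t)%g)) *
              (w ((x * y)%g, z, t) * w (x, y, (z * t)%g))); last by ring.
by rewrite -!Z3E; ring.
Qed.

Definition Z3one := MkZ3 Z3one_subproof.
Definition Z3inv w := MkZ3 (Z3inv_subproof w).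
Definition Z3mul v w := MkZ3 (Z3mul_subproof v w).

Lemma Z3mulA : associative Z3mul.
Proof. by move=> u v w; apply/val_inj/ffunP => p; rewrite /= !ffunE mulrA. Qed.
Lemma Z3mulC : commutative Z3mul.
Proof. by move=> v w; apply/val_inj/ffunP => p; rewrite /= !ffunE mulrC. Qed.
Lemma Z3mul1 : left_id Z3one Z3mul.
Proof. by move=> w; apply/val_inj/ffunP => p; rewrite /= !ffunE mul1r. Qed.
Lemma Z3mulV : left_inverse Z3one Z3inv Z3mul.
Proof.
by move=> w; apply/val_inj/ffunP => p; rewrite /= !ffunE mulVf ?Z3_neq0.
Qed.

(* MathComp has abelian quotients only for additively written groups: in [Z3]
   and [H3] the sum [v + w] is the pointwise product of cocycles. *)
HB.instance Definition _ := GRing.isZmodule.Build Z3 Z3mulA Z3mulC Z3mul1 Z3mulV.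

Definition B3 : {pred Z3} := fun w =>
  `[< exists f : gT -> gT -> F, (forall x y, f x y != 0) /\
      forall x y z,
        w (x, y, z) = (f y z * f x (y * z)%g / (f (x * y)%g z * f x y)) >].

Lemma B3_zmod_closed : zmod_closed B3.
Proof.
split.
  apply/asboolP; exists (fun _ _ => 1); split=> [x y|x y z]; first exact: oner_neq0.
  by rewrite /= ffunE !mulr1 invr1 mulr1.
move=> v w /asboolP[f [f0 fE]] /asboolP[h [h0 hE]]; apply/asboolP.
exists (fun x y => f x y / h x y); split=> [x y|x y z].
  by rewrite mulf_neq0 ?invr_eq0 ?f0 ?h0.
rewrite /= !ffunE fE hE; field.
by rewrite !f0 !h0.
Qed.

HB.instance Definition _ := GRing.isZmodClosed.Build Z3 B3 B3_zmod_closed.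

Definition H3 := Quotient.quot B3.
HB.instance Definition _ := GRing.Zmodule.on H3.

Definition class3 (w : Z3) : H3 := \pi_H3 w.

Definition in_2part (u : H3) := exists k : nat, u *+ (2 ^ k) = 0.

Definition two_generator (u : H3) :=
  in_2part u /\ forall v, in_2part v -> exists n : int, v = u *~ n.

Definition contains_two_generator (u : H3) := exists n : int, two_generator (u *~ n).

End Cohomology.

Definition normalized3 (gT : finGroupType) (F : fieldType) (w : Z3 gT F) :=
  forall x y, [/\ w (1%g, x, y) = 1, w (x, 1%g, y) = 1 & w (x, y, 1%g) = 1].

Record nZ3 (gT : finGroupType) (F : fieldType) :=
  MkNZ3 { nZ3cocycle :> Z3 gT F; nZ3P : normalized3 nZ3cocycle }.

(* The coefficient of the basis vector [e_g x] in [u : dbl w] is [u (g, x)]. *)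
Definition dbl (gT : finGroupType) (F : fieldType) (w : nZ3 gT F) : Type :=
  {ffun gT * gT -> F^o}.

Section TwistedDouble.
Variables (gT : finGroupType) (F : fieldType) (w : nZ3 gT F).
Implicit Types (g h x y : gT) (p q : gT * gT).

Definition theta g x y : F :=
  w (g, x, y) * w (x, y, (g ^ (x * y))%g) / w (x, (g ^ x)%g, y).

Definition gamma g x y : F :=
  w (x, y, g) * w (g, (x ^ g)%g, (y ^ g)%g) / w (x, g, (y ^ g)%g).

Lemma theta_neq0 g x y : theta g x y != 0.
Proof. by rewrite !mulf_neq0 ?invr_eq0 ?Z3_neq0. Qed.

Lemma theta_cocycle g x y z :
  theta g x y * theta g (x * y)%g z = theta (g ^ x)%g y z * theta g x (y * z)%g.
Proof.
rewrite /theta !conjgM.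
have E1 := Z3E w g x y z.
have E2 := Z3E w x (g ^ x)%g y z.
have E3 := Z3E w x y ((g ^ x) ^ y)%g z.
have E4 := Z3E w x y z (((g ^ x) ^ y) ^ z)%g.
rewrite -!conjgC in E2 E3 E4.
have mvl (a b c : F) : a != 0 -> c = a * b -> b = c / a.
  by move=> a0 ->; rewrite mulrC mulKf.
have mvr (a b c : F) : b != 0 -> c = a * b -> a = c / b.
  by move=> b0 ->; rewrite mulfK.
rewrite (mvl _ _ _ _ E1) ?Z3_neq0 // (mvl _ _ _ _ E2) ?Z3_neq0 //.
rewrite (mvr _ _ _ _ E3) ?Z3_neq0 // (mvr _ _ _ _ E4) ?Z3_neq0 //.
by field; rewrite !Z3_neq0.
Qed.

Lemma theta1g x y : theta 1%g x y = 1.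
Proof.
have [n1 n2 n3] := nZ3P w x y.
by rewrite /theta !conj1g n1 n2 n3 !mul1r invr1.
Qed.

Lemma theta_1l g x : theta g 1%g x = 1.
Proof.
rewrite /theta mul1g conjg1; have [n1 n2 n3] := nZ3P w g x.
have [n1' _ _] := nZ3P w x (g ^ x)%g.
by rewrite n1' n2 n1 !mulr1 invr1 ?mulr1.
Qed.

Lemma theta_1r g x : theta g x 1%g = 1.
Proof.
rewrite /theta mulg1; have [n1 n2 n3] := nZ3P w g x.
have [_ n2' _] := nZ3P w x (g ^ x)%g.
have [_ _ n3'] := nZ3P w x (g ^ x)%g.
by rewrite n3 n2' n3' !mulr1 invr1 ?mulr1.
Qed.

Local Notation H := (dbl w).

HB.instance Definition _ := Vector.copy H {ffun gT * gT -> F^o}.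

Definition ebas p : H := [ffun q => (q == p)%:R].

Definition ebas_mul p q : H :=
  if (p.1 ^ p.2 == q.1)%g then theta p.1 p.2 q.2 *: ebas (p.1, (p.2 * q.2)%g)
  else 0.

Definition dbl_one : H := \sum_g ebas (g, 1%g).

Definition dbl_mul (u v : H) : H :=
  \sum_p \sum_q (u p * v q) *: ebas_mul p q.

Lemma dblE (u : H) : u = \sum_p u p *: ebas p.
Proof.
apply/ffunP => q; rewrite sum_ffunE (bigD1 q) //= big1 => [|p pq].
  by rewrite !ffunE eqxx addr0 [_ *: _]mulr1.
by rewrite !ffunE eq_sym (negbTE pq) [_ *: _]mulr0.
Qed.

Lemma dbl_mul_linl v : linear (dbl_mul^~ v).
Proof.
move=> a u u'; rewrite /dbl_mul scaler_sumr -big_split; apply: eq_bigr => p _ /=.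
rewrite scaler_sumr -big_split; apply: eq_bigr => q _ /=.
by rewrite !ffunE [a *: u p]/GRing.scale /= mulrDl scalerDl -mulrA scalerA.
Qed.

Lemma dbl_mul_linr u : linear (dbl_mul u).
Proof.
move=> a v v'; rewrite /dbl_mul scaler_sumr -big_split; apply: eq_bigr => p _ /=.
rewrite scaler_sumr -big_split; apply: eq_bigr => q _ /=.
by rewrite !ffunE [a *: v q]/GRing.scale /= mulrDr scalerDl mulrCA scalerA.
Qed.

Lemma dbl_mulb p q : dbl_mul (ebas p) (ebas q) = ebas_mul p q.
Proof.
rewrite /dbl_mul (bigD1 p) //= (bigD1 q) //= !ffunE !eqxx mulr1 scale1r.
rewrite !big1 ?addr0 // => [p' p'p|q' q'q].
  by rewrite big1 // => q' _; rewrite !ffunE (negbTE p'p) mul0r scale0r.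
by rewrite !ffunE (negbTE q'q) mulr0 scale0r.
Qed.

Lemma dbl_mulDl : left_distributive dbl_mul +%R.
Proof. by move=> u u' v; have := dbl_mul_linl v 1 u u'; rewrite !scale1r. Qed.
Lemma dbl_mulDr : right_distributive dbl_mul +%R.
Proof. by move=> u v v'; have := dbl_mul_linr u 1 v v'; rewrite !scale1r. Qed.
Lemma dbl_mul0 u : dbl_mul 0 u = 0.
Proof. by apply: (@addrI _ (dbl_mul 0 u)); rewrite -dbl_mulDl !addr0. Qed.
Lemma dbl_mulu0 u : dbl_mul u 0 = 0.
Proof. by apply: (@addrI _ (dbl_mul u 0)); rewrite -dbl_mulDr !addr0. Qed.
Lemma dbl_mulZl a u v : dbl_mul (a *: u) v = a *: dbl_mul u v.
Proof. by have := dbl_mul_linl v a u 0; rewrite dbl_mul0 !addr0. Qed.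
Lemma dbl_mulZr a u v : dbl_mul u (a *: v) = a *: dbl_mul u v.
Proof. by have := dbl_mul_linr u a v 0; rewrite dbl_mulu0 !addr0. Qed.
Lemma dbl_mul_suml (I : finType) (P : pred I) (f : I -> H) v :
  dbl_mul (\sum_(i | P i) f i) v = \sum_(i | P i) dbl_mul (f i) v.
Proof. exact: (big_morph (dbl_mul^~ v) (fun a b => dbl_mulDl a b v) (dbl_mul0 v)). Qed.
Lemma dbl_mul_sumr (I : finType) (P : pred I) (f : I -> H) u :
  dbl_mul u (\sum_(i | P i) f i) = \sum_(i | P i) dbl_mul u (f i).
Proof. exact: (big_morph (dbl_mul u) (dbl_mulDr u) (dbl_mulu0 u)). Qed.

Lemma ebas_mulA p q r :
  dbl_mul (ebas p) (ebas_mul q r) = dbl_mul (ebas_mul p q) (ebas r).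
Proof.
case: p q r => [g x] [h y] [k z]; rewrite /ebas_mul /=.
have [<-|nk] := eqVneq (h ^ y)%g k; have [nh|nh] := eqVneq (g ^ x)%g h; rewrite -?nh.
- rewrite dbl_mulZl dbl_mulZr !dbl_mulb /ebas_mul /= conjgM !eqxx !scalerA.
  by rewrite mulrC [theta g _ _ * _]mulrC -theta_cocycle mulrC mulgA.
- by rewrite dbl_mul0 dbl_mulZr dbl_mulb /ebas_mul /= (negbTE nh) scaler0.
- by rewrite dbl_mulu0 dbl_mulZl dbl_mulb /ebas_mul /= conjgM nh (negbTE nk) scaler0.
- by rewrite dbl_mul0 dbl_mulu0.
Qed.

Lemma dbl_mulA : associative dbl_mul.
Proof.
move=> u v t; rewrite [u]dblE (dbl_mul_suml _ _ v).
rewrite (dbl_mul_suml _ _ (dbl_mul v t)) (dbl_mul_suml _ _ t).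
apply: eq_bigr => p _; rewrite 3!dbl_mulZl; congr (_ *: _).
rewrite [v]dblE (dbl_mul_suml _ _ t) (dbl_mul_sumr _ _ (ebas p)).
rewrite (dbl_mul_sumr _ _ (ebas p)) (dbl_mul_suml _ _ t).
apply: eq_bigr => q _; rewrite dbl_mulZl 2!dbl_mulZr dbl_mulZl; congr (_ *: _).
rewrite [t]dblE (dbl_mul_sumr _ _ (ebas q)) (dbl_mul_sumr _ _ (ebas p)).
rewrite (dbl_mul_sumr _ _ (dbl_mul _ _)); apply: eq_bigr => r _.
by rewrite 3!dbl_mulZr 2!dbl_mulb ebas_mulA.
Qed.

Lemma dbl_mul1l : left_id dbl_one dbl_mul.
Proof.
move=> u; rewrite {1}[u]dblE [RHS]dblE dbl_mul_sumr; apply: eq_bigr => -[h y] _.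
rewrite dbl_mulZr; congr (_ *: _).
rewrite dbl_mul_suml (bigD1 h) //= dbl_mulb /ebas_mul /= conjg1 eqxx.
rewrite theta_1l scale1r mul1g big1 ?addr0 // => g gh.
by rewrite dbl_mulb /ebas_mul /= conjg1 (negbTE gh).
Qed.

Lemma dbl_mul1r : right_id dbl_one dbl_mul.
Proof.
move=> u; rewrite {1}[u]dblE [RHS]dblE dbl_mul_suml; apply: eq_bigr => -[g x] _.
rewrite dbl_mulZl; congr (_ *: _).
rewrite dbl_mul_sumr (bigD1 (g ^ x)%g) //= dbl_mulb /ebas_mul /= eqxx.
rewrite theta_1r scale1r mulg1 big1 ?addr0 // => h hg.
by rewrite dbl_mulb /ebas_mul /= eq_sym (negbTE hg).
Qed.

Lemma dbl_one_neq0 : dbl_one != 0.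
Proof.
apply/eqP => /ffunP/(_ (1%g, 1%g)); rewrite sum_ffunE !ffunE.
rewrite (bigD1 1%g) //= ffunE eqxx big1 ?addr0 => [/eqP|g g1].
  by rewrite oner_eq0.
by rewrite ffunE xpair_eqE eq_sym (negbTE g1).
Qed.

HB.instance Definition _ := GRing.Zmodule_isNzRing.Build H
  dbl_mulA dbl_mul1l dbl_mul1r dbl_mulDl dbl_mulDr dbl_one_neq0.
HB.instance Definition _ := GRing.Lmodule_isLalgebra.Build F H
  (fun a u v => esym (dbl_mulZl a u v)).
HB.instance Definition _ := GRing.Lalgebra_isAlgebra.Build F H
  (fun a u v => esym (dbl_mulZr a u v)).
HB.instance Definition _ := Algebra_isFalgebra.Build F H.

Definition dbl_eps (u : H) : F := \sum_x u (1%g, x).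

Lemma dbl_eps_scalar : scalar dbl_eps.
Proof.
move=> a u v; rewrite /dbl_eps mulr_sumr -big_split; apply: eq_bigr => x _.
by rewrite !ffunE.
Qed.
HB.instance Definition _ :=
  GRing.isLinear.Build F H F *%R dbl_eps dbl_eps_scalar.

Lemma dbl_eps_ebas p : dbl_eps (ebas p) = (p.1 == 1%g)%:R.
Proof.
case: p => g x; rewrite /dbl_eps (bigD1 x) //= ffunE xpair_eqE eqxx andbT eq_sym.
by rewrite big1 ?addr0 // => y yx; rewrite ffunE xpair_eqE (negbTE yx) andbF.
Qed.

Lemma dbl_eps1 : dbl_eps 1 = 1.
Proof.
have -> : (1 : H) = \sum_g ebas (g, 1%g) by [].
rewrite linear_sum (bigD1 1%g) //= dbl_eps_ebas eqxx.
by rewrite big1 ?addr0 // => g g1; rewrite dbl_eps_ebas (negbTE g1).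
Qed.

Lemma dbl_epsM u v : dbl_eps (u * v) = dbl_eps u * dbl_eps v.
Proof.
rewrite {2}[u]dblE {2}[v]dblE (_ : u * v = \sum_p \sum_q (u p * v q) *: ebas_mul p q) //.
rewrite !linear_sum mulr_suml.
apply: eq_bigr => -[g x] _; rewrite linear_sum mulr_sumr.
apply: eq_bigr => -[h y] _.
rewrite !linearZ /= !dbl_eps_ebas mulrACA; congr (_ * _).
rewrite /ebas_mul /=; case: (eqVneq g 1%g) => [->|g1].
  rewrite conj1g theta1g scale1r mul1r eq_sym.
  by case: ifP => _; rewrite ?linear0 // dbl_eps_ebas eqxx.
rewrite mul0r; case: ifP => _; last exact: linear0.
by rewrite linearZ /= dbl_eps_ebas (negbTE g1) mulr0.
Qed.

Definition Zomega : {set gT} :=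
  [set g in 'Z([set: gT])%g |
    `[< exists f : gT -> F, (forall x, f x != 0) /\
          forall x y, gamma g x y = f x * f y / f (x * y)%g >]].

Definition is_char (chi : gT -> F) :=
  (forall x, chi x != 0) /\ (forall x y, chi (x * y)%g = chi x * chi y).

(* Only the values of [tau] and [nu] at [a \in A] matter. *)
Record admissible_pair (A : {group gT}) := AdmPair {
  ap_tau : gT -> gT -> F;
  ap_nu : gT -> gT -> F;
  ap_Zomega : A \subset Zomega;
  ap_tau_neq0 : forall a, a \in A -> forall x, ap_tau a x != 0;
  ap_tau1 : forall a, a \in A -> ap_tau a 1%g = 1;
  ap_dtau : forall a, a \in A -> forall x y,
    ap_tau a x * ap_tau a y / ap_tau a (x * y)%g = theta a x y;
  ap_nu_char : forall a, a \in A -> is_char (ap_nu a);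
  ap_nu1 : forall g, ap_nu 1%g g = 1;
  ap_nuM : forall a b, a \in A -> b \in A -> forall g,
    ap_nu a g * ap_nu b g / ap_nu (a * b)%g g =
    theta g a b * ap_tau a g * ap_tau b g / ap_tau (a * b)%g g
}.

Definition omega_admissible (A : {group gT}) := exists _ : admissible_pair A, True.

Definition s_elt (A : {group gT}) (P : admissible_pair A) (a : gT) : H :=
  \sum_g (ap_tau P a g * (ap_nu P a g)^-1) *: ebas (g, a).

(* Products and spans of subspaces: [H * S * H] is the two-sided ideal
   generated by [S] since [H] is unital. *)
Definition s_ideal (A : {group gT}) (P : admissible_pair A) : {vspace H} :=
  ({:H} * <<[seq s_elt P a - 1 | a in A]>> * {:H})%VS.

Lemma dbl_eps_ideal A (P : admissible_pair A) u : u \in s_ideal P -> dbl_eps u = 0.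
Proof.
suff K : (s_ideal P <= lker (linfun (dbl_eps : H -> F^o)))%VS.
  by move/subvP: K => K /K; rewrite memv_ker lfunE /= => /eqP.
apply/prodvP => x y xI _; rewrite memv_ker lfunE /= dbl_epsM.
suff /subvP/(_ x xI) : ({:H} * <<[seq s_elt P a - 1 | a in A]>>
     <= lker (linfun (dbl_eps : H -> F^o)))%VS.
  by rewrite memv_ker lfunE /= => /eqP->; rewrite mul0r.
apply/prodvP => {x y xI} x y _ yI; rewrite memv_ker lfunE /= dbl_epsM.
suff /subvP/(_ y yI) : (<<[seq s_elt P a - 1 | a in A]>>
     <= lker (linfun (dbl_eps : H -> F^o)))%VS.
  by rewrite memv_ker lfunE /= => /eqP->; rewrite mulr0.
apply/span_subvP => z; case/mapP => a; rewrite mem_enum => aA ->; rewrite memv_ker lfunE /=.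
rewrite linearB /= dbl_eps1 linear_sum (bigD1 1%g) //= linearZ /= dbl_eps_ebas eqxx.
rewrite big1 => [|g g1]; last by rewrite linearZ /= dbl_eps_ebas (negbTE g1) mulr0.
have [nz nM] := ap_nu_char P aA; have /eqP := nM 1%g 1%g.
rewrite mulg1 -{1}[ap_nu P a 1%g]mulr1 (inj_eq (mulfI (nz _))) => /eqP <-.
by rewrite ap_tau1 // invr1 !mulr1 addr0 subrr.
Qed.

End TwistedDouble.

Record ideal2 (F : fieldType) (H : falgType F) := MkIdeal2 {
  ideal_vs :> {vspace H};
  ideal2_l : ({:H} * ideal_vs <= ideal_vs)%VS;
  ideal2_r : (ideal_vs * {:H} <= ideal_vs)%VS;
  ideal2_1 : 1 \notin ideal_vs
}.

Section AlgQuotient.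
Variables (F : fieldType) (H : falgType F) (J : ideal2 H).

Definition aquot := Quotient.quot (ideal_vs J).
HB.instance Definition _ := GRing.Zmodule.on aquot.

Definition aq_pi (u : H) : aquot := \pi_(Quotient.quot (ideal_vs J)) u.
Definition aq_repr (q : aquot) : H := repr (q : Quotient.quot (ideal_vs J)).

Lemma aq_reprK : cancel aq_repr aq_pi. Proof. exact: reprK. Qed.
Lemma aq_eq u v : (aq_pi u == aq_pi v) = (u - v \in ideal_vs J).
Proof. by rewrite Quotient.idealrBE. Qed.

Lemma aq_piB u v : aq_pi (u - v) = aq_pi u - aq_pi v.
Proof. by rewrite /aq_pi raddfB. Qed.
Lemma aq_piD u v : aq_pi (u + v) = aq_pi u + aq_pi v.
Proof. by rewrite /aq_pi raddfD. Qed.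

Lemma aq_reprP u : aq_repr (aq_pi u) - u \in ideal_vs J.
Proof. by rewrite -aq_eq aq_reprK. Qed.

Lemma aq_ind (P : aquot -> Prop) : (forall u, P (aq_pi u)) -> forall q, P q.
Proof. by move=> Ppi q; rewrite -[q]aq_reprK. Qed.

Definition aq_one : aquot := aq_pi 1.
Definition aq_mul (p q : aquot) : aquot := aq_pi (aq_repr p * aq_repr q).
Definition aq_scale (c : F) (q : aquot) : aquot := aq_pi (c *: aq_repr q).

Lemma aq_piM u v : aq_mul (aq_pi u) (aq_pi v) = aq_pi (u * v).
Proof.
apply/eqP; rewrite aq_eq; set u' := aq_repr _; set v' := aq_repr _.
have -> : u' * v' - u * v = (u' - u) * v' + u * (v' - v).
  by rewrite mulrBl mulrBr addrA subrK.
rewrite memvD //.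
  by apply: (subvP (ideal2_r J)); rewrite memv_mul ?memvf ?aq_reprP.
by apply: (subvP (ideal2_l J)); rewrite memv_mul ?memvf ?aq_reprP.
Qed.

Lemma aq_piZ c u : aq_scale c (aq_pi u) = aq_pi (c *: u).
Proof. by apply/eqP; rewrite aq_eq -scalerBr memvZ ?aq_reprP. Qed.

Lemma aq_mulA : associative aq_mul.
Proof.
by elim/aq_ind => u; elim/aq_ind => v; elim/aq_ind => t; rewrite !aq_piM mulrA.
Qed.
Lemma aq_mul1l : left_id aq_one aq_mul.
Proof. by elim/aq_ind => u; rewrite aq_piM mul1r. Qed.
Lemma aq_mul1r : right_id aq_one aq_mul.
Proof. by elim/aq_ind => u; rewrite aq_piM mulr1. Qed.
Lemma aq_mulDl : left_distributive aq_mul +%R.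
Proof.
elim/aq_ind => u; elim/aq_ind => v; elim/aq_ind => t.
by rewrite -aq_piD !aq_piM mulrDl aq_piD.
Qed.
Lemma aq_mulDr : right_distributive aq_mul +%R.
Proof.
elim/aq_ind => u; elim/aq_ind => v; elim/aq_ind => t.
by rewrite -aq_piD !aq_piM mulrDr aq_piD.
Qed.
Lemma aq_one_neq0 : aq_one != 0.
Proof.
have <- : aq_pi 0 = 0 by rewrite -(subrr (0 : H)) aq_piB subrr.
by rewrite aq_eq subr0 ideal2_1.
Qed.
HB.instance Definition _ := GRing.Zmodule_isNzRing.Build aquot
  aq_mulA aq_mul1l aq_mul1r aq_mulDl aq_mulDr aq_one_neq0.

Lemma aq_scaleA a b q : aq_scale a (aq_scale b q) = aq_scale (a * b) q.
Proof. by elim/aq_ind: q => u; rewrite !aq_piZ scalerA. Qed.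
Lemma aq_scale1 : left_id 1 aq_scale.
Proof. by elim/aq_ind => u; rewrite aq_piZ scale1r. Qed.
Lemma aq_scaleDr : right_distributive aq_scale +%R.
Proof.
move=> a; elim/aq_ind => u; elim/aq_ind => v.
by rewrite -aq_piD !aq_piZ scalerDr aq_piD.
Qed.
Lemma aq_scaleDl q : {morph aq_scale^~ q : a b / a + b}.
Proof. by elim/aq_ind: q => u a b; rewrite !aq_piZ scalerDl aq_piD. Qed.
HB.instance Definition _ := GRing.Zmodule_isLmodule.Build F aquot
  aq_scaleA aq_scale1 aq_scaleDr aq_scaleDl.

Lemma aq_scaleAl a (p q : aquot) : a *: (p * q) = (a *: p) * q.
Proof.
elim/aq_ind: p => u; elim/aq_ind: q => v.
transitivity (aq_pi ((a *: u) * v)).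
  by rewrite -scalerAl -aq_piZ -aq_piM.
by rewrite -aq_piM -aq_piZ.
Qed.
HB.instance Definition _ := GRing.Lmodule_isLalgebra.Build F aquot aq_scaleAl.

Lemma aq_scaleAr a (p q : aquot) : a *: (p * q) = p * (a *: q).
Proof.
elim/aq_ind: p => u; elim/aq_ind: q => v.
transitivity (aq_pi (u * (a *: v))).
  by rewrite -scalerAr -aq_piZ -aq_piM.
by rewrite -aq_piM -aq_piZ.
Qed.
HB.instance Definition _ := GRing.Lalgebra_isAlgebra.Build F aquot aq_scaleAr.

End AlgQuotient.

(* The structure maps of a quasitriangular quasi-Hopf algebra. The axioms that
   are bundled are those needed for the trivial module; the remaining ones do
   not enter the definition of modularity. Elements of [H (x) H] and
   [H (x) H (x) H] are represented by formal sums of pure tensors, i.e. by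
   sequences of pairs and triples. *)
Record qtqh (F : fieldType) := QTQH {
  qh_alg :> algType F;
  qh_eps : {scalar qh_alg};
  qh_eps1 : qh_eps 1 = 1;
  qh_epsM : forall a b, qh_eps (a * b) = qh_eps a * qh_eps b;
  qh_Delta : qh_alg -> seq (qh_alg * qh_alg);
  qh_Phi : seq (qh_alg * qh_alg * qh_alg);
  qh_R : seq (qh_alg * qh_alg);
  qh_S : qh_alg -> qh_alg;
  qh_alpha : qh_alg;
  qh_beta : qh_alg
}.

Section Rep.
Variables (F : fieldType) (H : qtqh F).

(* A finite-dimensional left module, as matrices acting on column vectors. *)
Record rep := MkRep {
  rdim : nat;
  ract :> {linear H -> 'M[F]_rdim};
  ract1 : ract 1 = 1%:M;
  ractM : forall a b, ract (a * b) = ract a *m ract b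
}.

(* The rows of [U] span a subspace of [F^n]; [h] sends the vector [u] of that
   space to [u *m (X h)^T], the transpose of [X h *m u^T]. *)
Definition simple_rep (X : rep) :=
  (0 < rdim X)%N /\
  forall U : 'M[F]_(rdim X),
    (forall h, (U *m (X h)^T <= U)%MS) -> U = 0 \/ row_full U.

Definition iso_rep (X Y : rep) :=
  exists (f : 'M[F]_(rdim Y, rdim X)) (g : 'M[F]_(rdim X, rdim Y)),
    [/\ f *m g = 1%:M, g *m f = 1%:M & forall h, f *m X h = Y h *m f].

Definition unit_act (h : H) : 'M[F]_1 := (qh_eps H h)%:M.
Lemma unit_act_linear : linear unit_act.
Proof. by move=> a u v; rewrite /unit_act linearP raddfD /= scale_scalar_mx. Qed.
HB.instance Definition _ :=
  GRing.isLinear.Build F H 'M[F]_1 *:%R unit_act unit_act_linear.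
Lemma unit_act1 : unit_act 1 = 1%:M.
Proof. by rewrite /unit_act qh_eps1. Qed.
Lemma unit_actM a b : unit_act (a * b) = unit_act a *m unit_act b.
Proof. by rewrite /unit_act qh_epsM scalar_mxM. Qed.
Definition unit_rep : rep := MkRep unit_act1 unit_actM.

(* The vector space of [X (x) Y] is [F^(rdim X * rdim Y)], with the Kronecker
   product [*t] as tensor product of linear maps. *)
Definition tens2_act (X Y : rep) (t : seq (H * H)) : 'M[F]_(rdim X * rdim Y) :=
  \sum_(r <- t) X r.1 *t Y r.2.

(* The module structure on [X (x) Y]. The double braiding below is the
   composite of the underlying linear maps [X (x) Y -> Y (x) X -> X (x) Y]. *)
Definition tens_act (X Y : rep) (h : H) := tens2_act X Y (qh_Delta h).

(* [e_a (x) e_b |-> e_b (x) e_a]. *)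
Definition flip_mx m n : 'M[F]_(n * m, m * n) :=
  \matrix_(i, j) (((mxtens_unindex i).1 == (mxtens_unindex j).2) &&
                  ((mxtens_unindex i).2 == (mxtens_unindex j).1))%:R.

(* [x (x) y |-> flip (R . (x (x) y))]. *)
Definition braiding (X Y : rep) : 'M[F]_(rdim Y * rdim X, rdim X * rdim Y) :=
  flip_mx (rdim X) (rdim Y) *m tens2_act X Y (qh_R H).

Definition transparent (X : rep) :=
  forall Y, simple_rep Y -> braiding Y X *m braiding X Y = 1%:M.

Definition modular :=
  forall X, simple_rep X -> (transparent X <-> iso_rep X unit_rep).

End Rep.

Section DoubleData.
Variables (gT : finGroupType) (F : fieldType) (w : nZ3 gT F).
Local Notation H := (dbl w).
Local Notation e g x := (ebas w (g, x)).

Definition dbl_Delta (u : H) : seq (H * H) :=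
  [seq (let: (h, k, x) := p in
        ((u ((h * k)%g, x) * gamma w x h k) *: e h x, e k x))
  | p : gT * gT * gT].

Definition dbl_Phi : seq (H * H * H) :=
  [seq (let: (g, h, k) := p in ((w (g, h, k))^-1 *: e g 1%g, e h 1%g, e k 1%g))
  | p : gT * gT * gT].

Definition dbl_R : seq (H * H) :=
  [seq (e p.1 1%g, e p.2 p.1) | p : gT * gT].

Definition dbl_S (u : H) : H :=
  \sum_g \sum_x (u (g, x) * (theta w g^-1%g x x^-1%g)^-1
                          * (gamma w x g g^-1%g)^-1)
                 *: e (x^-1 * g^-1 * x)%g x^-1%g.

Definition dbl_beta : H := \sum_g w (g, g^-1%g, g) *: e g 1%g.

Definition Dw : qtqh F :=
  @QTQH F H (dbl_eps (w:=w)) (dbl_eps1 w) (@dbl_epsM gT F w)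
    dbl_Delta dbl_Phi dbl_R dbl_S 1 dbl_beta.

Variables (A : {group gT}) (P : admissible_pair w A).

Lemma s_ideal_l : ({:H} * s_ideal P <= s_ideal P)%VS.
Proof. by rewrite /s_ideal !prodvA prodvSl // prodvSl // subvf. Qed.
Lemma s_ideal_r : (s_ideal P * {:H} <= s_ideal P)%VS.
Proof. by rewrite /s_ideal -!prodvA prodvSr // prodvSr // subvf. Qed.
Lemma s_ideal_1 : 1 \notin s_ideal P.
Proof.
apply/negP => /dbl_eps_ideal /eqP; rewrite dbl_eps1.
by rewrite oner_eq0.
Qed.
Definition s_ideal2 : ideal2 H := MkIdeal2 s_ideal_l s_ideal_r s_ideal_1.

Local Notation Q := (aquot s_ideal2).
Local Notation pi := (aq_pi s_ideal2).

(* The counit, coproduct and antipode of the quotient are computed on a chosen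
   representative; they do not depend on it because [s_ideal] is a quasi-Hopf
   ideal. *)
Definition dblq_eps (q : Q) : F := dbl_eps (aq_repr q).
Lemma dblq_eps_pi u : dblq_eps (pi u) = dbl_eps u.
Proof.
apply/eqP; rewrite -subr_eq0 -linearB; apply/eqP.
exact: (dbl_eps_ideal (aq_reprP s_ideal2 u)).
Qed.
Lemma dblq_eps_scalar : scalar dblq_eps.
Proof.
move=> a; elim/aq_ind => u; elim/aq_ind => v.
have -> : a *: pi u + pi v = pi (a *: u + v) by rewrite aq_piD -aq_piZ.
by rewrite !dblq_eps_pi linearP.
Qed.
HB.instance Definition _ := GRing.isLinear.Build F Q F *%R dblq_eps dblq_eps_scalar.
Lemma dblq_eps1 : dblq_eps 1 = 1.
Proof. by rewrite [1]/(pi 1) dblq_eps_pi dbl_eps1. Qed.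
Lemma dblq_epsM a b : dblq_eps (a * b) = dblq_eps a * dblq_eps b.
Proof.
elim/aq_ind: a => u; elim/aq_ind: b => v.
have -> : pi u * pi v = pi (u * v) by rewrite -aq_piM.
by rewrite !dblq_eps_pi dbl_epsM.
Qed.

Definition DwA : qtqh F :=
  @QTQH F Q dblq_eps dblq_eps1 dblq_epsM
    (fun q => [seq (pi r.1, pi r.2) | r <- dbl_Delta (aq_repr q)])
    [seq (pi r.1.1, pi r.1.2, pi r.2) | r <- dbl_Phi]
    [seq (pi r.1, pi r.2) | r <- dbl_R]
    (fun q => pi (dbl_S (aq_repr q)))
    (pi 1) (pi dbl_beta).

End DoubleData.

(* Main.v *)
Require Import Defs.
From HB Require Import structures.
From mathcomp Require Import all_boot all_order all_algebra all_fingroup all_solvable.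
From mathcomp Require Import zify ring lra.

Set Implicit Arguments.
Unset Strict Implicit.
Unset Printing Implicit Defensive.
Import Order.TTheory GRing.Theory Num.Theory.
Local Open Scope ring_scope.

(** Write [A = {1, z}]. For a normalized cocycle [w] the value [w (z, z, z)] is
    [1] or [-1], and it tells whether the restriction of [w] to [A] is a
    coboundary. Both sides of the equivalence say that this value is [-1].

    Modularity ([modular_iff]). The element [s = s(z)] is central of square 1, so
    the simple modules of the quotient are the simple modules of the double on
    which [s] acts as 1. The double is semisimple ([dbl_semisimple]), hence an
    element that acts as 0 on all of them is annihilated by [1 + s]
    ([quotient_semisimple]). The double braiding is an explicit sum over the
    basis [e_g x], so transparency of a simple module becomes an identity
    between coefficients ([transparent_coef]): either the module is the unit
    module or [e_z] acts on it as 1. There is one candidate of the second kind,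
    the line on which [e_z x] acts by the coefficient of [e_x z] in [s]; there
    [s] acts as [w (z, z, z)^-1]. So the line is a module of the quotient
    exactly when [w (z, z, z) = 1], and it is transparent then, whereas for
    [w (z, z, z) = -1] only the unit module is transparent.

    Classes ([contains_two_generatorE]). The sign is a homomorphism from
    [H^3(G)] to the group of order 2. It is onto ([exists_sign]), its kernel is
    [2 H^3(G)] ([sign0_divide]), and [H^3(G)] is killed by [|G|]. So the 2-part
    is generated by any of its elements of nontrivial sign, and by no other
    element. Translation by a class of nontrivial sign exchanges the two signs,
    which gives the count.

    Admissibility ([admissible_exists]). One needs [tau] with
    [delta tau = theta_z], and a character [nu] whose square is
    [theta_g(z, z) tau(g)^2], which is a character by the shuffle identity.

    The facts [exists_sign], [sign0_divide] and [admissible_exists] descend from a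
    Sylow 2-subgroup, whose index is odd, by transfer. That subgroup has a unique
    involution, so it is cyclic or generalized quaternion
    ([two_group_cohomology]). There [H^2] vanishes and [H^3] is generated by an
    explicit cocycle: the cyclic subgroup of index 2 is treated first, and
    [descent] tells which classes are trivial on it.

    Cohomology is written additively, with values in a divisible abelian group
    [M] with a unique element [half] of order 2. *)

(** * Linear identities in abelian groups *)

(** An equation follows from another one when every atom occurs with the same
    multiplicity on both sides of their difference. Positive and negative
    occurrences are counted apart, in [nat], so that the comparison computes. *)
Inductive zexpr :=
| ZVar of nat | ZNil | ZAdd of zexpr & zexpr | ZOpp of zexpr
| ZMuln of zexpr & nat.

Section ZExpr.
Variable (M : zmodType).

Fixpoint zeval (env : seq M) e := match e with
| ZVar n => nth 0 env n
| ZNil => 0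
| ZAdd a b => zeval env a + zeval env b
| ZOpp a => - zeval env a
| ZMuln a n => zeval env a *+ n
end.

Fixpoint zcount e i : nat * nat := match e with
| ZVar n => (nat_of_bool (i == n)%N, 0%N)
| ZNil => (0, 0)%N
| ZAdd a b => ((zcount a i).1 + (zcount b i).1, (zcount a i).2 + (zcount b i).2)%N
| ZOpp a => ((zcount a i).2, (zcount a i).1)
| ZMuln a n => (n * (zcount a i).1, n * (zcount a i).2)%N
end.

Lemma zevalE env e : zeval env e =
  \sum_(i < size env) (env`_i *+ (zcount e i).1 - env`_i *+ (zcount e i).2).
Proof.
elim: e => [n||a IHa b IHb|a IHa|a IHa n] /=.
- have [ltn|gen] := ltnP n (size env).
    rewrite (bigD1 (Ordinal ltn)) //= eqxx subr0 big1 ?addr0 // => i.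
    by rewrite -val_eqE /= => /negbTE->; rewrite !mulr0n subrr.
  rewrite nth_default // big1 // => i _.
  by rewrite (ltn_eqF (leq_trans (ltn_ord i) gen)) !mulr0n subrr.
- by rewrite big1 // => i _; rewrite !mulr0n subrr.
- rewrite IHa IHb -big_split; apply: eq_bigr => i _ /=.
  by rewrite !mulrnDr opprD addrACA.
- by rewrite IHa -sumrN; apply: eq_bigr => i _; rewrite opprB.
- rewrite IHa -sumrMnl; apply: eq_bigr => i _.
  by rewrite mulrnBl -!mulrnA mulnC [X in _ - _ *+ X]mulnC.
Qed.

Lemma zexpr_lin env l r a b :
  all (fun i => let e := ZAdd (ZAdd l b) (ZOpp (ZAdd r a)) in
                ((zcount e i).1 == (zcount e i).2)%N) (iota 0 (size env)) ->
  zeval env a = zeval env b -> zeval env l = zeval env r.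
Proof.
move=> /allP chk ab; apply: (@addIr _ (zeval env b)).
rewrite -[in RHS]ab; apply/eqP; rewrite -subr_eq0; apply/eqP.
rewrite -[LHS]/(zeval env (ZAdd (ZAdd l b) (ZOpp (ZAdd r a)))) zevalE big1 // => i _.
by rewrite (eqP (chk i _)) ?subrr // mem_iota add0n ltn_ord.
Qed.
End ZExpr.

(* Atoms are compared up to conversion: two notations for one group operation
   may differ in the canonical structures that they mention. *)
Ltac zsame x y := match constr:(tt) with
  | _ => let _ := match constr:(tt) with _ => constr_eq x y end in constr:(true)
  | _ => let _ := constr:(@Logic.eq_refl _ x : x = y) in constr:(true)
  | _ => constr:(false) end.
Ltac zmem x l := lazymatch l with
  | nil => constr:(false)
  | cons ?y ?l' => let b := zsame x y in
      lazymatch b with true => constr:(true) | false => zmem x l' end end.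
Ltac zidx x l := lazymatch l with
  | cons ?y ?l' => let b := zsame x y in
      lazymatch b with true => constr:(O) | false => let n := zidx x l' in constr:(S n) end end.
Ltac zclosed n := lazymatch n with O => idtac | S ?m => zclosed m end.
Ltac zatoms e l := match e with
  | (?a + ?b)%R => let l1 := zatoms a l in zatoms b l1
  | (- ?a)%R => zatoms a l
  | (?a *+ ?n)%R => let _ := match constr:(tt) with _ => zclosed n end in zatoms a l
  | 0%R => constr:(l)
  | _ => match zmem e l with true => constr:(l) | false => constr:(cons e l) end end.
Ltac zreify e l := match e with
  | (?a + ?b)%R => let x := zreify a l in let y := zreify b l in constr:(ZAdd x y)
  | (- ?a)%R => let x := zreify a l in constr:(ZOpp x)
  | (?a *+ ?n)%R => let _ := match constr:(tt) with _ => zclosed n end in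
    let x := zreify a l in constr:(ZMuln x n)
  | 0%R => constr:(ZNil)
  | _ => let n := zidx e l in constr:(ZVar n) end.
(* [zlin H] closes [l = r] when [l - r] is formally [a - b], where [H : a = b]. *)
Ltac zlin H := cbv beta; let tH := type of H in let tH' := eval cbv beta in tH in
  match tH' with @eq ?T ?a ?b => match goal with |- @eq _ ?l ?r =>
    let L0 := zatoms l (@nil T) in let L1 := zatoms r L0 in
    let L2 := zatoms a L1 in let L := zatoms b L2 in
    let l' := zreify l L in let r' := zreify r L in
    let a' := zreify a L in let b' := zreify b L in
    exact (@zexpr_lin _ L l' r' a' b' (erefl true) H) end end.
Ltac zmod := match goal with |- @eq ?T _ _ =>
  let H := fresh in have H : (0 : T) = 0 by []; zlin H end.
Definition zadd (M : zmodType) (a b c d : M) (H1 : a = b) (H2 : c = d) : a + c = b + d :=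
  f_equal2 +%R H1 H2.
Definition zopp (M : zmodType) (a b : M) (H : a = b) : - a = - b := f_equal -%R H.

(** * Inhomogeneous and homogeneous cochains *)

Section Cochains.
Variables (gT : finGroupType) (M : zmodType).
Implicit Types (H K : {group gT}).

Definition character (K : {set gT}) (chi : gT -> M) :=
  forall x y, x \in K -> y \in K -> chi (x * y)%g = chi x + chi y.

Definition cocycle2_on (K : {set gT}) (a : gT -> gT -> M) :=
  forall x y z, x \in K -> y \in K -> z \in K ->
    a y z + a x (y * z)%g = a (x * y)%g z + a x y.

Definition cobound2_on (K : {set gT}) (a : gT -> gT -> M) :=
  exists f : gT -> M, forall x y, x \in K -> y \in K ->
    a x y = f x + f y - f (x * y)%g.

Definition cocycle3_on (K : {set gT}) (w : gT -> gT -> gT -> M) :=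
  forall x y z t, x \in K -> y \in K -> z \in K -> t \in K ->
    w y z t + w x (y * z)%g t + w x y z = w (x * y)%g z t + w x y (z * t)%g.

Definition cobound3_on (K : {set gT}) (w : gT -> gT -> gT -> M) :=
  exists f : gT -> gT -> M, forall x y z, x \in K -> y \in K -> z \in K ->
    w x y z = f y z + f x (y * z)%g - (f (x * y)%g z + f x y).

Definition cohomologous3 (K : {set gT}) (w v : gT -> gT -> gT -> M) :=
  cobound3_on K (fun x y z => w x y z - v x y z).

(** A homogeneous cochain is a function of tuples of group elements. Cochains on
    a group [K] correspond to those invariant under left translation by [K];
    invariance under a smaller group [H] gives a complex that computes the
    cohomology of [H], and this is what transfer and descent exploit. *)
Definition homog2 (a : gT -> gT -> M) g0 g1 g2 := a (g0^-1 * g1)%g (g1^-1 * g2)%g.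
Definition homog3 (w : gT -> gT -> gT -> M) g0 g1 g2 g3 :=
  w (g0^-1 * g1)%g (g1^-1 * g2)%g (g2^-1 * g3)%g.

Definition hdelta1 (u : gT -> gT -> M) g0 g1 g2 := u g1 g2 - u g0 g2 + u g0 g1.
Definition hdelta2 (u : gT -> gT -> gT -> M) g0 g1 g2 g3 :=
  u g1 g2 g3 - u g0 g2 g3 + u g0 g1 g3 - u g0 g1 g2.
Definition hdelta3 (u : gT -> gT -> gT -> gT -> M) g0 g1 g2 g3 g4 :=
  u g1 g2 g3 g4 - u g0 g2 g3 g4 + u g0 g1 g3 g4 - u g0 g1 g2 g4 + u g0 g1 g2 g3.

Definition invariant1 (H K : {set gT}) (u : gT -> M) := forall h g0,
  h \in H -> g0 \in K -> u (h * g0)%g = u g0.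
Definition invariant2 (H K : {set gT}) (u : gT -> gT -> M) := forall h g0 g1,
  h \in H -> g0 \in K -> g1 \in K -> u (h * g0)%g (h * g1)%g = u g0 g1.
Definition invariant3 (H K : {set gT}) (u : gT -> gT -> gT -> M) := forall h g0 g1 g2,
  h \in H -> g0 \in K -> g1 \in K -> g2 \in K ->
  u (h * g0)%g (h * g1)%g (h * g2)%g = u g0 g1 g2.
Definition invariant4 (H K : {set gT}) (u : gT -> gT -> gT -> gT -> M) := forall h g0 g1 g2 g3,
  h \in H -> g0 \in K -> g1 \in K -> g2 \in K -> g3 \in K ->
  u (h * g0)%g (h * g1)%g (h * g2)%g (h * g3)%g = u g0 g1 g2 g3.

Definition closed2 (K : {set gT}) (u : gT -> gT -> gT -> M) := forall g0 g1 g2 g3,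
  g0 \in K -> g1 \in K -> g2 \in K -> g3 \in K -> hdelta2 u g0 g1 g2 g3 = 0.
Definition closed3 (K : {set gT}) (u : gT -> gT -> gT -> gT -> M) := forall g0 g1 g2 g3 g4,
  g0 \in K -> g1 \in K -> g2 \in K -> g3 \in K -> g4 \in K -> hdelta3 u g0 g1 g2 g3 g4 = 0.

Lemma quotM (h g0 g1 : gT) : ((h * g0)^-1 * (h * g1) = g0^-1 * g1)%g.
Proof. by rewrite invMg -mulgA mulKg. Qed.

Lemma homog1_invariant a (A B : {set gT}) : invariant2 A B (fun g0 g1 => a (g0^-1 * g1)%g).
Proof. by move=> h g0 g1 *; rewrite quotM. Qed.
Lemma homog2_invariant a (A B : {set gT}) : invariant3 A B (homog2 a).
Proof. by move=> h g0 g1 g2 *; rewrite /homog2 !quotM. Qed.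
Lemma homog3_invariant a (A B : {set gT}) : invariant4 A B (homog3 a).
Proof. by move=> h g0 g1 g2 g3 *; rewrite /homog3 !quotM. Qed.

Lemma chainM (g0 g1 g2 : gT) : (g0^-1 * g1 * (g1^-1 * g2) = g0^-1 * g2)%g.
Proof. by rewrite mulgA mulgK. Qed.

Lemma homog2_closed K a : cocycle2_on K a -> closed2 K (homog2 a).
Proof.
move=> az g0 g1 g2 g3 K0 K1 K2 K3; rewrite /hdelta2 /homog2.
have := az (g0^-1 * g1)%g (g1^-1 * g2)%g (g2^-1 * g3)%g.
rewrite !chainM !groupM ?groupV // => /(_ isT isT isT) E; zlin E.
Qed.

Lemma homog3_closed K w : cocycle3_on K w -> closed3 K (homog3 w).
Proof.
move=> wz g0 g1 g2 g3 g4 K0 K1 K2 K3 K4; rewrite /hdelta3 /homog3.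
have := wz (g0^-1 * g1)%g (g1^-1 * g2)%g (g2^-1 * g3)%g (g3^-1 * g4)%g.
rewrite !chainM !groupM ?groupV // => /(_ isT isT isT isT) E; zlin E.
Qed.

Lemma cobound2_homog K a D : invariant2 K K D ->
  (forall g0 g1 g2, g0 \in K -> g1 \in K -> g2 \in K -> homog2 a g0 g1 g2 = hdelta1 D g0 g1 g2) ->
  cobound2_on K a.
Proof.
move=> Di aE; exists (fun x => D 1%g x) => x y Kx Ky.
have := aE 1%g x (x * y)%g (group1 K) Kx (groupM Kx Ky).
rewrite /homog2 /hdelta1 invg1 !mul1g mulKg => ->.
have := Di x 1%g y Kx; rewrite mulg1 => ->//; zmod.
Qed.

Lemma cobound3_homog K w B : invariant3 K K B ->
  (forall g0 g1 g2 g3, g0 \in K -> g1 \in K -> g2 \in K -> g3 \in K ->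
     homog3 w g0 g1 g2 g3 = hdelta2 B g0 g1 g2 g3) ->
  cobound3_on K w.
Proof.
move=> Bi wE; exists (fun x y => B 1%g x (x * y)%g) => x y z Kx Ky Kz.
have := wE 1%g x (x * y)%g (x * y * z)%g (group1 K) Kx (groupM Kx Ky) (groupM (groupM Kx Ky) Kz).
rewrite /homog3 /hdelta2 invg1 !mul1g !mulKg => ->.
have := Bi x 1%g y (y * z)%g Kx; rewrite mulg1 !mulgA => ->//; last exact: groupM.
zmod.
Qed.

Lemma homog2_cobound K a f g0 g1 g2 : g0 \in K -> g1 \in K -> g2 \in K ->
  (forall x y, x \in K -> y \in K -> a x y = f x + f y - f (x * y)%g) ->
  homog2 a g0 g1 g2 = hdelta1 (fun g0 g1 => f (g0^-1 * g1)%g) g0 g1 g2.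
Proof.
move=> K0 K1 K2 aE; rewrite /homog2 /hdelta1 aE ?groupM ?groupV // chainM; zmod.
Qed.

Lemma homog3_cobound K w f g0 g1 g2 g3 : g0 \in K -> g1 \in K -> g2 \in K -> g3 \in K ->
  (forall x y z, x \in K -> y \in K -> z \in K ->
     w x y z = f y z + f x (y * z)%g - (f (x * y)%g z + f x y)) ->
  homog3 w g0 g1 g2 g3 = hdelta2 (homog2 f) g0 g1 g2 g3.
Proof.
move=> K0 K1 K2 K3 wE; rewrite /homog3 /hdelta2 /homog2 wE ?groupM ?groupV // !chainM; zmod.
Qed.

(** The representatives of the right cosets split [g] into a product of an
    element of [H] and a representative; [retract H g] is the first factor. It is
    locked: rewriting with group identities must not reach inside. *)
Fact retract_key : unit. Proof. exact: tt. Qed.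
Definition retract (H : {set gT}) g :=
  locked_with retract_key (g * (repr (H :* g)%g)^-1)%g.

Lemma retractM H h g : h \in H -> retract H (h * g) = (h * retract H g)%g.
Proof. by move=> Hh; rewrite /retract !locked_withE rcosetM (rcoset_id Hh) mulgA. Qed.
Lemma retract_in H g : retract H g \in H.
Proof.
rewrite /retract locked_withE.
have : (repr (H :* g) \in H :* g)%g by apply: mem_repr (rcoset_refl _ _).
by rewrite mem_rcoset -groupV invMg invgK.
Qed.

Section Relative.
Variables (H K : {group gT}).
Hypothesis sHK : H \subset K.
Local Notation r := (retract H).
Let rK g : r g \in K. Proof. exact: (subsetP sHK _ (retract_in H g)). Qed.
Let HK h : h \in H -> h \in K. Proof. exact: (subsetP sHK). Qed.

(** Replacing all arguments by their retractions is an [H]-equivariant chain map,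
    homotopic to the identity; the prisms are the homotopy. *)
Definition prism2 (u : gT -> gT -> gT -> M) g0 g1 := u (r g0) g0 g1 - u (r g0) (r g1) g1.
Definition prism3 (u : gT -> gT -> gT -> gT -> M) g0 g1 g2 :=
  u (r g0) g0 g1 g2 - u (r g0) (r g1) g1 g2 + u (r g0) (r g1) (r g2) g2.

Lemma prism2_invariant u : invariant3 H K u -> invariant2 H K (prism2 u).
Proof. by move=> ui h g0 g1 *; rewrite /prism2 !retractM // !ui // ?rK. Qed.
Lemma prism3_invariant u : invariant4 H K u -> invariant3 H K (prism3 u).
Proof. by move=> ui h g0 g1 g2 *; rewrite /prism3 !retractM // !ui // ?rK. Qed.

Lemma prism2P u g0 g1 g2 : closed2 K u -> g0 \in K -> g1 \in K -> g2 \in K ->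
  u g0 g1 g2 = u (r g0) (r g1) (r g2) + hdelta1 (prism2 u) g0 g1 g2.
Proof.
move=> uz K0 K1 K2.
have E1 := uz _ _ _ _ (rK g0) K0 K1 K2.
have E2 := uz _ _ _ _ (rK g0) (rK g1) K1 K2.
have E3 := uz _ _ _ _ (rK g0) (rK g1) (rK g2) K2.
rewrite /hdelta2 in E1 E2 E3; rewrite /hdelta1 /prism2.
zlin (zadd E1 (zadd (zopp E2) E3)).
Qed.

Lemma prism3P u g0 g1 g2 g3 : closed3 K u ->
  g0 \in K -> g1 \in K -> g2 \in K -> g3 \in K ->
  u g0 g1 g2 g3 = u (r g0) (r g1) (r g2) (r g3) + hdelta2 (prism3 u) g0 g1 g2 g3.
Proof.
move=> uz K0 K1 K2 K3.
have E1 := uz _ _ _ _ _ (rK g0) K0 K1 K2 K3.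
have E2 := uz _ _ _ _ _ (rK g0) (rK g1) K1 K2 K3.
have E3 := uz _ _ _ _ _ (rK g0) (rK g1) (rK g2) K2 K3.
have E4 := uz _ _ _ _ _ (rK g0) (rK g1) (rK g2) (rK g3) K3.
rewrite /hdelta3 in E1 E2 E3 E4; rewrite /hdelta2 /prism3.
zlin (zadd E1 (zadd (zopp E2) (zadd E3 (zopp E4)))).
Qed.

(** Restriction to [H] is injective on the cohomology of the [H]-invariant
    cochains on [K]: a primitive on [H] is pulled back along the retraction, and
    the prism corrects it. *)
Lemma invariant_primitive2 u f : closed2 K u -> invariant3 H K u -> invariant2 H H f ->
  (forall g0 g1 g2, g0 \in H -> g1 \in H -> g2 \in H -> u g0 g1 g2 = hdelta1 f g0 g1 g2) ->
  exists2 D, invariant2 H K D & forall g0 g1 g2, g0 \in K -> g1 \in K -> g2 \in K ->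
    u g0 g1 g2 = hdelta1 D g0 g1 g2.
Proof.
move=> uz ui fi uE; exists (fun g0 g1 => f (r g0) (r g1) + prism2 u g0 g1).
  by move=> h g0 g1 *; rewrite !retractM // fi ?retract_in // prism2_invariant.
move=> g0 g1 g2 K0 K1 K2; rewrite prism2P // uE ?retract_in // /hdelta1; zmod.
Qed.

Lemma invariant_primitive3 u f : closed3 K u -> invariant4 H K u -> invariant3 H H f ->
  (forall g0 g1 g2 g3, g0 \in H -> g1 \in H -> g2 \in H -> g3 \in H ->
     u g0 g1 g2 g3 = hdelta2 f g0 g1 g2 g3) ->
  exists2 D, invariant3 H K D & forall g0 g1 g2 g3,
    g0 \in K -> g1 \in K -> g2 \in K -> g3 \in K -> u g0 g1 g2 g3 = hdelta2 D g0 g1 g2 g3.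
Proof.
move=> uz ui fi uE; exists (fun g0 g1 g2 => f (r g0) (r g1) (r g2) + prism3 u g0 g1 g2).
  by move=> h g0 g1 g2 *; rewrite !retractM // fi ?retract_in // prism3_invariant.
move=> g0 g1 g2 g3 K0 K1 K2 K3; rewrite prism3P // uE ?retract_in // /hdelta2; zmod.
Qed.

Definition coset_sum (F : gT -> M) := \sum_(X in rcosets H K) F (repr X).

Lemma repr_rcosets X : X \in rcosets H K -> repr X \in K /\ X = (H :* repr X)%g.
Proof.
case/rcosetsP => x Kx ->; have := mem_repr _ (rcoset_refl H x).
move=> HX; split; last by rewrite (rcoset_eqP HX).
by case/rcosetP: HX => h /HK Kh ->; rewrite groupM.
Qed.

(** The sum depends only on the cosets, which translation by [x] permutes. *)
Lemma coset_sum_shift F x : invariant1 H K F -> x \in K ->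
  coset_sum (fun t => F (t * x)%g) = coset_sum F.
Proof.
move=> Fi Kx; rewrite /coset_sum [RHS](reindex_onto (fun X => X :* x)%g (fun X => X :* x^-1)%g).
  apply: eq_big => [X|X HX].
    rewrite -rcosetM mulgV mulg1 eqxx andbT.
    apply/idP/idP => /rcosetsP[y Ky E].
      by apply/rcosetsP; exists (y * x)%g; rewrite ?groupM // E rcosetM.
    apply/rcosetsP; exists (y * x^-1)%g; rewrite ?groupM ?groupV //.
    by rewrite rcosetM -E -rcosetM mulgV mulg1.
  have [KX XE] := repr_rcosets HX; set t := repr X in KX XE *.
  have : (repr (X :* x) \in H :* (t * x))%g by rewrite rcosetM -XE; apply: (mem_repr (t * x)%g);
    rewrite XE -rcosetM rcoset_refl.
  by case/rcosetP => h Hh ->; rewrite Fi // groupM.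
by move=> X _; rewrite -rcosetM mulVg mulg1.
Qed.

Lemma coset_sum_const F c : (forall g, g \in K -> F g = c) -> coset_sum F = c *+ #|K : H|%g.
Proof.
move=> Fc; rewrite /coset_sum (eq_bigr (fun=> c)) ?sumr_const //.
by move=> X /repr_rcosets[KX _]; rewrite Fc.
Qed.

Lemma eq_coset_sum F F' : (forall g, g \in K -> F g = F' g) -> coset_sum F = coset_sum F'.
Proof. by move=> E; apply: eq_bigr => X /repr_rcosets[KX _]; apply: E. Qed.

Lemma coset_sumD F F' : coset_sum (fun t => F t + F' t) = coset_sum F + coset_sum F'.
Proof. exact: big_split. Qed.
Lemma coset_sumN F : coset_sum (fun t => - F t) = - coset_sum F.
Proof. exact: sumrN. Qed.

End Relative.
End Cochains.

(** * Transfer *)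

Section Transfer.
Variables (gT : finGroupType) (M : zmodType) (H K : {group gT}).
Hypothesis sHK : H \subset K.
Local Notation r := (retract H).
Let HK h : h \in H -> h \in K. Proof. exact: (subsetP sHK). Qed.
Let sum := @coset_sum gT M H K.
Local Notation m := #|K : H|%g.

(** Pull back along the retraction, then average over cosets. *)
Definition transfer1 (chi : gT -> M) x := sum (fun t => chi ((r t)^-1 * r (t * x))%g).

Definition transfer3 (v : gT -> gT -> gT -> M) x y z :=
  sum (fun t => homog3 v (r t) (r (t * x)%g) (r (t * (x * y))%g) (r (t * (x * y * z))%g)).

Lemma transfer1_char chi : character H chi -> character K (transfer1 chi).
Proof.
move=> chiM x y Kx Ky; rewrite /transfer1.
rewrite -[X in _ + X](coset_sum_shift (F := fun t => chi ((r t)^-1 * r (t * y))%g) sHK _ Kx).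
  rewrite -coset_sumD; apply: eq_coset_sum => // t Kt /=.
  by rewrite -chiM ?groupM ?groupV ?retract_in // chainM mulgA.
by move=> h g Hh Kg /=; rewrite -mulgA !(retractM _ Hh) // quotM.
Qed.

Lemma transfer1_res chi x : character K chi -> x \in K -> transfer1 chi x = chi x *+ m.
Proof.
move=> chiM Kx.
have rK g : r g \in K by apply/HK/retract_in.
have chi1 : chi 1%g = 0.
  by apply: (@addrI _ (chi 1%g)); rewrite -chiM ?group1 // mulg1 addr0.
have chiV g : g \in K -> chi g^-1%g = - chi g.
  by move=> Kg; apply/eqP; rewrite -addr_eq0 -chiM ?groupV // mulVg chi1.
pose F t := chi (r t) - chi t.
have Fi : invariant1 H K F.
  move=> h g Hh Kg; have Kh := HK Hh; rewrite /F (retractM _ Hh) !chiM //; zmod.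
rewrite -(coset_sum_const sHK (F := fun=> chi x)) //.
have -> : transfer1 chi x = sum (fun t => F (t * x)%g - F t + chi x).
  apply: eq_coset_sum => // t Kt; rewrite /F chiM ?groupV // chiV // chiM //; zmod.
by rewrite /sum coset_sumD coset_sumD coset_sumN coset_sum_shift // subrr add0r.
Qed.

Lemma homog3_inhom (U : gT -> gT -> gT -> gT -> M) g0 g1 g2 g3 : invariant4 K K U ->
  g0 \in K -> g1 \in K -> g2 \in K -> g3 \in K ->
  homog3 (fun x y z => U 1%g x (x * y)%g (x * y * z)%g) g0 g1 g2 g3 = U g0 g1 g2 g3.
Proof.
move=> Ui K0 K1 K2 K3; rewrite /homog3 !chainM.
by rewrite -{1}(mulVg g0) Ui ?groupV.
Qed.

Lemma inhom_cocycle3 (U : gT -> gT -> gT -> gT -> M) : closed3 K U -> invariant4 K K U ->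
  cocycle3_on K (fun x y z => U 1%g x (x * y)%g (x * y * z)%g).
Proof.
move=> Uz Ui x y z t Kx Ky Kz Kt.
have := Uz _ _ _ _ _ (group1 K) Kx (groupM Kx Ky) (groupM (groupM Kx Ky) Kz)
  (groupM (groupM (groupM Kx Ky) Kz) Kt).
have := Ui x 1%g y (y * z)%g (y * z * t)%g Kx (group1 K) Ky (groupM Ky Kz)
  (groupM (groupM Ky Kz) Kt).
rewrite /hdelta3 !mulgA mulg1 => -> E; zlin E.
Qed.

Section HomTransfer.
Variable U : gT -> gT -> gT -> gT -> M.
Hypothesis Ui : invariant4 H K U.
Definition coset_transfer3 g0 g1 g2 g3 := sum (fun t => U (t * g0) (t * g1) (t * g2) (t * g3))%g.
Lemma coset_transfer3_invariant : invariant4 K K coset_transfer3.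
Proof.
move=> k g0 g1 g2 g3 Kk K0 K1 K2 K3; rewrite /coset_transfer3.
rewrite -[RHS](coset_sum_shift sHK _ Kk) => [|h g Hh Kg].
  by apply: eq_coset_sum => // t Kt; rewrite !mulgA.
by rewrite -!mulgA Ui // groupM.
Qed.
Lemma coset_transfer3_closed : closed3 K U -> closed3 K coset_transfer3.
Proof.
move=> Uz g0 g1 g2 g3 g4 K0 K1 K2 K3 K4.
rewrite /hdelta3 /coset_transfer3 -!coset_sumN -!coset_sumD -[RHS](mul0rn _ m).
by apply: coset_sum_const => // t Kt; apply: Uz; rewrite groupM.
Qed.
End HomTransfer.

Let rU (v : gT -> gT -> gT -> M) g0 g1 g2 g3 := homog3 v (r g0) (r g1) (r g2) (r g3).
Let rUi v : invariant4 H K (rU v).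
Proof.
move=> h g0 g1 g2 g3 Hh *; rewrite /rU !(retractM _ Hh) //.
by apply: (@homog3_invariant _ _ v H H); rewrite ?retract_in.
Qed.

Lemma transfer3E v x y z : transfer3 v x y z = coset_transfer3 (rU v) 1%g x (x * y)%g (x * y * z)%g.
Proof. by apply: eq_coset_sum => // t Kt; rewrite mulg1. Qed.

Lemma transfer3_cocycle v : cocycle3_on H v -> cocycle3_on K (transfer3 v).
Proof.
move=> vz x y z t Kx Ky Kz Kt; rewrite !transfer3E.
apply: (@inhom_cocycle3 (coset_transfer3 (rU v))) => //; last exact: coset_transfer3_invariant.
apply: coset_transfer3_closed => g0 g1 g2 g3 g4 *.
by apply: (homog3_closed vz); apply: retract_in.
Qed.

(** On the homogeneous side [w] is cohomologous, through an [H]-invariant cochain,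
    to the pullback of [v] along the retraction; summing the translates over the
    cosets multiplies the [K]-invariant [w] by the index. *)
Lemma transfer3_res w v : cocycle3_on K w -> cohomologous3 H w v ->
  cohomologous3 K (fun x y z => w x y z *+ m) (transfer3 v).
Proof.
move=> wz [f fE].
pose fr g0 g1 g2 := homog2 f (r g0) (r g1) (r g2).
pose B g0 g1 g2 := fr g0 g1 g2 + prism3 H (homog3 w) g0 g1 g2.
have Bi : invariant3 H K B.
  move=> h g0 g1 g2 Hh K0 K1 K2; rewrite /B; congr (_ + _).
    by rewrite /fr !(retractM _ Hh) // (@homog2_invariant _ _ f H H) ?retract_in.
  by apply: (@prism3_invariant _ _ H K) => //; apply: homog3_invariant.
have BE g0 g1 g2 g3 : g0 \in K -> g1 \in K -> g2 \in K -> g3 \in K ->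
    homog3 w g0 g1 g2 g3 = rU v g0 g1 g2 g3 + hdelta2 B g0 g1 g2 g3.
  move=> K0 K1 K2 K3; rewrite (prism3P sHK (homog3_closed wz)) // /rU.
  have := @homog3_cobound _ _ H (fun x y z => w x y z - v x y z) f
    (r g0) (r g1) (r g2) (r g3).
  rewrite !retract_in => /(_ isT isT isT isT fE) E.
  rewrite /homog3 /hdelta2 -!/(homog3 _ _ _ _ _) in E *; rewrite /B /fr.
  have E' : homog3 w (r g0) (r g1) (r g2) (r g3) - homog3 v (r g0) (r g1) (r g2) (r g3) =
    homog2 f (r g1) (r g2) (r g3) - homog2 f (r g0) (r g2) (r g3) +
      homog2 f (r g0) (r g1) (r g3) - homog2 f (r g0) (r g1) (r g2) by [].
  rewrite /homog3 in E' *.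
  zlin E'.
apply: (@cobound3_homog _ _ _ _ (fun g0 g1 g2 => sum (fun t => B (t * g0) (t * g1) (t * g2))%g)).
  move=> k g0 g1 g2 Kk K0 K1 K2.
  rewrite -[RHS](coset_sum_shift sHK _ Kk) => [|h g Hh Kg].
    by apply: eq_coset_sum => // t Kt; rewrite !mulgA.
  by rewrite -!mulgA Bi // groupM.
move=> g0 g1 g2 g3 K0 K1 K2 K3; rewrite {1}/homog3.
have -> : transfer3 v (g0^-1 * g1)%g (g1^-1 * g2)%g (g2^-1 * g3)%g = coset_transfer3 (rU v) g0 g1 g2 g3.
  rewrite -(homog3_inhom (coset_transfer3_invariant (@rUi v))) // /homog3 transfer3E //.
apply: (canLR (addrK _)).
rewrite /hdelta2 /coset_transfer3 -!coset_sumN -!coset_sumD.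
rewrite -(coset_sum_const sHK (F := fun=> w (g0^-1 * g1)%g (g1^-1 * g2)%g (g2^-1 * g3)%g)) //.
apply: eq_coset_sum => // t Kt.
have := BE _ _ _ _ (groupM Kt K0) (groupM Kt K1) (groupM Kt K2) (groupM Kt K3).
rewrite {1}/homog3 !quotM /hdelta2 => E; zlin E.
Qed.

(** Central arguments commute with the coset representatives, so every summand
    is the value of [v] itself. *)
Lemma transfer3_central v x y z : x \in H -> y \in H -> z \in H ->
  (forall t, t \in K -> commute x t) -> (forall t, t \in K -> commute y t) ->
  (forall t, t \in K -> commute z t) -> transfer3 v x y z = v x y z *+ m.
Proof.
move=> Hx Hy Hz cx cy cz; apply: coset_sum_const => // t Kt.
have cxy : commute (x * y)%g t by apply/commute_sym/commuteM; apply/commute_sym; auto.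
have cxyz : commute (x * y * z)%g t by apply/commute_sym/commuteM; apply/commute_sym; auto.
rewrite -cx // -cxy -cxyz.
rewrite (retractM t Hx) (retractM t (groupM Hx Hy)) (retractM t (groupM (groupM Hx Hy) Hz)).
have Kr : retract H t \in K by apply/HK/retract_in.
have cJ u : commute u (retract H t) -> ((retract H t)^-1 * (u * retract H t) = u)%g.
  by move=> ->; rewrite mulKg.
rewrite /homog3 cJ; last by apply: cx.
rewrite -[(x * y * retract H t)%g]mulgA quotM cJ; last by apply: cy.
rewrite mulgA -[(x * y * z * retract H t)%g]mulgA quotM cJ //; exact: cz.
Qed.

End Transfer.

Section Transfer2.
Variables (gT : finGroupType) (M : zmodType) (H K : {group gT}).
Hypothesis sHK : H \subset K.
(** Summing the translates of an [H]-invariant primitive over the cosets gives a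
    [K]-invariant primitive of the multiple by the index. *)
Lemma cobound2_transfer (a : gT -> gT -> M) : cocycle2_on K a -> cobound2_on H a ->
  cobound2_on K (fun x y => a x y *+ #|K : H|%g).
Proof.
move=> az [f fE].
have [|h g0 g1 Hh H0 H1|g0 g1 g2 H0 H1 H2|D Di DE] :=
   @invariant_primitive2 _ _ H K sHK (homog2 a) (fun g0 g1 => f (g0^-1 * g1)%g) (homog2_closed az).
- by move=> h g0 g1 g2 *; rewrite /homog2 !quotM.
- by rewrite quotM.
- exact: (homog2_cobound (K := H)).
pose D' g0 g1 := coset_sum H K (fun t => D (t * g0) (t * g1))%g.
apply: (@cobound2_homog _ _ _ _ D').
  move=> k g0 g1 Kk K0 K1; rewrite /D'.
  rewrite -[RHS](coset_sum_shift sHK _ Kk) => [|h g Hh Kg].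
    by apply: eq_coset_sum => // t Kt; rewrite !mulgA.
  by rewrite -!mulgA Di // groupM.
move=> g0 g1 g2 K0 K1 K2; rewrite /hdelta1 /D' -!coset_sumN -!coset_sumD.
rewrite /homog2 -(coset_sum_const sHK (F := fun=> a (g0^-1 * g1)%g (g1^-1 * g2)%g)) //.
apply: eq_coset_sum => // t Kt.
by have := DE _ _ _ (groupM Kt K0) (groupM Kt K1) (groupM Kt K2); rewrite /homog2 !quotM.
Qed.
End Transfer2.

(** * Descent from a subgroup of index two *)

Section IndexTwo.
Variables (gT : finGroupType) (S C : {group gT}).
Hypotheses (sCS : C \subset S) (indC : #|S : C|%g = 2%N).

Lemma index2_mem s t : s \in S -> t \in S -> (s * t \in C)%g = ((s \in C) == (t \in C)).
Proof.
move=> Ss St; have [Cs|nCs] := boolP (s \in C); first by rewrite groupMl //; case: (t \in C).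
have [Ct|nCt] := boolP (t \in C); first by rewrite groupMr // (negbTE nCs).
have dCt : [disjoint (C :* t^-1)%g & C].
  rewrite disjoint_subset; apply/subsetP => x /rcosetP[c Cc ->]; rewrite inE /=.
  by rewrite groupMl // groupV.
have E : (C :* t^-1)%g = S :\: C.
  apply/eqP; rewrite eqEcard subsetD dCt card_rcoset cardsD (setIidPr sCS).
  rewrite -(Lagrange sCS) indC mulnC mul2n -addnn addnK leqnn andbT andbT.
  by apply/subsetP => x /rcosetP[c Cc ->]; rewrite groupM ?groupV // (subsetP sCS).
have : s \in (C :* t^-1)%g by rewrite E inE nCs.
by rewrite mem_rcoset invgK => ->.
Qed.

Lemma index2_out : exists2 y, y \in S & y \notin C.
Proof.
have : ~~ (S \subset C) by rewrite -indexg_eq1 indC.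
by case/subsetPn => y Sy nCy; exists y.
Qed.

Section Descent.
Variable M : zmodType.
Hypothesis H2C : forall a : gT -> gT -> M, cocycle2_on C a -> cobound2_on C a.

(** The part of the spectral sequence of [C] in [S] that survives when [H^2(C)]
    vanishes and [w] is trivial on [C]. Let [B] be a [C]-invariant primitive of
    [w], and [y] outside [C]. The defect [y.B - B] of invariance is closed and
    [C]-invariant, hence [d D] with [D] invariant under [C]. Then [D + y.D] is
    closed, and it is [S]-invariant since [y ^ 2] lies in [C]: it is a character
    [chi]. Repairing [B] with [D] turns [w] into the product of [chi] with the
    carry cocycle of the quotient of [S] by [C], a group of order two. *)
Theorem descent (w : gT -> gT -> gT -> M) : cocycle3_on S w -> cobound3_on C w ->
  exists2 chi, character S chi & cohomologous3 S w
    (fun s t u => if (s \notin C) && (t \notin C) then chi u else 0).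
Proof.
move=> wz [f fE].
have CS c : c \in C -> c \in S := subsetP sCS c.
have [y Sy nCy] := index2_out.
have Syg g : g \in S -> (y * g)%g \in S by apply: groupM.
have Cyy : (y * y \in C)%g by rewrite index2_mem // eqxx.
have Cy g : g \in S -> (y * g \in C)%g = (g \notin C).
  by move=> Sg; rewrite index2_mem // (negbTE nCy); case: (g \in C).
have CyJ h : h \in C -> (y * h * y^-1 \in C)%g.
  move=> Ch; have Sh := CS _ Ch; have SVy := groupVr Sy.
  rewrite (index2_mem (groupM Sy Sh) SVy) (index2_mem Sy Sh) groupV.
  by rewrite (negbTE nCy) Ch.
have yJ h g : (y * (h * g) = (y * h * y^-1) * (y * g))%g by rewrite !mulgA mulgKV.
have [|||B Bi BE] := @invariant_primitive3 _ _ C S sCS (homog3 w) (homog2 f) (homog3_closed wz).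
- exact: homog3_invariant.
- exact: homog2_invariant.
- by move=> g0 g1 g2 g3 *; apply: (@homog3_cobound _ _ C).
have wy g0 g1 g2 g3 : homog3 w (y * g0)%g (y * g1)%g (y * g2)%g (y * g3)%g = homog3 w g0 g1 g2 g3.
  by rewrite /homog3 !quotM.
pose V g0 g1 g2 := B (y * g0)%g (y * g1)%g (y * g2)%g - B g0 g1 g2.
have Byy g0 g1 g2 : g0 \in S -> g1 \in S -> g2 \in S ->
    B (y * (y * g0))%g (y * (y * g1))%g (y * (y * g2))%g = B g0 g1 g2.
  by move=> *; rewrite !(mulgA y y) Bi.
have Byi h g0 g1 g2 : h \in C -> g0 \in S -> g1 \in S -> g2 \in S ->
    B (y * (h * g0))%g (y * (h * g1))%g (y * (h * g2))%g = B (y * g0)%g (y * g1)%g (y * g2)%g.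
  by move=> Ch S0 S1 S2; rewrite !(yJ h) Bi //; auto.
have Vz : closed2 S V.
  move=> g0 g1 g2 g3 S0 S1 S2 S3; rewrite /hdelta2 /V.
  have E1 := BE _ _ _ _ S0 S1 S2 S3.
  have := BE _ _ _ _ (Syg _ S0) (Syg _ S1) (Syg _ S2) (Syg _ S3).
  rewrite wy => E2; rewrite /hdelta2 in E1 E2.
  zlin (zadd E1 (zopp E2)).
have Vi : invariant3 C S V.
  by move=> h g0 g1 g2 Ch S0 S1 S2; rewrite /V (Bi h) // Byi.
have [fV fVE] : cobound2_on C (fun s t => V 1%g s (s * t)%g).
  apply: H2C => s t u Cs Ct Cu.
  have := Vz _ _ _ _ (group1 S) (CS _ Cs) (CS _ (groupM Cs Ct))
     (CS _ (groupM (groupM Cs Ct) Cu)).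
  have := Vi s 1%g t (t * u)%g Cs (group1 S) (CS _ Ct) (CS _ (groupM Ct Cu)).
  rewrite /hdelta2 mulg1 !mulgA => -> E; zlin E.
have [||D Di DE] := @invariant_primitive2 _ _ C S sCS V (fun g0 g1 => fV (g0^-1 * g1)%g) Vz Vi.
- exact: homog1_invariant.
- move=> g0 g1 g2 C0 C1 C2; rewrite -(homog2_cobound (K := C) C0 C1 C2 fVE) /homog2 chainM.
  have := Vi g0^-1%g g0 g1 g2 (groupVr C0) (CS _ C0) (CS _ C1) (CS _ C2).
  by rewrite mulVg.
pose Dy g0 g1 := D (y * g0)%g (y * g1)%g.
pose W g0 g1 := D g0 g1 + Dy g0 g1.
have Dyy g0 g1 : g0 \in S -> g1 \in S -> D (y * (y * g0))%g (y * (y * g1))%g = D g0 g1.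
  by move=> *; rewrite !(mulgA y y) Di.
have ByE g0 g1 g2 : g0 \in S -> g1 \in S -> g2 \in S ->
    B (y * g0)%g (y * g1)%g (y * g2)%g = B g0 g1 g2 + hdelta1 D g0 g1 g2.
  by move=> S0 S1 S2; rewrite -DE // /V addrC subrK.
have Dyi : invariant2 C S Dy.
  by move=> h g0 g1 Ch S0 S1; rewrite /Dy !(yJ h) Di //; auto.
have SyC s : s \in S -> s \notin C -> exists2 h, h \in C & s = (h * y)%g.
  move=> Ss nCs; exists (s * y^-1)%g; rewrite ?mulgKV //.
  by rewrite (index2_mem Ss (groupVr Sy)) groupV (negbTE nCs) (negbTE nCy).
have Wi : invariant2 S S W.
  move=> s g0 g1 Ss S0 S1; have [Cs|/(SyC _ Ss)[h Ch ->]] := boolP (s \in C).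
    by rewrite /W Di // Dyi.
  rewrite -!mulgA /W (Di _ _ _ Ch (Syg _ S0) (Syg _ S1)) (Dyi _ _ _ Ch (Syg _ S0) (Syg _ S1)).
  by rewrite /Dy Dyy // addrC.
have WM g0 g1 g2 : g0 \in S -> g1 \in S -> g2 \in S -> W g0 g2 = W g0 g1 + W g1 g2.
  move=> S0 S1 S2; have E1 := DE _ _ _ S0 S1 S2.
  have E2 := DE _ _ _ (Syg _ S0) (Syg _ S1) (Syg _ S2).
  rewrite /V /hdelta1 Byy // in E1 E2; rewrite /W /Dy; zlin (zadd E1 E2).
pose chi x := W 1%g x.
have WE g0 g1 : g0 \in S -> g1 \in S -> chi (g0^-1 * g1)%g = W g0 g1.
  by move=> S0 S1; rewrite /chi -{1}(mulVg g0) Wi ?groupV.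
exists chi => [s t Ss St|].
  rewrite /chi (WM 1%g s) ?groupM //; congr (_ + _).
  by rewrite -{1}(mulg1 s) Wi.
have DyE g0 g1 : g0 \in S -> g1 \in S -> Dy g0 g1 = W g0 g1 - D g0 g1.
  by rewrite /W => *; zmod.
(* [Bt] is [S]-invariant, and [Dt] is so up to the sign of [S / C]. The
   coboundary of [Bt] differs from [w] by values of [D] where consecutive
   arguments change cosets; [cor] cancels them, except for values of [W]. *)
pose Bt g0 g1 g2 := if g0 \in C then B g0 g1 g2 else B (y * g0)%g (y * g1)%g (y * g2)%g.
pose Dt g0 g1 := if g0 \in C then D g0 g1 else - Dy g0 g1.
pose cor (g0 g1 g2 : gT) := if (g0 \in C) == (g1 \in C) then 0
  else if g0 \in C then Dt g1 g2 else - Dt g1 g2.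
have flip h g : h \in C -> g \in S -> (h * (y * g) \in C)%g = (g \notin C).
  by move=> Ch Sg; rewrite groupMl // Cy.
have Bti : invariant3 S S Bt.
  move=> s g0 g1 g2 Ss S0 S1 S2; have [Cs|/(SyC _ Ss)[h Ch ->]] := boolP (s \in C).
    by rewrite /Bt groupMl // (Bi s) // Byi.
  rewrite -!mulgA /Bt flip //; have [C0|C0] := boolP (g0 \in C) => /=.
    by rewrite Byi ?Byy ?Syg.
  by rewrite (Bi h) ?Syg.
have Dti s g0 g1 : s \in S -> g0 \in S -> g1 \in S ->
    Dt (s * g0)%g (s * g1)%g = if s \in C then Dt g0 g1 else - Dt g0 g1.
  move=> Ss S0 S1; have [Cs|nCs] := boolP (s \in C).
    by rewrite /Dt groupMl // Di // Dyi.
  have [h Ch ->] := SyC _ Ss nCs.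
  rewrite -!mulgA /Dt flip //; have [C0|C0] := boolP (g0 \in C) => /=.
    by rewrite (Dyi h) ?Syg // /Dy Dyy.
  by rewrite (Di h) ?Syg // opprK.
have cori : invariant3 S S cor.
  move=> s g0 g1 g2 Ss S0 S1 S2; rewrite /cor !index2_mem // Dti //.
  by case: (s \in C); case: (g0 \in C); case: (g1 \in C) => //=; rewrite ?opprK.
apply: (@cobound3_homog _ _ S _ (fun g0 g1 g2 => Bt g0 g1 g2 + cor g0 g1 g2)).
  by move=> s g0 g1 g2 *; rewrite Bti ?cori.
move=> g0 g1 g2 g3 S0 S1 S2 S3.
rewrite {1}/homog3 -/(homog3 w g0 g1 g2 g3) BE // WE // !index2_mem ?groupV //.
rewrite /hdelta2 /Bt /cor /Dt !ByE // !DyE // /hdelta1.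
rewrite (WM g1 g2 g3) //.
by case: (g0 \in C); case: (g1 \in C); case: (g2 \in C) => /=; zmod.
Qed.
End Descent.
End IndexTwo.

(** * Operations on cocycles *)

Section Cohomologous.
Variables (gT : finGroupType) (M : zmodType) (K : {group gT}).
Implicit Types (w v u : gT -> gT -> gT -> M).

Lemma cocycle3B w v : cocycle3_on K w -> cocycle3_on K v -> cocycle3_on K (fun x y z => w x y z - v x y z).
Proof.
move=> wz vz x y z t Kx Ky Kz Kt.
zlin (zadd (wz x y z t Kx Ky Kz Kt) (zopp (vz x y z t Kx Ky Kz Kt))).
Qed.
Lemma cocycle3Mn w n : cocycle3_on K w -> cocycle3_on K (fun x y z => w x y z *+ n).
Proof. by move=> wz x y z t *; rewrite -!mulrnDl wz. Qed.
Lemma cocycle2B (a b : gT -> gT -> M) :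
  cocycle2_on K a -> cocycle2_on K b -> cocycle2_on K (fun x y => a x y - b x y).
Proof.
move=> az bz x y z Kx Ky Kz.
zlin (zadd (az x y z Kx Ky Kz) (zopp (bz x y z Kx Ky Kz))).
Qed.
Lemma cobound2_cocycle (f : gT -> M) : cocycle2_on K (fun x y => f x + f y - f (x * y)%g).
Proof. by move=> x y z Kx Ky Kz; rewrite mulgA; zmod. Qed.
Lemma cohom3_eq w v : (forall x y z, x \in K -> y \in K -> z \in K -> w x y z = v x y z) ->
  cohomologous3 K w v.
Proof.
move=> E; exists (fun _ _ => 0) => x y z *; rewrite E //; zmod.
Qed.
Lemma cohom3_sym w v : cohomologous3 K w v -> cohomologous3 K v w.
Proof.
move=> [f fE]; exists (fun x y => - f x y) => x y z Kx Ky Kz.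
zlin (zopp (fE x y z Kx Ky Kz)).
Qed.
End Cohomologous.

(** * Cyclic 2-groups *)

Section Log.
Variables (gT : finGroupType) (x : gT).
Definition glog g := find (fun i => (x ^+ i)%g == g) (iota 0 #[x]%g).

Lemma glogX i : (i < #[x]%g)%N -> glog (x ^+ i)%g = i.
Proof.
move=> lti; set p := (fun j => (x ^+ j)%g == (x ^+ i)%g).
have hp : has p (iota 0 #[x]%g) by apply/hasP; exists i; rewrite ?mem_iota /p ?eqxx.
have ltf : (glog (x ^+ i)%g < #[x]%g)%N by move: hp; rewrite has_find size_iota.
have := nth_find 0 hp; rewrite nth_iota // add0n /p eq_expg_mod_order => /eqP.
by rewrite !modn_small.
Qed.

Lemma glogP g : g \in <[x]>%g -> (x ^+ glog g)%g = g /\ (glog g < #[x]%g)%N.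
Proof. by case/cyclePmin => i lti ->; rewrite glogX. Qed.

Lemma glog1 : glog 1%g = 0%N.
Proof. by rewrite -(expg0 x) glogX. Qed.

(** The integral 2-cocycle of the extension of [<[x]>] by the integers. *)
Definition carry g h : nat := (#[x]%g <= glog g + glog h)%N.

Lemma glogM g h : g \in <[x]>%g -> h \in <[x]>%g ->
  (glog g + glog h = glog (g * h)%g + #[x]%g * carry g h)%N.
Proof.
move=> /glogP[gE gl] /glogP[hE hl]; rewrite /carry.
have [le|lt] := leqP; rewrite ?muln1 ?muln0 ?addn0 /=.
  suff -> : glog (g * h)%g = (glog g + glog h - #[x]%g)%N by rewrite subnK.
  rewrite -{1}gE -{1}hE -expgD -{1}(subnK le) expgD expg_order mulg1 glogX //; lia.
by rewrite -{2}gE -{2}hE -expgD glogX.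
Qed.

Lemma carry_cocycle g h k : g \in <[x]>%g -> h \in <[x]>%g -> k \in <[x]>%g ->
  (carry h k + carry g (h * k)%g = carry (g * h)%g k + carry g h)%N.
Proof.
move=> Cg Ch Ck; have n0 := order_gt0 x.
have E1 := glogM Cg Ch; have E2 := glogM Ch Ck.
have E3 := glogM (groupM Cg Ch) Ck; have E4 := glogM Cg (groupM Ch Ck).
have a : (g * (h * k) = g * h * k)%g := mulgA _ _ _; rewrite a in E4.
apply/eqP; rewrite -(eqn_pmul2l n0) !mulnDr; apply/eqP.
move: E1 E2 E3 E4; move: (_ * carry h k)%N (_ * carry g h)%N (_ * carry (g * h)%g k)%N.
move: (_ * carry g (h * k)%g)%N => e1 e2 e3 e4.
by move: (glog (g * h * k)%g) (glog (g * h)%g) (glog (h * k)%g) => *; lia.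
Qed.

Lemma glogS g : g \in <[x]>%g ->
  (glog g).+1 = glog (g * x)%g \/ ((glog g).+1 = #[x]%g /\ (g * x)%g = 1%g).
Proof.
move=> /glogP[gE gl]; have -> : (g * x = x ^+ (glog g).+1)%g by rewrite expgSr gE.
have [|] := ltnP (glog g).+1 #[x]%g; first by move=> lt; left; rewrite glogX.
move=> le; right; have -> : (glog g).+1 = #[x]%g by apply/eqP; rewrite eqn_leq gl.
by rewrite expg_order.
Qed.
End Log.

Section Cyclic.
Variables (M : zmodType) (gT : finGroupType).
Hypothesis divM : forall (n : nat) (m : M), (0 < n)%N -> exists m', m' *+ n = m.

Section OneGenerator.
Variable x : gT.

Lemma log_char (eta : M) : eta *+ #[x]%g = 0 ->
  character <[x]>%g (fun g => eta *+ glog x g).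
Proof.
move=> eta0 g h Cg Ch.
by rewrite -mulrnDr glogM // mulrnDr mulrnA eta0 mul0rn addr0.
Qed.

Lemma char_log (K : {set gT}) (chi : gT -> M) : <[x]>%g \subset K -> character K chi ->
  chi x *+ #[x]%g = 0 /\ forall g, g \in <[x]>%g -> chi g = chi x *+ glog x g.
Proof.
move=> /subsetP sxK chiM.
have K1 : 1%g \in K by apply: sxK.
have chi1 : chi 1%g = 0.
  by apply: (@addrI _ (chi 1%g)); rewrite -chiM // mulg1 addr0.
have chiX i : chi (x ^+ i)%g = chi x *+ i.
  elim: i => [|i IH]; first by rewrite expg0 mulr0n.
  by rewrite expgS mulrS chiM ?IH //; apply: sxK; rewrite ?mem_cycle ?cycle_id.
split; first by rewrite -chiX expg_order.
by move=> g /glogP[gE _]; rewrite -{1}gE chiX.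
Qed.

Lemma cocycle2_1 (K : {group gT}) (a : gT -> gT -> M) g : cocycle2_on K a -> g \in K ->
  a 1%g g = a 1%g 1%g /\ a g 1%g = a 1%g 1%g.
Proof.
move=> az Kg; have E1 := az 1%g 1%g g (group1 K) (group1 K) Kg.
have E2 := az g 1%g 1%g Kg (group1 K) (group1 K).
rewrite !mul1g in E1; rewrite !mulg1 in E2.
by split; [zlin E1 | zlin (zopp E2)].
Qed.

(** The primitive is built by walking along the powers of [x], where each step
    imposes [f (g * x) = f g + rho - a g x]; the walk closes up for [rho] a
    suitable [#[x]]-th part of the sum of the [a (x ^+ j) x]. *)
Lemma cyclic_H2 (a : gT -> gT -> M) : cocycle2_on <[x]>%g a -> cobound2_on <[x]>%g a.
Proof.
move=> az.
pose p i := \sum_(j < i) a (x ^+ j)%g x.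
have [rho rhoE] := divM (p #[x]%g) (order_gt0 x).
pose F i := rho *+ i + a 1%g 1%g - p i.
pose f g := F (glog x g).
have Cx : x \in <[x]>%g := cycle_id x.
have fS g : g \in <[x]>%g -> f (g * x)%g = f g + rho - a g x.
  move=> Cg; have [gE _] := glogP Cg; rewrite /f.
  have FS : F (glog x g).+1 = F (glog x g) + rho - a g x.
    rewrite /F /p big_ord_recr /= gE mulrSr; zmod.
  have [<- //|[gl ->]] := glogS Cg; rewrite -FS gl glog1 /F rhoE /p big_ord0 mulr0n; zmod.
have f1 : f 1%g = a 1%g 1%g by rewrite /f glog1 /F /p big_ord0 mulr0n; zmod.
exists f; suff E i g : g \in <[x]>%g -> a g (x ^+ i)%g = f g + f (x ^+ i)%g - f (g * x ^+ i)%g.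
  by move=> g h Cg /cycleP[i ->]; exact: E.
elim: i g => [|i IH] g Cg.
  by rewrite expg0 mulg1 f1 (cocycle2_1 az Cg).2; zmod.
have Ci := mem_cycle x i.
have := az g (x ^+ i)%g x Cg Ci Cx; have := IH g Cg.
rewrite expgSr mulgA !fS ?groupM // => E1 E2.
zlin (zadd E1 E2).
Qed.

(** Cup product of the character that sends [x] to [eta] with the carry. *)
Definition cyc3 (eta : M) g h k := eta *+ glog x k *+ carry x g h.

Lemma cyc3_cocycle eta : eta *+ #[x]%g = 0 -> cocycle3_on <[x]>%g (cyc3 eta).
Proof.
move=> eta0 g h k l Cg Ch Ck Cl; rewrite /cyc3.
have E1 := log_char eta0 Ck Cl; rewrite /= in E1; rewrite E1 mulrnDl.
have E2 := congr1 (fun i => eta *+ glog x l *+ i) (carry_cocycle Cg Ch Ck).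
by rewrite /= !mulrnDr in E2; zlin E2.
Qed.
End OneGenerator.

Variables (half : M) (zeta : nat -> M).
Hypotheses (tor2 : forall m : M, m *+ 2 = 0 -> m = 0 \/ m = half)
  (zeta0 : zeta 0 = 0) (zeta1 : zeta 1 = half) (zetaS : forall n, zeta n.+1 *+ 2 = zeta n).

(** The [zeta n] are compatible generators of the elements killed by [2 ^ n]. *)
Lemma zeta_half n : zeta n.+1 *+ 2 ^ n = half.
Proof.
elim: n => [|n IH]; first by rewrite zeta1.
by rewrite expnS mulrnA zetaS.
Qed.
Lemma zeta_tor n : zeta n *+ 2 ^ n = 0.
Proof. by case: n => [|n]; rewrite ?zeta0 // expnSr mulrnA zeta_half -zeta1 zetaS. Qed.

Lemma half2 : half *+ 2 = 0. Proof. by rewrite -zeta1 zetaS. Qed.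

Lemma tor2n n m : m *+ 2 ^ n = 0 -> exists j, m = zeta n *+ j.
Proof.
elim: n m => [|n IH] m; first by rewrite mulr1n => ->; exists 0%N.
rewrite expnS mulrnA => /IH[j mE].
have [] := @tor2 (m - zeta n.+1 *+ j).
- by rewrite mulrnBl mE -mulrnA mulnC mulrnA zetaS subrr.
- by move/eqP; rewrite subr_eq0 => /eqP->; exists j.
move/eqP; rewrite subr_eq -(zeta_half n) -mulrnDr => /eqP ->.
by exists (2 ^ n + j)%N.
Qed.

(** Induction along [<[x ^+ 2]>], where by hypothesis [w] is a multiple of the
    generator; that generator is the restriction of the one for [x]. By [descent]
    the remainder comes from a character, and such a class is a multiple of
    [2 ^ n] times the generator. *)
Lemma cyclic_H3 n (x : gT) (w : gT -> gT -> gT -> M) : #[x]%g = (2 ^ n)%N ->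
  cocycle3_on <[x]>%g w -> exists j, cohomologous3 <[x]>%g w
    (fun g h k => cyc3 x (zeta n) g h k *+ j).
Proof.
elim: n x w => [|n IH] x w ox wz.
  have C1 g : g \in <[x]>%g -> g = 1%g.
    by move/eqP: ox; rewrite expn0 order_eq1 => /eqP->; rewrite cycle1 => /set1P.
  exists 0%N; apply: cohom3_eq => g h k /C1-> /C1-> /C1->.
  have := wz 1%g 1%g 1%g 1%g (group1 _) (group1 _) (group1 _) (group1 _).
  rewrite !mulg1 => E; zlin E.
have ox2 : #[x ^+ 2]%g = (2 ^ n)%N.
  by rewrite orderXdiv ox expnS ?dvdn_mulr // mulKn.
have sC : <[x ^+ 2]>%g \subset <[x]>%g by rewrite cycle_subG mem_cycle.
have indC : #|<[x]> : <[x ^+ 2]>|%g = 2%N.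
  by rewrite -divgS // -!orderE ox ox2 expnS mulnK ?expn_gt0.
have logC g : g \in <[x ^+ 2]>%g -> glog x g = (2 * glog (x ^+ 2)%g g)%N.
  move=> /glogP[gE gl]; rewrite -{1}gE -expgM glogX // ox expnS ltn_pmul2l //.
  by rewrite -ox2.
have [j jE] := IH (x ^+ 2)%g w ox2 (fun g h k l Cg Ch Ck Cl =>
   wz g h k l (subsetP sC _ Cg) (subsetP sC _ Ch) (subsetP sC _ Ck) (subsetP sC _ Cl)).
have z0 : zeta n.+1 *+ #[x]%g = 0 by rewrite ox zeta_tor.
have cz := cyc3_cocycle z0.
have [||chi chiM chiE] := descent sC indC (@cyclic_H2 (x ^+ 2)%g)
   (w := fun g h k => w g h k - cyc3 x (zeta n.+1) g h k *+ j).
- exact/cocycle3B/cocycle3Mn.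
- have [f fE] := jE; exists f => g h k Cg Ch Ck; rewrite -fE //; congr (_ - _ *+ _).
  rewrite /cyc3 (logC k) // mulrnA zetaS; congr (_ *+ _).
  by rewrite /carry !logC // ox ox2 -mulnDr expnS leq_pmul2l.
have [chi0 chiX] := char_log (subxx _) chiM.
have [i iE] := tor2n (etrans (congr1 _ (esym ox)) chi0).
exists (2 ^ n * i + j)%N.
suff [f fE] : cohomologous3 <[x]>%g
   (fun s t u => if (s \notin <[x ^+ 2]>%g) && (t \notin <[x ^+ 2]>%g) then chi u else 0)
   (fun g h k => cyc3 x (zeta n.+1) g h k *+ (2 ^ n * i)).
  have [h hE] := chiE; exists (fun g k => f g k + h g k) => g k l Cg Ck Cl.
  rewrite mulrnDr; zlin (zadd (fE g k l Cg Ck Cl) (hE g k l Cg Ck Cl)).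
have oddC g : g \in <[x]>%g -> (g \notin <[x ^+ 2]>%g) = odd (glog x g).
  move=> Cg; have [gE gl] := glogP Cg; apply/idP/idP => [nC|od].
    apply: contraNT nC => ev; rewrite -gE -(odd_double_half (glog x g)) (negbTE ev).
    by rewrite add0n -mul2n expgM mem_cycle.
  by apply: contraTN od => /logC->; rewrite oddM.
exists (fun g k => - (chi k *+ (glog x g)./2)) => g h k Cg Ch Ck.
rewrite !oddC // chiM // /cyc3 [_ *+ (2 ^ n * i)]mulrnAC mulnC.
have -> : zeta n.+1 *+ glog x k *+ (i * 2 ^ n) = chi k *+ 2 ^ n.
  by rewrite [in RHS]chiX // iE mulrnA; congr (_ *+ _); rewrite -!mulrnA mulnC.
(* Adding logarithms and adding their halves differ by the carry of the last bit,
   which is the class that [descent] leaves. *)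
have E : ((glog x g)./2 + (glog x h)./2 + (odd (glog x g) && odd (glog x h)) =
    (glog x (g * h)%g)./2 + 2 ^ n * carry x g h)%N.
  have := glogM Cg Ch; rewrite ox expnS; set A := glog x (g * h)%g.
  set c := (2 ^ n * _)%N => Eg; have {}Eg : (glog x g + glog x h = A + 2 * c)%N by lia.
  by case: (odd _) (odd_double_half (glog x g)) => E1; case: (odd _) (odd_double_half (glog x h)) => E2;
    case: (odd _) (odd_double_half A) => E3; lia.
have {}E := congr1 (fun i => chi k *+ i) E.
rewrite !mulrnDr mulrnA in E; rewrite mulrnDl.
have -> : (if odd (glog x g) && odd (glog x h) then chi k else 0) =
   chi k *+ (odd (glog x g) && odd (glog x h)) by case: ifP.
zlin E.
Qed.
End Cyclic.

(** * Extensions of degree two in which an abelian subgroup is inverted *)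

Section InvertingH2.
Variables (gT : finGroupType) (M : zmodType) (S C : {group gT}) (y : gT).
Hypothesis divM : forall (n : nat) (m : M), (0 < n)%N -> exists m', m' *+ n = m.
Hypotheses (sCS : C \subset S) (indC : #|S : C|%g = 2%N) (Sy : y \in S) (nCy : y \notin C).
Hypothesis invC : forall h, h \in C -> (y * h = h^-1 * y)%g.
Hypothesis H2C : forall a : gT -> gT -> M, cocycle2_on C a -> cobound2_on C a.
Hypothesis sqrtC : forall psi : gT -> M, character C psi -> psi (y * y)%g = 0 ->
  exists2 xi, character C xi & forall h, h \in C -> psi h = xi h *+ 2.

Let CS c : c \in C -> c \in S. Proof. exact: (subsetP sCS). Qed.
Let Cyy : (y * y \in C)%g. Proof. by rewrite (index2_mem sCS indC) // eqxx. Qed.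
Let Cs s : s \in S -> s \in C \/ exists2 h, h \in C & s = (h * y)%g.
Proof.
move=> Ss; have [Cs|nCs] := boolP (s \in C); [by left | right].
exists (s * y^-1)%g; rewrite ?mulgKV // (index2_mem sCS indC) ?groupV //.
by rewrite (negbTE nCs) (negbTE nCy).
Qed.

(** All values of [a] are determined by [a y y] and by [psi h = a y h], which is a
    character of [C] trivial on [y * y]. A square root [xi] of [psi] gives a
    primitive, once its value at [y] is adjusted by [kap]. *)
Lemma inverting_normalized_H2 (a : gT -> gT -> M) : cocycle2_on S a ->
  (forall h h', h \in C -> h' \in C -> a h h' = 0) -> (forall h, h \in C -> a h y = 0) ->
  cobound2_on S a.
Proof.
move=> az aC aCy.
have aCCy h h' : h \in C -> h' \in C -> a h (h' * y)%g = 0.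
  move=> Ch Ch'; have := az h h' y (CS Ch) (CS Ch') Sy.
  by rewrite (aCy _ Ch') (aC _ _ Ch Ch') (aCy _ (groupM Ch Ch')) !add0r.
pose psi h := a y h.
have ayC h h' : h \in C -> h' \in C -> a (h * y)%g h' = psi h'.
  move=> Ch Ch'; have := az h y h' (CS Ch) Sy (CS Ch').
  by rewrite invC // (aCCy h) ?groupV // (aCy h) // !addr0.
have psiM : character C psi.
  move=> h h' Ch Ch'; have := az y h h' Sy (CS Ch) (CS Ch').
  by rewrite (aC h) // invC // ayC ?groupV // add0r [X in _ = X]addrC.
have ayCy h h' : h \in C -> h' \in C -> a (h * y)%g (h' * y)%g = a y (h' * y)%g.
  move=> Ch Ch'; have := az h y (h' * y)%g (CS Ch) Sy (groupM (CS Ch') Sy).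
  have -> : (y * (h' * y) = h'^-1 * (y * y))%g by rewrite !mulgA invC.
  by rewrite (aCy h) // (aC _ _ Ch (groupM (groupVr Ch') Cyy)) !addr0 => <-.
have ay h : h \in C -> a y (h * y)%g = a y y + psi h.
  move=> Ch; have := az y h y Sy (CS Ch) Sy.
  rewrite (aCy h) // add0r invC // => ->; congr (_ + _).
  by have := ayCy h^-1%g 1%g; rewrite mul1g; apply; rewrite ?groupV ?group1.
have psiz : psi (y * y)%g = 0.
  have := az y y y Sy Sy Sy; rewrite (aCy _ Cyy) add0r => E.
  by apply: (@addrI _ (a y y)); rewrite addr0 -[RHS]E.
have [xi xiM xiE] := sqrtC psiM psiz.
have [kap kapE] := divM (a y y + xi (y * y)%g) (isT : 0 < 2)%N.
pose f s := if s \in C then xi s else xi (s * y^-1)%g + kap.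
have fC h : h \in C -> f h = xi h by rewrite /f => ->.
have fCy h : h \in C -> f (h * y)%g = xi h + kap.
  by move=> Ch; rewrite /f (index2_mem sCS indC (CS Ch) Sy) Ch (negbTE nCy) /= mulgK.
have xiV h : h \in C -> xi h^-1%g = - xi h.
  move=> Ch; have xi1 : xi 1%g = 0.
    by apply: (@addrI _ (xi 1%g)); rewrite -xiM ?group1 // mulg1 addr0.
  by apply/eqP; rewrite -addr_eq0 -xiM ?groupV // mulVg xi1.
exists f => s t /Cs[Ch|[h Ch ->]] /Cs[Ch'|[h' Ch' ->]].
- rewrite aC // !fC ?groupM // xiM //; zmod.
- rewrite aCCy // mulgA !fCy ?groupM // fC // xiM //; zmod.
- rewrite ayC // -mulgA invC // mulgA !fCy ?groupM ?groupV // fC // xiM ?groupV // xiV //.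
  rewrite xiE //; zmod.
- have -> : (h * y * (h' * y) = h * h'^-1 * (y * y))%g by rewrite -!mulgA (mulgA y) (invC Ch') -!mulgA.
  have ChV := groupM Ch (groupVr Ch').
  rewrite ayCy // ay // (fC _ (groupM ChV Cyy)) !fCy // (xiM _ _ ChV Cyy).
  rewrite (xiM _ _ Ch (groupVr Ch')) xiV // xiE //.
  zlin (zopp kapE).
Qed.

(** Subtract a primitive on [C], then a cochain supported outside [C]. *)
Theorem inverting_H2 (a : gT -> gT -> M) : cocycle2_on S a -> cobound2_on S a.
Proof.
move=> az.
have [f fE] := H2C (fun x y z Cx Cy Cz => az x y z (CS Cx) (CS Cy) (CS Cz)).
pose b s t := a s t - (f s + f t - f (s * t)%g).
have bz : cocycle2_on S b by apply: cocycle2B => //; apply: cobound2_cocycle.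
have bC h h' : h \in C -> h' \in C -> b h h' = 0.
  by move=> Ch Ch'; rewrite /b fE // subrr.
pose k s := if s \in C then 0 else - b (s * y^-1)%g y.
have kC h : h \in C -> k h = 0 by rewrite /k => ->.
have kCy h : h \in C -> k (h * y)%g = - b h y.
  by move=> Ch; rewrite /k (index2_mem sCS indC (CS Ch) Sy) Ch (negbTE nCy) /= mulgK.
have ky : k y = 0.
  rewrite -[y]mul1g kCy ?group1 //.
  have := bz 1%g 1%g y (group1 _) (group1 _) Sy; rewrite !mul1g (bC _ _ (group1 C) (group1 C)) => E.
  zlin (zopp E).
have [|||h hE] := @inverting_normalized_H2 (fun s t => b s t - (k s + k t - k (s * t)%g)).
- by apply: cocycle2B => //; apply: cobound2_cocycle.
- by move=> h h' Ch Ch'; rewrite bC // !kC ?groupM //; zmod.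
- by move=> h Ch; rewrite (kC h) // ky kCy //; zmod.
exists (fun s => f s + k s + h s) => s t Ss St.
have := hE s t Ss St; rewrite /b => E; zlin E.
Qed.
End InvertingH2.

(** * Generalized quaternion groups *)

Definition bitZ (b : bool) : int := if b then 1 else 0.
Definition signZ (b : bool) : int := if b then -1 else 1.

(** Elements of the quaternion group of order [8n] are written [y^s x^a] with
    [x^(4n) = 1]; [s], [t], [u] are the exponents of [y] in three elements, [c] is
    the exponent of [x] in the last one, and [e], [e'] are the carries of the
    first two and of the last two. The form gives the value of a 3-cocycle as a
    multiple of an element of order [8n]. For [s = t = u = 0] it is twice the
    cyclic cup product [e c]; the other terms account for [y^2 = x^(2n)] and for
    the inversion of [x] by [y]. *)
Definition qform (n : int) (s t u : bool) (e e' c : int) : int :=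
  (e * 2 - bitZ (s && t)) * signZ u * c
  + n * 4 * (bitZ ((s (+) t) && u) * e + bitZ (s && (t (+) u)) * e')
  - n * bitZ [&& s, t & u].

(** An explicit quotient by [8n]: with the four bits fixed, the identity is one
    between polynomials. *)
Lemma qform_cocycle (n : int) (s t u v : bool) (c d d' e_gh e_gh_k e_g_hk e_hk e_kl e_hk_l e_h_kl : int) :
  e_g_hk = e_gh_k + signZ u * e_gh - e_hk + bitZ [&& s, t & u] ->
  e_h_kl = e_hk_l + signZ v * e_hk - e_kl + bitZ [&& t, u & v] ->
  d' = signZ v * c + d + n * 2 * bitZ (u && v) - n * 4 * e_kl ->
  exists W : int,
   qform n t u v e_hk e_kl d + qform n s (t (+) u) v e_g_hk e_hk_l d
   + qform n s t u e_gh e_hk c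
   - (qform n (s (+) t) u v e_gh_k e_kl d + qform n s t (u (+) v) e_gh e_h_kl d')
   = n * 8 * W.
Proof.
move=> -> -> ->.
exists (signZ u * signZ v * e_gh * e_kl - bitZ [&& u, v & s == t] * e_gh
  + bitZ [&& s, v & t != u] * e_hk + bitZ [&& s, t & u != v] * e_kl).
by rewrite /qform; case: s; case: t; case: u; case: v => /=; ring.
Qed.

Lemma expg_eq_int (gT : finGroupType) (x : gT) i j : (x ^+ i = x ^+ j)%g ->
  exists e : int, i%:Z = j%:Z + #[x]%g%:Z * e.
Proof.
move/eqP; rewrite eq_expg_mod_order => /eqP E.
exists ((i %/ #[x]%g)%N%:Z - (j %/ #[x]%g)%N%:Z).
rewrite {1}(divn_eq i #[x]%g) {1}(divn_eq j #[x]%g) E; lia.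
Qed.

(** In this section [S] is the generalized quaternion group generated by [x] and
    [y], of order [8n] with [n = 2 ^ m]. *)
Section Quaternion.
Variables (gT : finGroupType) (M : zmodType) (S : {group gT}) (x y : gT) (m : nat).
Variables (half : M) (zeta : nat -> M).
Hypothesis divM : forall (n : nat) (m : M), (0 < n)%N -> exists m', m' *+ n = m.
Hypotheses (tor2 : forall m : M, m *+ 2 = 0 -> m = 0 \/ m = half)
  (zeta0 : zeta 0 = 0) (zeta1 : zeta 1 = half) (zetaS : forall n, zeta n.+1 *+ 2 = zeta n).

Local Notation C := <[x]>%g.
Hypotheses (sCS : C \subset S) (indC : #|S : C|%g = 2%N) (Sy : y \in S) (nCy : y \notin C).
Hypotheses (ox : #[x]%g = (2 ^ m.+2)%N) (yx : (y * x = x^-1 * y)%g)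
  (yy : (y * y = x ^+ (2 ^ m.+1))%g).

Let n : int := (2 ^ m)%N%:Z.
Let n_neq0 : n != 0. Proof. by rewrite /n; lia. Qed.
Let oxn : #[x]%g%:Z = n * 4. Proof. rewrite ox !expnS /n; lia. Qed.
Let CS c : c \in C -> c \in S. Proof. exact: (subsetP sCS). Qed.
Let Sx : x \in S. Proof. by rewrite CS ?cycle_id. Qed.

Let ycx i : (y * x ^+ i = x ^- i * y)%g.
Proof.
elim: i => [|i IH]; first by rewrite invg1 mulg1 mul1g.
by rewrite expgSr mulgA IH -mulgA yx mulgA -invMg -expgS -expgSr.
Qed.

Lemma quaternion_inv h : h \in C -> (y * h = h^-1 * y)%g.
Proof. by case/cycleP => i ->. Qed.

Definition qb g := g \notin C.
Definition qa g : nat := glog x (if qb g then y^-1 * g else g)%g.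

Let qbM g h : g \in S -> h \in S -> qb (g * h)%g = qb g (+) qb h.
Proof.
by move=> Sg Sh; rewrite /qb (index2_mem sCS indC) //; case: (g \in C); case: (h \in C).
Qed.

Lemma qcoord g : g \in S -> g = (y ^+ qb g * x ^+ qa g)%g.
Proof.
move=> Sg; rewrite /qa /qb; have [Cg|nCg] := boolP (g \in C).
  by rewrite expg0 mul1g; have [-> _] := glogP Cg.
have Cyg : (y^-1 * g \in C)%g.
  by rewrite (index2_mem sCS indC) ?groupV // (negbTE nCg) (negbTE nCy).
by have [-> _] := glogP Cyg; rewrite expg1 mulKVg.
Qed.

Let raw g h : int := signZ (qb h) * (qa g)%:Z + (qa h)%:Z + n * 2 * bitZ (qb g && qb h).
(** The carry of the multiplication law in the coordinates [y^s x^a]. *)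
Definition qe g h : int := ((raw g h - (qa (g * h)%g)%:Z) %/ (n * 4))%Z.

Let two_n : (2 ^ m.+1)%N%:Z = n * 2. Proof. rewrite expnS /n; lia. Qed.

Lemma qeE g h : g \in S -> h \in S -> raw g h = (qa (g * h)%g)%:Z + n * 4 * qe g h.
Proof.
move=> Sg Sh.
suff [e eE] : exists e, raw g h = (qa (g * h)%g)%:Z + n * 4 * e.
  have n4 : n * 4 != 0 by rewrite mulf_neq0.
  by rewrite /qe eE addrAC subrr add0r mulKz.
have := qcoord (groupM Sg Sh); rewrite {1}(qcoord Sg) {1}(qcoord Sh) qbM // /raw.
case: (qb g); case: (qb h) => /=; rewrite ?expg0 ?expg1 ?mul1g => E.
- have {}E : (x ^+ (2 ^ m.+1 + qa h) = x ^+ (qa g + qa (g * h)%g))%g.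
    by rewrite [RHS]expgD -E ycx -!mulgA mulKVg mulgA yy expgD.
  have [e eE] := expg_eq_int E; exists e; rewrite oxn in eE; rewrite PoszD two_n in eE; lra.
- have {}E : (x ^+ (qa g + qa h) = x ^+ (qa (g * h)%g))%g.
    by move: E; rewrite -mulgA -expgD => /mulgI.
  have [e eE] := expg_eq_int E; exists e; rewrite oxn in eE; lra.
- have {}E : (x ^+ qa h = x ^+ (qa g + qa (g * h)%g))%g.
    move/(congr1 (mulg (x ^- qa g)%g)): E; rewrite mulKg mulgA -ycx -mulgA -expgD.
    by move/mulgI.
  have [e eE] := expg_eq_int E; exists e; rewrite oxn in eE; lra.
- have {}E : (x ^+ (qa g + qa h) = x ^+ (qa (g * h)%g))%g by rewrite expgD.
  have [e eE] := expg_eq_int E; exists e; rewrite oxn in eE; lra.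
Qed.

(** Associativity of the law, divided by [4n]: the carry is a cocycle for the
    action of [S] on the integers by the sign of [S / C], up to the term that
    comes from [y ^ 2]. *)
Lemma qe_assoc g h k : g \in S -> h \in S -> k \in S ->
  qe g (h * k)%g = qe (g * h)%g k + signZ (qb k) * qe g h - qe h k
                   + bitZ [&& qb g, qb h & qb k].
Proof.
move=> Sg Sh Sk; have n4 : n * 4 != 0 by rewrite mulf_neq0.
have := qeE Sg Sh; have := qeE (groupM Sg Sh) Sk; have := qeE Sh Sk.
have := qeE Sg (groupM Sh Sk); rewrite /raw !qbM // mulgA.
move: (qe g (h * k)%g) (qe (g * h)%g k) (qe g h) (qe h k) => e1 e2 e3 e4.
by case: (qb g); case: (qb h); case: (qb k) => /= E1 E2 E3 E4; apply: (mulfI n4); lra.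
Qed.

(** Its restriction to [C] generates [H^3(C)], see [qc_cyc]. *)
Definition qc g h k : M :=
  zeta m.+3 *~ qform n (qb g) (qb h) (qb k) (qe g h) (qe h k) (qa k)%:Z.

Let zeta8 W : zeta m.+3 *~ (n * 8 * W) = 0.
Proof.
rewrite mulrzA (_ : n * 8 = (2 ^ m.+3)%N%:Z); last by rewrite !expnS /n; lia.
by rewrite -pmulrn (zeta_tor zeta0 zeta1 zetaS) mul0rz.
Qed.

Lemma qc_cocycle : cocycle3_on S qc.
Proof.
move=> g h k l Sg Sh Sk Sl; rewrite /qc !qbM //.
have Sgh := groupM Sg Sh; have Shk := groupM Sh Sk; have Skl := groupM Sk Sl.
have akl := qeE Sk Sl; rewrite /raw in akl.
have d'E : (qa (k * l)%g)%:Z = signZ (qb l) * (qa k)%:Z + (qa l)%:Z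
   + n * 2 * bitZ (qb k && qb l) - n * 4 * qe k l by lra.
have [W WE] := @qform_cocycle n (qb g) (qb h) (qb k) (qb l) _ (qa l) _ _ _ _ _ _ _ _
  (qe_assoc Sg Sh Sk) (qe_assoc Sh Sk Sl) d'E.
by apply/eqP; rewrite -subr_eq0 -!mulrzDr -mulrzBr WE zeta8.
Qed.

Let qbC g : g \in C -> qb g = false. Proof. by rewrite /qb => ->. Qed.
Let qaC g : g \in C -> qa g = glog x g. Proof. by move=> Cg; rewrite /qa qbC. Qed.

Lemma qeC g h : g \in C -> h \in C -> qe g h = carry x g h.
Proof.
move=> Cg Ch; have n4 : n * 4 != 0 by rewrite mulf_neq0.
have := qeE (CS Cg) (CS Ch); rewrite /raw !qbC //= !qaC ?groupM //.
have := congr1 Posz (glogM Cg Ch); rewrite !PoszD PoszM oxn => E1 E2.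
apply: (mulfI n4); lra.
Qed.

Lemma qc_cyc g h k : g \in C -> h \in C -> k \in C -> qc g h k = cyc3 x (zeta m.+2) g h k.
Proof.
move=> Cg Ch Ck; rewrite /qc /qform !qbC // !qeC // qaC //=.
rewrite /cyc3 -(zetaS m.+2) -!mulrnA [RHS]pmulrn; congr (_ *~ _).
by rewrite !PoszM; ring.
Qed.

Lemma half_mod i j k : i - j = 2 * k -> half *~ i = half *~ j.
Proof.
move=> E; apply/eqP; rewrite -subr_eq0 -mulrzBr E (_ : 2 * k = Posz 2 * k) // mulrzA -pmulrn.
by rewrite (half2 zeta0 zeta1 zetaS) ?mul0rz.
Qed.

Let zeta4 : zeta m.+3 *+ 2 ^ m.+2 = half. Proof. exact: zeta_half. Qed.

(** Only the parity of [qform] matters for this multiple. By [qe_assoc] it is a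
    coboundary, up to the class that [descent] attaches to the character of order
    two that maps [y] to 0 and [x] to [half]. *)
Lemma qc_period : exists f : gT -> gT -> M, forall g h k,
  g \in S -> h \in S -> k \in S ->
  qc g h k *+ 2 ^ m.+2 = (if qb g && qb h then half *~ (qa k)%:Z else 0) +
    (f h k + f g (h * k)%g - (f (g * h)%g k + f g h)).
Proof.
exists (fun g h => half *~ (n * qe g h)) => g h k Sg Sh Sk.
rewrite /qc pmulrn mulrzAC -pmulrn zeta4 (qe_assoc Sg Sh Sk).
have -> : (if qb g && qb h then half *~ (qa k)%:Z else 0) =
  half *~ (bitZ (qb g && qb h) * (qa k)%:Z) by case: ifP; rewrite ?mul1r ?mul0r.
rewrite -!mulrzDr -mulrzBr -mulrzDr /qform.
move: (qa k)%:Z (qe (g * h)%g k) (qe g h) (qe h k) => a e'' e e'.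
set t := bitZ [&& _, _ & _]; set v := bitZ (_ && (_ (+) _)); set u := bitZ ((_ (+) _) && _).
apply: (@half_mod _ _ (e * signZ (qb k) * a - bitZ (qb g && qb h) * a * bitZ (~~ qb k)
  + n * 2 * (u * e + v * e') - n * t + n * bitZ (qb k) * e)).
by case: (qb k) => /=; ring.
Qed.

(** Since [y] inverts [x], and [y * y] is a power of [x * x], characters take
    values killed by 2. *)
Lemma quaternion_char chi : character S chi -> exists A B : nat, forall g, g \in S ->
  chi g = half *+ (A * qa g) + half *+ (B * qb g).
Proof.
move=> chiM.
have chi2 h : h \in S -> chi (h * h)%g = chi h *+ 2 by move=> Sh; rewrite chiM ?mulr2n.
have [_ chiC] := char_log sCS chiM.
have chix2 : chi x *+ 2 = 0.
  have E := congr1 chi yx; rewrite !chiM ?groupV // in E.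
  have E' : chi x + chi x^-1%g = 0.
    by rewrite -chiM ?groupV // mulgV -(expg0 x) chiC ?group1 ?mem_cycle // expg0 glog1.
  by zlin (zadd E E').
have chiy2 : chi y *+ 2 = 0.
  by rewrite -chi2 // yy chiC ?mem_cycle // glogX ?ox ?ltn_exp2l // expnS mulrnA chix2 mul0rn.
have hE (c : M) : c *+ 2 = 0 -> exists A : nat, c = half *+ A.
  by case/tor2 => ->; [exists 0%N | exists 1%N].
have [A AE] := hE _ chix2; have [B BE] := hE _ chiy2; exists A, B => g Sg.
have Cq : (if qb g then y^-1 * g else g)%g \in C.
  have [qg|] := boolP (qb g); last by rewrite negbK.
  by rewrite (index2_mem sCS indC) ?groupV // (negbTE qg) (negbTE nCy).
rewrite {1}(qcoord Sg) chiM ?groupX // addrC chiC ?mem_cycle // glogX; last first.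
  by rewrite /qa; have [] := glogP Cq.
rewrite AE -mulrnA; congr (_ + _); case: (qb g); rewrite ?expg1 ?muln1 //.
by rewrite expg0 muln0 -(expg0 x) chiC ?mem_cycle // expg0 glog1.
Qed.

(** On [C] the cocycle is a multiple of [qc]. By [descent] and [quaternion_char]
    two classes are left: the one in [A] is a multiple of [qc] by [qc_period], and
    the one in [B] is bounded by the carry. *)
Theorem quaternion_H3 (w : gT -> gT -> gT -> M) : cocycle3_on S w ->
  exists j, cohomologous3 S w (fun g h k => qc g h k *+ j).
Proof.
move=> wz; have wzC : cocycle3_on C w by move=> g h k l *; apply: wz; apply: CS.
have [j [f fE]] := cyclic_H3 divM tor2 zeta0 zeta1 zetaS ox wzC.
have [||chi chiM [f' f'E]] := descent sCS indC (@cyclic_H2 M gT divM x)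
   (w := fun g h k => w g h k - qc g h k *+ j).
- exact: cocycle3B wz (cocycle3Mn _ qc_cocycle).
- by exists f => g h k Cg Ch Ck; rewrite -fE // qc_cyc.
have [A [B chiE]] := quaternion_char chiM.
have [F FE] := qc_period.
pose G g h := half *~ qe g h *+ B.
have GE g h k : g \in S -> h \in S -> k \in S ->
    (if qb g && qb h then half *+ (B * qb k) else 0) =
    G h k + G g (h * k)%g - (G (g * h)%g k + G g h).
  move=> Sg Sh Sk; rewrite /G (qe_assoc Sg Sh Sk) -!mulrnDl -mulrnBl -!mulrzDr -mulrzBr.
  have -> : (if qb g && qb h then half *+ (B * qb k) else 0) =
      half *~ bitZ [&& qb g, qb h & qb k] *+ B.
    by case: (qb g); case: (qb h); case: (qb k); rewrite /= ?mulr0z ?mulr1z ?mul0rn ?muln0 ?muln1.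
  congr (_ *+ _); move: (qe (g * h)%g k) (qe g h) (qe h k) => c a b.
  apply: (@half_mod _ _ (bitZ (qb k) * a)).
  by case: (qb k) => /=; ring.
exists (2 ^ m.+2 * A + j)%N.
exists (fun g h => f' g h - F g h *+ A + G g h) => g h k Sg Sh Sk.
have E1 := f'E g h k Sg Sh Sk.
have E2 := FE g h k Sg Sh Sk; have E3 := GE g h k Sg Sh Sk.
have {}E2 : qc g h k *+ (2 ^ m.+2 * A) =
    (if qb g && qb h then half *+ (A * qa k) else 0) +
    (F h k *+ A + F g (h * k)%g *+ A - (F (g * h)%g k *+ A + F g h *+ A)).
  rewrite mulrnA E2 mulrnDl mulrnBl !mulrnDl; congr (_ + _).
  by case: ifP; rewrite ?mul0rn // -pmulrn -mulrnA mulnC.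
have E4 : (if qb g && qb h then chi k else 0) =
    (if qb g && qb h then half *+ (A * qa k) else 0) +
    (if qb g && qb h then half *+ (B * qb k) else 0).
  by rewrite chiE //; case: ifP; rewrite ?addr0.
rewrite -/(qb g) -/(qb h) E4 in E1.
rewrite mulrnDr; zlin (zadd E1 (zadd (zopp E2) E3)).
Qed.

Local Notation z := (x ^+ (2 ^ m.+1))%g.
Let Cz : z \in C. Proof. exact: mem_cycle. Qed.
Let qaz : (qa z)%:Z = n * 2.
Proof. by rewrite qaC // glogX ?two_n // ox ltn_exp2l. Qed.

Lemma qe1l g : g \in S -> qe 1%g g = 0.
Proof.
move=> Sg; have n4 : n * 4 != 0 by rewrite mulf_neq0.
have := qeE (group1 S) Sg; rewrite /raw (qbC (group1 _)) (qaC (group1 _)) glog1 mul1g.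
by move=> /= E; apply: (mulfI n4); lra.
Qed.
Lemma qe1r g : g \in S -> qe g 1%g = 0.
Proof.
move=> Sg; have n4 : n * 4 != 0 by rewrite mulf_neq0.
have := qeE Sg (group1 S); rewrite /raw (qbC (group1 _)) (qaC (group1 _)) glog1 mulg1 andbF.
by move=> /= E; apply: (mulfI n4); lra.
Qed.

Lemma qc_normalized g h : g \in S -> h \in S ->
  [/\ qc 1%g g h = 0, qc g 1%g h = 0 & qc g h 1%g = 0].
Proof.
move=> Sg Sh; rewrite /qc /qform !qe1l // !qe1r // !(qbC (group1 _)) (qaC (group1 _)) glog1.
by split; rewrite ?andbF ?addbF /=; apply/eqP; rewrite -(mulr0z (zeta m.+3)); apply/eqP;
   congr (_ *~ _); rewrite ?(andbF, addbF) /=; case: (qb g); case: (qb h) => /=; ring.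
Qed.

Lemma qc_half : qc z z z = half.
Proof.
rewrite qc_cyc // /cyc3 /carry !glogX ?ox ?ltn_exp2l //.
by rewrite addnn -mul2n -expnS leqnn mulr1n (zeta_half zeta1 zetaS).
Qed.

(** For [g * g = z] and normalized [w], an invariant of the class of the
    restriction of [w] to the cyclic group of order 4 generated by [g]. *)
Definition jinv (w : gT -> gT -> gT -> M) g :=
  w g z z + w z z g - w z g z + (w z g g + w g g z - w g z g).

Lemma qc_jinv g : g \in S -> (g * g = z)%g -> jinv qc g = zeta m.+3 *~ (n * 2).
Proof.
move=> Sg gg; have n4 : n * 4 != 0 by rewrite mulf_neq0.
have cgz : (g * z = z * g)%g by rewrite -gg mulgA.
have zz : (z * z = 1)%g by rewrite -expgD addnn -mul2n -expnS -ox expg_order.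
have ezz : qe z z = 1.
  have := qeE (CS Cz) (CS Cz); rewrite /raw qbC // qaz zz qaC // glog1 /= => E.
  apply: (mulfI n4); lra.
have E1 := qeE Sg (CS Cz); have E2 := qeE (CS Cz) Sg; have E3 := qeE Sg Sg.
rewrite /raw qbC // qaz ?cgz ?gg ?qaz in E1 E2 E3.
rewrite /jinv /qc ezz (qbC Cz) qaz -!(mulrzDr, mulrzBr).
have [Cg|nCg] := boolP (g \in C).
  rewrite (qbC Cg) /= in E1 E2 E3 *.
  have e12 : qe z g = qe g z by apply: (mulfI n4); lra.
  apply/eqP; rewrite -subr_eq0 -mulrzBr -(zeta8 (qe g g)); apply/eqP; congr (_ *~ _).
  rewrite /qform /= e12.
  have {}E3 : n * 4 * qe g g = (qa g)%:Z * 2 - n * 2 by lra.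
  have -> : n * 8 * qe g g = 2 * (n * 4 * qe g g) by ring.
  rewrite E3.
  transitivity (2 * (qa g)%:Z - n * 2 + n * 4 * qe g g); first by ring.
  by rewrite E3; ring.
have qg : qb g = true by rewrite /qb nCg.
rewrite qg /= in E1 E2 E3 *.
have e2 : qe z g = qe g z - 1 by apply: (mulfI n4); lra.
have e3 : qe g g = 0 by apply: (mulfI n4); lra.
by congr (_ *~ _); rewrite /qform /= e2 e3; ring.
Qed.

Section Admissible.
Variables (w : gT -> gT -> gT -> M) (tau : gT -> M).
Hypothesis wz : cocycle3_on S w.
Hypothesis w1 : forall g h, g \in S -> h \in S ->
  [/\ w 1%g g h = 0, w g 1%g h = 0 & w g h 1%g = 0].
Hypothesis tauE : forall g h, g \in S -> h \in S ->
  tau g + tau h - tau (g * h)%g = w z g h + w g h z - w g z h.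
(* [chi g] is [theta_g(z, z) tau(g)^2], written additively. *)
Let chi g := w g z z + w z z g - w z g z + tau g *+ 2.
Hypothesis chiM : character S chi.

Lemma jinv_const : exists c, forall g, g \in S -> (g * g = z)%g -> jinv w g = c.
Proof.
have [j [f fE]] := quaternion_H3 wz.
exists (zeta m.+3 *~ (n * 2) *+ j) => g Sg gg.
have Sz := CS Cz; have S1 := group1 S.
have cgz : (g * z = z * g)%g by rewrite -gg mulgA.
have zz : (z * z = 1)%g by rewrite -expgD addnn -mul2n -expnS -ox expg_order.
have := fE _ _ _ Sg S1 S1; have := fE _ _ _ S1 S1 Sg.
have [q1 q2 q3] := qc_normalized Sg S1; have [r1 r2 r3] := w1 Sg S1.
have [q1' q2' q3'] := qc_normalized S1 Sg; have [r1' r2' r3'] := w1 S1 Sg.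
rewrite q3 r3 q1' r1' mul0rn !mul1g !mulg1 => F1 F2.
rewrite -(qc_jinv Sg gg) /jinv.
have := fE g z z Sg Sz Sz; have := fE z z g Sz Sz Sg; have := fE z g z Sz Sg Sz.
have := fE z g g Sz Sg Sg; have := fE g g z Sg Sg Sz; have := fE g z g Sg Sz Sg.
rewrite cgz !zz !gg => E1 E2 E3 E4 E5 E6.
rewrite !(mulrnDl, mulNrn).
zlin (zadd E6 (zadd E5 (zadd (zopp E4) (zadd E3 (zadd E2 (zadd (zopp E1) (zadd F1 F2))))))).
Qed.

(** By [jinv_const] the character [chi] has the same value at all square roots of
    [z]. Both [y] and [y * x] are such, so [chi x = 0]; the power [x ^+ (2 ^ m)]
    is another one, so the common value is 0, and [chi y = 0]. *)
Lemma quaternion_admissible g : g \in S -> chi g = 0.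
Proof.
have [c cE] := jinv_const.
have sqz h : h \in S -> (h * h = z)%g -> chi h = c + tau z.
  move=> Sh hh; rewrite -(cE h Sh hh) /chi /jinv.
  have := tauE Sh Sh; rewrite hh => E; zlin E.
have Cx := cycle_id x.
have yxyx : (y * x * (y * x) = z)%g by rewrite {1}yx -!mulgA (mulgA y y) yy -expgSr expgS mulKg.
have chix : chi x = 0.
  apply: (@addrI _ (chi y)); rewrite addr0 -chiM //.
  by rewrite (sqz _ (groupM Sy Sx) yxyx) (sqz _ Sy yy).
have [_ chiC] := char_log sCS chiM.
have chiC0 h : h \in C -> chi h = 0 by move=> Ch; rewrite chiC // chix mul0rn.
have c0 : c + tau z = 0.
  rewrite -(sqz (x ^+ (2 ^ m))%g) ?chiC0 ?groupX // -expgD addnn -mul2n -expnS //.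
move=> Sg; rewrite (qcoord Sg) chiM ?groupX // (chiC0 _ (mem_cycle x (qa g))) addr0.
case: (qb g); last by rewrite expg0 chiC0 ?group1.
by rewrite expg1 (sqz _ Sy yy).
Qed.
End Admissible.

(** A character of [C] that kills [y * y] takes [x] to a value killed by half the
    order of [x], so its square root is again a character. *)
Lemma quaternion_H2 (a : gT -> gT -> M) : cocycle2_on S a -> cobound2_on S a.
Proof.
apply: (inverting_H2 divM sCS indC Sy nCy quaternion_inv (@cyclic_H2 M gT divM x)).
move=> psi psiM psi0; have [psix psiC] := char_log (subxx _) psiM.
have [eta etaE] := divM (psi x) (isT : 0 < 2)%N.
exists (fun g => eta *+ glog x g) => [|h Ch].
  apply: log_char; rewrite ox expnS mulrnA etaE.
  by move: psi0; rewrite yy psiC ?mem_cycle // glogX // ox ltn_exp2l.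
by rewrite psiC // -etaE mulrnAC.
Qed.

End Quaternion.

(** * Groups with a unique involution *)

Section UniqueInvolution.
Variables (gT : finGroupType) (M : zmodType).
Variables (half : M) (zeta : nat -> M).
Hypothesis divM : forall (n : nat) (m : M), (0 < n)%N -> exists m', m' *+ n = m.
Hypotheses (half0 : half != 0) (tor2 : forall m : M, m *+ 2 = 0 -> m = 0 \/ m = half)
  (zeta0 : zeta 0 = 0) (zeta1 : zeta 1 = half) (zetaS : forall n, zeta n.+1 *+ 2 = zeta n).

Definition normalized (K : {set gT}) (w : gT -> gT -> gT -> M) :=
  forall g h, g \in K -> h \in K -> [/\ w 1%g g h = 0, w g 1%g h = 0 & w g h 1%g = 0].

(** These are [theta_z(x, y)] and [theta_g(z, z)], written additively. *)
Definition slant (w : gT -> gT -> gT -> M) (z x y : gT) := w z x y + w x y z - w x z y.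
Definition slant2 (w : gT -> gT -> gT -> M) (z g : gT) := w g z z + w z z g - w z g z.

Definition generates_H3 (S : {group gT}) (z : gT) (c : gT -> gT -> gT -> M) :=
  [/\ cocycle3_on S c, normalized S c, c z z z = half &
    forall w, cocycle3_on S w -> exists j, cohomologous3 S w (fun g h k => c g h k *+ j)].

(** The character [xi] is the component at [z] of the second member of an
    admissible pair. *)
Definition slant_trivializable (S : {group gT}) z := forall w tau,
  cocycle3_on S w -> normalized S w ->
  (forall g h, g \in S -> h \in S -> tau g + tau h - tau (g * h)%g = slant w z g h) ->
  character S (fun g => slant2 w z g + tau g *+ 2) ->
  exists2 xi, character S xi & forall g, g \in S -> slant2 w z g + tau g *+ 2 = xi g *+ 2.

Section Two.
Variables (S : {group gT}) (z : gT).
Hypotheses (Sz : z \in S) (oz : #[z]%g = 2%N).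

Lemma normalized_torsion w : cocycle3_on S w -> normalized S w -> w z z z *+ 2 = 0.
Proof.
move=> wz w1; have zz : (z * z = 1)%g by rewrite -[RHS](expg_order z) oz.
have := wz z z z z Sz Sz Sz Sz; rewrite zz.
by have [-> -> ->] := w1 z z Sz Sz => E; rewrite mulr2n; zlin E.
Qed.

(** A character of a cyclic group is a square when it is trivial on the
    involution, and the primitive [tau] of the slant makes [chi z] equal to
    [w z z z *+ 2 = 0]. *)
Lemma cyclic_case x n : (S :=: <[x]>)%g -> #[x]%g = (2 ^ n.+1)%N -> z = (x ^+ (2 ^ n))%g ->
  [/\ forall a : gT -> gT -> M, cocycle2_on S a -> cobound2_on S a,
      exists c, generates_H3 S z c & slant_trivializable S z].
Proof.
move=> Sx ox zE.
have e0 : zeta n.+1 *+ #[x]%g = 0 by rewrite ox (zeta_tor zeta0 zeta1 zetaS).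
have lz : glog x z = (2 ^ n)%N by rewrite zE glogX // ox ltn_exp2l.
split.
- by move=> a; rewrite Sx; exact: (cyclic_H2 divM).
- exists (cyc3 x (zeta n.+1)); split.
  + by rewrite Sx; apply: cyc3_cocycle.
  + move=> g h; rewrite Sx /cyc3 /carry glog1 => /glogP[_ lg] _.
    by rewrite add0n addn0 mulr0n mul0rn leqNgt lg.
  + by rewrite /cyc3 /carry lz ox addnn -mul2n -expnS leqnn mulr1n (zeta_half zeta1 zetaS).
  + by move=> w; rewrite Sx; exact: (cyclic_H3 divM tor2 zeta0 zeta1 zetaS ox).
move=> w tau wz w1 tauE chiM.
set chi := fun g => _ in chiM; have sSx : (<[x]> \subset S)%g by rewrite Sx.
have [chi0 chiC] := char_log sSx chiM.
have [j jE] := tor2n tor2 zeta1 zetaS (etrans (congr1 _ (esym ox)) chi0).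
have zz : (z * z = 1)%g by rewrite -[RHS](expg_order z) oz.
have tau1 : tau 1%g = 0.
  have [a b _] := w1 z 1%g Sz (group1 S); have [c _ _] := w1 1%g z (group1 S) Sz.
  have := tauE _ _ (group1 S) (group1 S); rewrite /slant a b c mulg1 => E; zlin E.
have chiz : chi z = 0.
  have := tauE z z Sz Sz; rewrite zz tau1 /chi /slant2 /slant => E.
  have E2 := normalized_torsion wz w1; rewrite mulr2n in E2 *.
  zlin (zadd E E2).
have ev : ~~ odd j.
  apply: contraNN half0 => od; move: chiz.
  rewrite chiC -?Sx // lz jE -mulrnA mulnC mulrnA (zeta_half zeta1 zetaS).
  rewrite -(odd_double_half j) od -muln2 mulnC mulrnDr mulrnA mulr1n.
  by rewrite (half2 zeta0 zeta1 zetaS) mul0rn addr0 => ->.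
exists (fun g => zeta n.+1 *+ j./2 *+ glog x g) => [|g Sg].
  by rewrite Sx; apply: log_char; rewrite mulrnAC e0 mul0rn.
rewrite -/(chi g) chiC -?Sx // jE [RHS]mulrnAC -[X in _ = X *+ _]mulrnA.
by rewrite muln2 -[in LHS](odd_double_half j) (negbTE ev).
Qed.
End Two.

Theorem two_group_cohomology (S : {group gT}) z : (2.-group S)%g -> z \in S -> #[z]%g = 2%N ->
  (forall u, u \in S -> #[u]%g = 2%N -> u = z) ->
  [/\ forall a : gT -> gT -> M, cocycle2_on S a -> cobound2_on S a,
      exists c, generates_H3 S z c & slant_trivializable S z].
Proof.
move=> pS Sz oz zuniq.
have ntS : (S :!=: 1)%g.
  by apply/eqP => S1; move: Sz; rewrite S1 => /set1P z1; move: oz; rewrite z1 order1.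
have OhmS : 'Ohm_1(S)%g = <[z]>%g.
  rewrite (OhmE 1 pS) expn1; apply/eqP; rewrite eqEsubset gen_subG cycle_subG.
  apply/andP; split; last by apply: mem_gen; rewrite !inE Sz -oz expg_order eqxx.
  apply/subsetP => u; rewrite !inE => /andP[Su /eqP u2].
  have [->|u1] := eqVneq u 1%g; first exact: group1.
  by rewrite (zuniq u) ?cycle_id //; apply: nt_prime_order.
have oOhm : #|'Ohm_1(S)|%g = 2%N by rewrite OhmS -orderE.
have /orP[/cyclicP[x Sx]|/andP[_ /eqP/quaternion_classP[n n2 isoQ]]] :=
  introT (prime_Ohm1P pS ntS) oOhm.
  have [n ox] : exists n, #[x]%g = (2 ^ n)%N.
    by have [n nE] := p_natP pS; exists n; rewrite orderE -Sx.
  case: n ox => [|n] ox.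
    by case/eqP: ntS; rewrite Sx; apply/eqP; rewrite cycle_eq1 -order_eq1 ox.
  apply: (@cyclic_case _ _ Sz oz x n Sx ox); symmetry; apply: zuniq.
    by rewrite Sx mem_cycle.
  by rewrite orderXdiv ox ?dvdn_exp2l // -expnB ?subSnn.
have [[x y] [oS Sx ox]] := generators_quaternion n2 isoQ.
rewrite inE => /andP[nCy Sy] [oy y2 xy].
case: n n2 oS ox y2 isoQ => // -[//|[//|m]] _ oS ox y2 isoQ; rewrite /= in ox.
have sCS : (<[x]> \subset S)%g by rewrite cycle_subG.
have indC : #|S : <[x]>|%g = 2%N.
  by rewrite -divgS // oS -orderE ox -expnB ?subSnn.
have yy : (y * y = x ^+ (2 ^ m.+1))%g by rewrite -y2.
have yx : (y * x = x^-1 * y)%g.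
  by apply: (mulgI x); rewrite mulKVg mulgA (conjgC x y) xy mulgKV.
have zE : z = (x ^+ (2 ^ m.+1))%g.
  symmetry; apply: zuniq; first by rewrite groupX.
  by rewrite orderXdiv ox ?dvdn_exp2l // -expnB ?subSnn.
split.
- exact: (quaternion_H2 divM sCS indC Sy nCy ox yx yy).
- exists (qc x y m zeta); split.
  + exact: (qc_cocycle zeta0 zeta1 zetaS sCS indC Sy nCy ox yx yy).
  + exact: (qc_normalized zeta sCS indC Sy nCy ox yx yy).
  + rewrite zE; exact: (qc_half zeta1 zetaS sCS indC Sy nCy ox yx yy).
  + exact: (quaternion_H3 divM tor2 zeta0 zeta1 zetaS sCS indC Sy nCy ox yx yy).
move=> w tau wz w1 tauE chiM; exists (fun=> 0) => [g h _ _|g Sg]; first by rewrite addr0.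
rewrite mul0rn /slant2 zE.
apply: (quaternion_admissible divM tor2 zeta0 zeta1 zetaS sCS indC Sy nCy ox yx yy wz w1 _ _ Sg).
  by move=> a b Sa Sb; rewrite tauE // zE.
by move=> a b Sa Sb; have := chiM a b Sa Sb; rewrite /slant2 zE.
Qed.
End UniqueInvolution.

Section UniqueInvolutionGroup.
Variables (gT : finGroupType) (M : zmodType).
Variables (half : M) (zeta : nat -> M).
Hypothesis divM : forall (n : nat) (m : M), (0 < n)%N -> exists m', m' *+ n = m.
Hypotheses (half0 : half != 0) (tor2 : forall m : M, m *+ 2 = 0 -> m = 0 \/ m = half)
  (zeta0 : zeta 0 = 0) (zeta1 : zeta 1 = half) (zetaS : forall n, zeta n.+1 *+ 2 = zeta n).
Variables (K : {group gT}) (z : gT).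
Hypotheses (Kz : z \in K) (oz : #[z]%g = 2%N) (zuniq : forall u, u \in K -> #[u]%g = 2%N -> u = z).
Implicit Types (w v : gT -> gT -> gT -> M).
Let zz : (z * z = 1)%g. Proof. by rewrite -[RHS](expg_order z) oz. Qed.

Lemma involution_central t : t \in K -> commute z t.
Proof.
move=> Kt; have /conjg_fixP : (z ^ t)%g = z by apply: zuniq; rewrite ?groupJ ?orderJ.
by move/commgP.
Qed.

(** This is [w z z z] when [w] is normalized. The other two terms make it vanish
    on all coboundaries, so that it is defined on classes. *)
Definition involution_sign w := w z z z - w 1%g z z - w z z 1%g.
Local Notation eps := involution_sign.

Lemma involution_sign_cobound w : cobound3_on K w -> eps w = 0.
Proof.
move=> [f fE]; rewrite /involution_sign !fE //; rewrite zz !mul1g !mulg1; zmod.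
Qed.

Lemma involution_sign_cohom w v : cohomologous3 K w v -> eps w = eps v.
Proof. move=> /involution_sign_cobound; rewrite /involution_sign => E; zlin E. Qed.

Lemma involution_sign_tor2 w : cocycle3_on K w -> eps w *+ 2 = 0.
Proof.
move=> wz; rewrite /involution_sign; have K1 := group1 K.
have E1 := wz z z z z Kz Kz Kz Kz; have E2 := wz z 1%g 1%g z Kz K1 K1 Kz.
have E3 := wz 1%g 1%g z z K1 K1 Kz Kz; have E4 := wz z z 1%g 1%g Kz Kz K1 K1.
have E5 := wz 1%g 1%g 1%g 1%g K1 K1 K1 K1.
rewrite ?mulg1 ?mul1g ?zz in E1 E2 E3 E4 E5.
zlin (zadd E1 (zadd E2 (zadd (zopp E3) (zadd (zopp E4) (zopp (zadd E5 E5)))))).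
Qed.

(** Transfer from the trivial subgroup. *)
Lemma cobound3_exponent w : cocycle3_on K w -> cobound3_on K (fun x y t => w x y t *+ #|K|).
Proof.
move=> wz; have w1 : cohomologous3 1%g w (fun _ _ _ => 0).
  apply: cohom3_eq => g h k /set1P-> /set1P-> /set1P->.
  have := wz 1%g 1%g 1%g 1%g (group1 K) (group1 K) (group1 K) (group1 K).
  rewrite !mulg1 => E; zlin E.
have [f fE] := transfer3_res (sub1G K) wz w1; exists f => x y t Kx Ky Kt.
rewrite -fE // indexg1; suff -> : transfer3 1 K (fun _ _ _ => 0 : M) x y t = 0 by rewrite subr0.
by rewrite -[RHS](mul0rn _ #|K : 1|%g); apply: coset_sum_const => //; apply: sub1G.
Qed.

(** A Sylow 2-subgroup [P] falls under [two_group_cohomology], and its index [m]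
    is odd. *)
Section Sylow.
Variable P : {group gT}.
Hypothesis sylP : (2.-Sylow(K) P)%g.
Let sPK : P \subset K. Proof. exact: pHall_sub sylP. Qed.
Let m := #|K : P|%g.
Let PK h : h \in P -> h \in K. Proof. exact: (subsetP sPK). Qed.

Lemma sylow_index : m = (m./2.*2).+1.
Proof.
have : odd m by rewrite /m -coprime2n; have [_ _] := and3P sylP; rewrite p'natE // coprime2n dvdn2 negbK.
by move=> od; rewrite -[LHS]odd_double_half od.
Qed.

Lemma sylow_involution : z \in P.
Proof.
have [Q [sylQ zQ]] : exists Q : {group gT}, (2.-Sylow(K) Q)%g /\ z \in Q.
  have pz : (2.-group <[z]>)%g by rewrite /pgroup -orderE oz.
  have sz : (<[z]> \subset K)%g by rewrite cycle_subG.
  have [Q sylQ sQ] := Sylow_superset sz pz; exists Q; split => //.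
  by rewrite -cycle_subG.
have [x Kx QE] := Sylow_trans sylP sylQ.
move: zQ; rewrite QE mem_conjg.
by rewrite (_ : z ^ x^-1 = z)%g //; apply/conjg_fixP/commgP/involution_central; rewrite groupV.
Qed.

Let sylowP : [/\ forall a : gT -> gT -> M, cocycle2_on P a -> cobound2_on P a,
      exists c, generates_H3 half P z c & slant_trivializable M P z].
Proof.
apply: (two_group_cohomology divM half0 tor2 zeta0 zeta1 zetaS (pHall_pgroup sylP) sylow_involution oz).
by move=> u /PK; exact: zuniq.
Qed.

Lemma odd_multiple (c : M) : c = c *+ m - c *+ m./2 *+ 2.
Proof. by rewrite {1}sylow_index mulrS -mulrnA muln2 addrK. Qed.

(** Since [z] is central, the transfer of the generator takes at [z], [z], [z] the
    value of the generator multiplied by [m]. *)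
Lemma sylow_exists_sign : exists2 w, cocycle3_on K w & eps w = half.
Proof.
have [_ [c [cz c1 chalf _]] _] := sylowP; have Pz := sylow_involution.
exists (transfer3 P K c); first exact: transfer3_cocycle.
have P1 := group1 P; have cz1 t : t \in K -> commute 1%g t by move=> _; apply/commute_sym/commute1.
have cc := involution_central.
have [e1 _ _] := c1 z z Pz Pz; have [_ _ e2] := c1 z z Pz Pz.
rewrite /involution_sign !(transfer3_central sPK) // e1 e2 chalf mul0rn !subr0 -/m sylow_index.
by rewrite -muln2 mulnC mulrSr mulrnA (half2 zeta0 zeta1 zetaS) mul0rn add0r.
Qed.

(** On [P] the class of [w] is an even multiple [j] of the generator [c], so
    [w = m w - 2 (m./2) w] and [m w] is the transfer of [j c]. *)
Lemma sylow_sign0_divide w : cocycle3_on K w -> eps w = 0 ->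
  exists2 v, cocycle3_on K v & cohomologous3 K w (fun x y t => v x y t *+ 2).
Proof.
move=> wz ew; have Pz := sylow_involution; have P1 := group1 P.
have [_ [c [cz c1 chalf cgen]] _] := sylowP.
have wzP : cocycle3_on P w by move=> g h k l *; apply: wz; apply: PK.
have [j jE] := cgen w wzP.
have ej : half *+ j = 0.
  have [f fE] := jE; move: ew; rewrite /involution_sign.
  have [e1 _ _] := c1 z z Pz Pz; have [_ _ e2] := c1 z z Pz Pz.
  have F1 := fE z z z Pz Pz Pz; have F2 := fE 1%g z z P1 Pz Pz; have F3 := fE z z 1%g Pz Pz P1.
  rewrite chalf in F1; rewrite e1 mul0rn in F2; rewrite e2 mul0rn in F3.
  rewrite ?zz ?mul1g ?mulg1 in F1 F2 F3 => E.
  zlin (zadd (zopp F1) (zadd F2 (zadd F3 E))).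
have ev : ~~ odd j.
  apply: contraNN half0 => od; move: ej.
  rewrite -(odd_double_half j) od -muln2 mulnC mulrnDr mulrnA mulr1n.
  by rewrite (half2 zeta0 zeta1 zetaS) mul0rn addr0 => ->.
pose v x y t := transfer3 P K (fun x y t => c x y t *+ j./2) x y t - w x y t *+ m./2.
exists v.
  by apply: cocycle3B; [apply: transfer3_cocycle => //; apply: cocycle3Mn | apply: cocycle3Mn].
have [|f fE] := @transfer3_res _ _ P K sPK w (fun x y t => c x y t *+ j./2 *+ 2) wz.
  have [f fE] := jE; exists f => x y t Px Py Pt; rewrite -fE // -mulrnA muln2.
  by rewrite -{2}(odd_double_half j) (negbTE ev).
exists f => x y t Kx Ky Kt; rewrite -fE // -/m /v.
have -> : transfer3 P K (fun x y t => c x y t *+ j./2 *+ 2) x y t =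
    transfer3 P K (fun x y t => c x y t *+ j./2) x y t *+ 2.
  by rewrite !mulr2n -coset_sumD; apply: eq_coset_sum => // s Ks; rewrite /homog3 mulr2n.
have E := odd_multiple (w x y t); rewrite mulrnBl; zlin E.
Qed.

(** Alternating sum of the cocycle equation over the six shuffles of [z], [z] with
    [x], [y]. *)
Lemma shuffle_identity w x y : cocycle3_on K w -> normalized K w -> x \in K -> y \in K ->
  slant w z x y *+ 2 + slant2 w z x + slant2 w z y = slant2 w z (x * y)%g.
Proof.
move=> wz w1 Kx Ky; have K1 := group1 K; rewrite /slant /slant2.
have E1 := wz z z x y Kz Kz Kx Ky; have E2 := wz z x z y Kz Kx Kz Ky.
have E3 := wz z x y z Kz Kx Ky Kz; have E4 := wz x z z y Kx Kz Kz Ky.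
have E5 := wz x z y z Kx Kz Ky Kz; have E6 := wz x y z z Kx Ky Kz Kz.
have cx : (z * x = x * z)%g := involution_central Kx.
have cy : (z * y = y * z)%g := involution_central Ky.
have cxy : (z * (x * y) = x * y * z)%g := involution_central (groupM Kx Ky).
have [a1 a2 a3] := w1 x y Kx Ky.
rewrite ?zz ?cx ?cy ?cxy ?a1 ?a2 ?a3 in E1 E2 E3 E4 E5 E6.
zlin (zadd E1 (zadd (zopp E2) (zadd E3 (zadd E4 (zadd (zopp E5) E6))))).
Qed.

(** Alternating sum of the cocycle equation over the four shuffles of [z] with
    [x], [y], [t]. *)
Lemma slant_cocycle w : cocycle3_on K w -> cocycle2_on K (slant w z).
Proof.
move=> wz x y t Kx Ky Kt; rewrite /slant.
have E1 := wz z x y t Kz Kx Ky Kt; have E2 := wz x z y t Kx Kz Ky Kt.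
have E3 := wz x y z t Kx Ky Kz Kt; have E4 := wz x y t z Kx Ky Kt Kz.
have cx : (z * x = x * z)%g := involution_central Kx.
have cy : (z * y = y * z)%g := involution_central Ky.
have ct : (z * t = t * z)%g := involution_central Kt.
rewrite ?cx ?cy ?ct in E1 E2 E3 E4.
zlin (zadd (zopp E1) (zadd E2 (zadd (zopp E3) E4))).
Qed.

(** The slant is a coboundary on [P], hence its multiple by [m] is one, and its
    double is one by the shuffle identity. *)
Lemma slant_cobound w : cocycle3_on K w -> normalized K w -> cobound2_on K (slant w z).
Proof.
move=> wz w1; have [H2 _ _] := sylowP.
have sz := slant_cocycle wz.
have [f fE] := cobound2_transfer sPK sz (H2 _ (fun x y t Px Py Pt => sz x y t (PK Px) (PK Py) (PK Pt))).
exists (fun x => f x + slant2 w z x *+ m./2) => x y Kx Ky.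
have E := odd_multiple (slant w z x y); have E1 := fE x y Kx Ky; rewrite -/m in E1.
have E2 := congr1 (fun c => c *+ m./2) (shuffle_identity wz w1 Kx Ky).
move: E E1 E2; move: (slant w z x y) (slant2 w z _) (slant2 w z _) (slant2 w z _).
move=> a b c d E E1; rewrite !mulrnDl => E2.
zlin (zadd E (zadd E1 (zopp E2))).
Qed.

(** The function [chi] is a character by the shuffle identity. A square root on [P]
    yields one of [m] times [chi] by transfer, and [m] is odd. *)
Lemma sylow_admissible w : cocycle3_on K w -> normalized K w ->
  exists tau nu : gT -> M,
   [/\ forall g h, g \in K -> h \in K -> tau g + tau h - tau (g * h)%g = slant w z g h,
       character K nu &
       forall g, g \in K -> nu g *+ 2 = slant2 w z g + tau g *+ 2].
Proof.
move=> wz w1; have [tau tauE] := slant_cobound wz w1.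
pose chi g := slant2 w z g + tau g *+ 2.
have chiM : character K chi.
  move=> x y Kx Ky; have := shuffle_identity wz w1 Kx Ky; rewrite tauE // => E.
  rewrite /chi; zlin (zopp E).
have [_ _ adm] := sylowP.
have [||||xi xiM xiE] := adm w tau.
- by move=> x y t s *; apply: wz; apply: PK.
- by move=> g h Pg Ph; apply: w1; apply: PK.
- by move=> g h Pg Ph; rewrite tauE ?PK.
- by move=> g h Pg Ph; apply: chiM; apply: PK.
exists tau, (fun g => transfer1 P K xi g - chi g *+ m./2); split.
- by move=> g h Kg Kh; rewrite tauE.
- have trM := transfer1_char sPK xiM; move=> g h Kg Kh.
  by rewrite trM // chiM // mulrnDl; zmod.
move=> g Kg; have := transfer1_res sPK chiM Kg; rewrite -/m.
have -> : transfer1 P K chi g = transfer1 P K xi g *+ 2.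
  rewrite mulr2n -coset_sumD; apply: eq_coset_sum => // t Kt.
  by rewrite /chi xiE ?groupM ?groupV ?retract_in // mulr2n.
move=> E1; have E2 := odd_multiple (chi g); rewrite -/(chi g).
by rewrite mulrnBl; zlin (zadd E1 (zopp E2)).
Qed.
End Sylow.

Theorem exists_sign : exists2 w, cocycle3_on K w & involution_sign w = half.
Proof. by have [P sylP] := Sylow_exists 2 K; apply: sylow_exists_sign sylP. Qed.

Theorem sign0_divide w : cocycle3_on K w -> involution_sign w = 0 ->
  exists2 v, cocycle3_on K v & cohomologous3 K w (fun x y t => v x y t *+ 2).
Proof. by have [P sylP] := Sylow_exists 2 K; exact: (sylow_sign0_divide sylP). Qed.

Theorem admissible_exists w : cocycle3_on K w -> normalized K w ->
  exists tau nu : gT -> M,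
   [/\ forall g h, g \in K -> h \in K -> tau g + tau h - tau (g * h)%g = slant w z g h,
       character K nu &
       forall g, g \in K -> nu g *+ 2 = slant2 w z g + tau g *+ 2].
Proof. by have [P sylP] := Sylow_exists 2 K; exact: (sylow_admissible sylP). Qed.
End UniqueInvolutionGroup.

From mathcomp Require Import all_field generic_quotient ring_quotient mxtens boolp.

(** * Simple modules and traces *)

Section Representations.
Variables (F : fieldType) (H : qtqh F).
Implicit Types X Y : rep H.

(** Schur's lemma: the kernel of [E - a] is a submodule. With a quadratic equation
    for [E] no eigenvalue has to be found. *)
Lemma simple_scalar X (E : 'M[F]_(rdim X)) (a b : F) : simple_rep X ->
  (forall h, E *m X h = X h *m E) -> (E - a%:M) *m (E - b%:M) = 0 -> E = a%:M \/ E = b%:M.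
Proof.
move=> [_ sX] cE Eab; have [h|U0|Ufull] := sX (kermx ((E - a%:M)^T)).
- apply/sub_kermxP; rewrite -mulmxA -trmx_mul mulmxBl mul_scalar_mx cE.
  rewrite -(mul_mx_scalar a) -mulmxBr trmx_mul mulmxA mulmx_ker mul0mx //.
- right; apply/eqP; rewrite -subr_eq0 -trmx_eq0; apply/eqP.
  apply: (row_free_inj (A := (E - a%:M)^T)); first by rewrite -kermx_eq0 U0.
  by rewrite mul0mx -trmx_mul Eab trmx0.
left; apply/eqP; rewrite -subr_eq0 -trmx_eq0; apply/eqP.
have := mulmx_ker ((E - a%:M)^T); move/(congr1 (mulmx (pinvmx (kermx (E - a%:M)^T)))).
by rewrite mulmxA mulVpmx // mul1mx mulmx0.
Qed.

Section Compress.
Variables (X : rep H) (r : nat) (B : 'M[F]_(r, rdim X)) (p : 'M[F]_(rdim X, r)).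
(** When the rows of [B] span a submodule, or a complement of one, and [p] is dual
    to [B], this is the induced action on the submodule or on the quotient. *)
Definition compress_act (h : H) : 'M[F]_r := (B *m (X h)^T *m p)^T.
Fact compress_linear : linear compress_act.
Proof.
move=> a u v; rewrite /compress_act linearP /= [(_ *: _ + _)^T]linearP /=.
by rewrite mulmxDr mulmxDl -scalemxAr -scalemxAl [(_ *: _ + _)^T]linearP.
Qed.
HB.instance Definition _ := GRing.isLinear.Build F H 'M[F]_r *:%R compress_act compress_linear.
Hypothesis Bp : B *m p = 1%:M.
Hypothesis actM : forall h k,
  B *m (X h)^T *m (X k)^T *m p = B *m (X h)^T *m p *m (B *m (X k)^T *m p).
Fact compress1 : compress_act 1 = 1%:M.
Proof. by rewrite /compress_act ract1 trmx1 mulmx1 Bp trmx1. Qed.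
Fact compressM a b : compress_act (a * b) = compress_act a *m compress_act b.
Proof.
rewrite /compress_act -trmx_mul -actM; congr (_^T).
by rewrite ractM trmx_mul !mulmxA.
Qed.
Definition compress : rep H := MkRep compress1 compressM.
End Compress.

(** Traces are additive on a submodule and the quotient by it; no complement
    needs to be stable. *)
Lemma stable_split X (U : 'M[F]_(rdim X)) : (forall h, (U *m (X h)^T <= U)%MS) ->
  exists S Q : rep H, [/\ rdim S = \rank U, rdim Q = (rdim X - \rank U)%N &
    forall h, \tr (X h) = \tr (S h) + \tr (Q h)].
Proof.
move=> stU; pose B := row_base U; pose C := row_base (U^C)%MS.
have eqB : (B :=: U)%MS := eq_row_base U; have eqC : (C :=: U^C)%MS := eq_row_base _.
clearbody B C; pose T := col_mx B C.
have rT : \rank T = rdim X.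
  rewrite -addsmxE (adds_eqmx eqB eqC).
  by apply/eqP; apply: addsmx_compl_full.
have rU : (\rank U + \rank (U^C)%MS = rdim X)%N.
  by rewrite mxrank_compl subnKC // rank_leq_col.
have TK : pinvmx T *m T = 1%:M by apply: mulVpmx; rewrite /row_full rT.
have KT : T *m pinvmx T = 1%:M by apply: mulmxVp; rewrite /row_free rT rU.
pose pB := lsubmx (pinvmx T); pose pC := rsubmx (pinvmx T).
have pE : pinvmx T = row_mx pB pC by rewrite hsubmxK.
have sumE : pB *m B + pC *m C = 1%:M by rewrite -mul_row_col -pE.
have := KT; rewrite pE mul_col_row scalar_mx_block => /eq_block_mx[BB BC CB CC].
have BpC h : B *m (X h)^T *m pC = 0.
  have /submxP[D ->] : (B *m (X h)^T <= B)%MS.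
    by rewrite (eqmxMr _ eqB) (submx_trans (stU h)) ?eqB.
  by rewrite -mulmxA BC mulmx0.
have actB h k : B *m (X h)^T *m (X k)^T *m pB = B *m (X h)^T *m pB *m (B *m (X k)^T *m pB).
  rewrite -{1}(mulmx1 (B *m (X h)^T)) -sumE mulmxDr [_ *m (pC *m C)]mulmxA BpC mul0mx addr0.
  by rewrite !mulmxA.
have actC h k : C *m (X h)^T *m (X k)^T *m pC = C *m (X h)^T *m pC *m (C *m (X k)^T *m pC).
  rewrite -{1}(mulmx1 (C *m (X h)^T)) -sumE; move: (C *m (X h)^T) => c.
  have E : c *m pB *m B *m (X k)^T *m pC = 0.
    by rewrite -[LHS]mulmxA -[LHS]mulmxA [B *m _]mulmxA BpC mulmx0.
  by rewrite mulmxDr !mulmxDl !mulmxA E add0r.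
exists (compress BB actB), (compress CC actC); split => //.
  by rewrite /= mxrank_compl.
move=> h; rewrite /= /compress_act !mxtrace_tr -(mxtrace_tr (X h)).
rewrite -{1}(mulmx1 (X h)^T) -sumE mulmxDr mxtraceD.
by congr (_ + _); rewrite mulmxA mxtrace_mulC !mulmxA.
Qed.

(** Induction on the dimension, by [stable_split]. *)
Lemma trace_zero (u : H) : (forall Y, simple_rep Y -> Y u = 0) -> forall X, \tr (X u) = 0.
Proof.
move=> u0 X; move: {2}(rdim X).+1 (ltnSn (rdim X)) => n.
elim: n X => // n IH X; rewrite ltnS => Xn.
have [/u0->|nsX] := pselect (simple_rep X); first by rewrite mxtrace0.
have [X0|Xpos] := posnP (rdim X).
  by rewrite /mxtrace big1 // => -[i lti]; have := lti; rewrite {1}X0.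
have [U [stU U0 Ufull]] : exists U : 'M[F]_(rdim X),
    [/\ forall h, (U *m (X h)^T <= U)%MS, U != 0 & ~~ row_full U].
  apply: contrapT => nU; apply: nsX; split=> // U stU.
  have [|U0] := eqVneq U 0; [by left | right].
  by apply: contrapT => nf; apply: nU; exists U; split=> //; apply/negP.
have [S [Q [rS rQ ->]]] := stable_split stU.
have rU : (0 < \rank U)%N by rewrite lt0n mxrank_eq0.
have rUn : (\rank U < rdim X)%N.
  by rewrite ltn_neqAle rank_leq_col andbT.
rewrite (IH S); last by rewrite rS (leq_trans rUn Xn).
by rewrite (IH Q) ?addr0 // rQ (leq_trans _ Xn) // ltn_subrL rU Xpos.
Qed.
End Representations.

(** * Tensor flips *)

Section Flip.
Variable F : fieldType.
Lemma flip_row m n p (E : 'M[F]_(m * n, p)) (i : 'I_(n * m)) k :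
  (flip_mx F m n *m E) i k = E (mxtens_index ((mxtens_unindex i).2, (mxtens_unindex i).1)) k.
Proof.
rewrite mxE; set j0 := mxtens_index _; rewrite (bigD1 j0) // big1 => [|j /= nj].
  by rewrite [LHS]addr0 !mxE mxtens_indexK !eqxx mul1r.
rewrite mxE; case: eqP => [E1|_]; last by rewrite mul0r.
case: eqP => [E2|_]; last by rewrite mul0r.
by rewrite /j0 E1 E2 -surjective_pairing mxtens_unindexK eqxx in nj.
Qed.
Lemma flip_col m n p (E : 'M[F]_(p, n * m)) i (k : 'I_(m * n)) :
  (E *m flip_mx F m n) i k = E i (mxtens_index ((mxtens_unindex k).2, (mxtens_unindex k).1)).
Proof.
rewrite mxE; set j0 := mxtens_index _; rewrite (bigD1 j0) // big1 => [|j /= nj].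
  by rewrite [LHS]addr0 !mxE mxtens_indexK !eqxx mulr1.
rewrite mxE; case: eqP => [E1|_]; last by rewrite mulr0.
case: eqP => [E2|_]; last by rewrite mulr0.
by rewrite /j0 -E1 -E2 -surjective_pairing mxtens_unindexK eqxx in nj.
Qed.
Lemma flip_tens m n (A : 'M[F]_m) (B : 'M[F]_n) :
  flip_mx F m n *m (A *t B) = (B *t A) *m flip_mx F m n.
Proof. by apply/matrixP => i k; rewrite flip_row flip_col !mxE !mxtens_indexK mulrC. Qed.
Lemma flipK m n : flip_mx F n m *m flip_mx F m n = 1%:M.
Proof.
apply/matrixP => i k; rewrite flip_row !mxE mxtens_indexK andbC.
rewrite -(inj_eq (can_inj (@mxtens_unindexK m n)) i k).
by case: (mxtens_unindex i) (mxtens_unindex k) => [a b] [c d]; rewrite xpair_eqE.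
Qed.
End Flip.

(** * Semisimplicity of the twisted double *)

Section Double.
Variables (gT : finGroupType) (F : numFieldType) (w : nZ3 gT F).
Local Notation H := (dbl w).
Local Notation e g x := (ebas w (g, x)).
Implicit Types (u v : H) (g h x y : gT).

Lemma ebasM g x h y : e g x * e h y = if (g ^ x == h)%g then theta w g x y *: e g (x * y)%g else 0.
Proof. exact: dbl_mulb. Qed.

Lemma ebasE p q : ebas w p q = (q == p)%:R. Proof. by rewrite ffunE. Qed.

Lemma dbl1E : (1 : H) = \sum_g e g 1%g. Proof. by []. Qed.

Lemma mul_ebas_coef u k y h t :
  (u * e k y) (h, t) = if (h ^ (t * y^-1) == k)%g then u (h, (t * y^-1)%g) * theta w h (t * y^-1) y else 0.
Proof.
rewrite {1}[u]dblE mulr_suml sum_ffunE (bigD1 (h, t * y^-1)%g) //= big1 => [|[g x] ne].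
  rewrite addr0 -scalerAl ebasM !ffunE; case: eqP => _; last by rewrite ffunE [_ *: _]mulr0.
  by rewrite !ffunE mulgKV eqxx [_ *: _]mulrA mulr1.
rewrite -scalerAl ebasM ffunE; case: eqP => _; last by rewrite ffunE [_ *: _]mulr0.
rewrite !ffunE xpair_eqE; case: eqP => [E1|_]; last by rewrite /= [X in _ *: X]mulr0 [_ *: _]mulr0.
case: eqP => [E2|_]; last by rewrite /= [X in _ *: X]mulr0 [_ *: _]mulr0.
by rewrite E1 E2 mulgK eqxx in ne.
Qed.

Local Notation n := #|{: gT * gT}|.
Definition reg_act (u : H) : 'M[F]_n :=
  \matrix_(i, j) (u * ebas w (enum_val j)) (enum_val i).
Fact reg_linear : linear reg_act.
Proof. by move=> a u v; apply/matrixP => i j; rewrite !mxE mulrDl -scalerAl !ffunE. Qed.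
HB.instance Definition _ := GRing.isLinear.Build F H 'M[F]_n *:%R reg_act reg_linear.
Fact reg1 : reg_act 1 = 1%:M.
Proof.
by apply/matrixP => i j; rewrite !mxE mul1r ebasE (inj_eq enum_val_inj).
Qed.
Fact regM u v : reg_act (u * v) = reg_act u *m reg_act v.
Proof.
apply/matrixP => i j; rewrite !mxE -mulrA {1}[v * _]dblE mulr_sumr sum_ffunE.
rewrite (reindex_onto (@enum_val _ _) enum_rank) => [|p _]; last by rewrite enum_rankK.
rewrite (eq_bigl predT) => [|k]; last by rewrite /= enum_valK eqxx.
by apply: eq_bigr => k _; rewrite !mxE -scalerAr ffunE [_ *: _]mulrC.
Qed.
Definition regular_rep : rep (Dw w) := @MkRep F (Dw w) n reg_act reg1 regM.

(** Multiplication by [e_g x] maps a basis vector [e_h y] to 0 or to a multiple of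
    [e_g (x * y)], so its diagonal vanishes unless [x = 1]. *)
Lemma trace_reg u : \tr (reg_act u) = #|gT|%:R * \sum_g u (g, 1%g).
Proof.
rewrite /mxtrace (reindex_onto enum_rank (@enum_val _ _)) => [|k _]; last by rewrite enum_valK.
rewrite (eq_bigl predT) => [|k]; last by rewrite /= enum_rankK eqxx.
rewrite (eq_bigr (fun p : gT * gT => u (p.1, 1%g))) => [|[h t] _]; last first.
  rewrite !mxE enum_rankK mul_ebas_coef mulgV conjg1 eqxx /theta.
  have -> : w (h, 1%g, t) * w (1%g, t, (h ^ (1 * t))%g) / w (1%g, (h ^ 1)%g, t) = theta w h 1%g t by [].
  by rewrite theta_1l mulr1.
rewrite -(pair_bigA _ (fun g x : gT => u (g, 1%g))) /= mulr_sumr.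
apply: eq_bigr => g _; rewrite sumr_const [RHS]mulr_natl.
by congr (_ *+ _); apply: eq_card.
Qed.

(** The trace form of the regular representation is nondegenerate: pairing [u]
    with [e_(g^x) x^-1] gives the coefficient of [e_g x] in [u], up to a nonzero
    factor. By [trace_zero] all these traces vanish. *)
Theorem dbl_semisimple u : (forall Y : rep (Dw w), simple_rep Y -> Y u = 0) -> u = 0.
Proof.
move=> u0; apply/ffunP => -[g x]; rewrite [RHS]ffunE.
have uv0 (Y : rep (Dw w)) : simple_rep Y -> Y (u * e (g ^ x)%g x^-1%g) = 0.
  by move=> /u0 uY; rewrite (ractM Y u) uY mul0mx.
have /eqP : \tr (reg_act (u * e (g ^ x)%g x^-1%g)) = 0 := trace_zero uv0 regular_rep.
rewrite trace_reg; have G0 : (#|gT| == 0)%N = false by rewrite (cardD1 (1%g : gT)).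
rewrite mulf_eq0 pnatr_eq0 G0 /= (bigD1 g) //= big1 => [|h hg].
  rewrite addr0 mul_ebas_coef mul1g invgK eqxx mulf_eq0 (negbTE (theta_neq0 _ _ _ _)) orbF.
  by move/eqP.
rewrite mul_ebas_coef mul1g invgK; case: eqP => // /conjg_inj E.
by rewrite E eqxx in hg.
Qed.
End Double.

Lemma tens_sumr (F : fieldType) (I : finType) m n (B : 'M[F]_m) (C : I -> 'M[F]_n) :
  B *t (\sum_k C k) = \sum_k (B *t C k).
Proof.
apply/matrixP => i j; rewrite summxE !mxE summxE mulr_sumr.
by apply: eq_bigr => k _; rewrite mxE.
Qed.

Lemma scalar_mx0 (F : fieldType) n : 0%:M = 0 :> 'M[F]_n. Proof. exact: raddf0. Qed.

(** * Modules of the quotient and double braiding *)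

Section Quotient.
Variables (gT : finGroupType) (F : numFieldType) (w : nZ3 gT F) (A : {group gT}).
Variables (P : admissible_pair w A) (z : gT).
Hypotheses (AE : A :=: [set 1%g; z]) (z1 : z != 1%g).
Local Notation H := (dbl w).
Local Notation e g x := (ebas w (g, x)).
Local Notation tau := (ap_tau P).
Local Notation nu := (ap_nu P).
Local Notation s := (s_elt P z).
Local Notation sig g := (tau z g * (nu z g)^-1).
Local Notation pi := (aq_pi (s_ideal2 P)).

Let Az : z \in A. Proof. by rewrite AE !inE eqxx orbT. Qed.
Let A1 : 1%g \in A. Proof. exact: group1. Qed.
Let zz : (z * z = 1)%g.
Proof.
have : (z * z)%g \in A by rewrite groupM.
rewrite AE !inE => /orP[/eqP//|/eqP E]; move: z1; rewrite -(inj_eq (mulgI z)) E mulg1 eqxx //.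
Qed.
Let zcent g : (z * g = g * z)%g.
Proof.
have := subsetP (ap_Zomega P) z Az; rewrite inE => /andP[/centerP[_ cz] _].
by apply: cz; rewrite inE.
Qed.
Let zJ g : (z ^ g = z)%g. Proof. by rewrite conjgE zcent mulKg. Qed.
Let gJz g : (g ^ z = g)%g. Proof. by rewrite conjgE -zcent mulKg. Qed.

Let tau0 g : tau z g != 0. Proof. exact: ap_tau_neq0. Qed.
Let nu0 g : nu z g != 0. Proof. by have [? _] := ap_nu_char P Az. Qed.
Let tauM g h : tau z g * tau z h = theta w z g h * tau z (g * h)%g.
Proof. by rewrite -(ap_dtau P Az) divfK. Qed.
Let nuM g h : nu z (g * h)%g = nu z g * nu z h.
Proof. by have [_ ?] := ap_nu_char P Az. Qed.
Let nu1 : nu z 1%g = 1.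
Proof. by apply: (mulfI (nu0 1%g)); rewrite -nuM !mulg1 mulr1. Qed.
Let tau_1 g : tau 1%g g = 1.
Proof.
have := ap_nuM P A1 A1 g; rewrite mulg1 !ap_nu1 theta_1l !mul1r invr1 mulfK => //.
exact: ap_tau_neq0.
Qed.

Lemma sig1 : sig 1%g = 1. Proof. by rewrite ap_tau1 // nu1 invr1 mulr1. Qed.

(** The admissibility equation at [a = b = z]. *)
Lemma sig_sq g : sig g ^+ 2 * theta w g z z = 1.
Proof.
have := ap_nuM P Az Az g; rewrite zz ap_nu1 tau_1 !divr1 => E.
have {}E : nu z g ^+ 2 = theta w g z z * tau z g ^+ 2 by rewrite !expr2 E mulrA.
by rewrite exprMn exprVn E; field; rewrite theta_neq0 tau0.
Qed.

Lemma sig_mul x y : theta w z x y * sig (x * y)%g = sig x * sig y.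
Proof. by rewrite mulrA -tauM nuM; field; rewrite !nu0. Qed.

(** Centrality of [s], coefficient by coefficient. *)
Lemma sig_conj h y : theta w h z y * sig h = sig (h ^ y)%g * theta w h y z.
Proof.
have nuJ : nu z (h ^ y)%g = nu z h.
  by apply: (mulfI (nu0 y)); rewrite -nuM -conjgC nuM mulrC.
rewrite nuJ [X in _ = X]mulrAC mulrA; congr (_ * _).
have E1 := tauM h y; have E2 := tauM y (h ^ y)%g.
rewrite -conjgC in E2.
have E : theta w z y (h ^ y)%g * (tau z h * tau z y) = theta w z h y * (tau z y * tau z (h ^ y)%g).
  by rewrite E1 E2; ring.
have {}E : theta w z y (h ^ y)%g * tau z h = theta w z h y * tau z (h ^ y)%g.
  by apply: (mulIf (tau0 y)); rewrite -[LHS]mulrA E; ring.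
have {}E : tau z (h ^ y)%g = theta w z y (h ^ y)%g * tau z h / theta w z h y.
  by rewrite E mulrC mulKf ?theta_neq0.
rewrite E /theta !conjgM !zJ !gJz.
by field; rewrite !Z3_neq0.
Qed.

Lemma ebas_s h g : e h g * s = (sig (h ^ g)%g * theta w h g z) *: e h (g * z)%g.
Proof.
rewrite /s_elt mulr_sumr (bigD1 (h ^ g)%g) //= big1 => [|k nk].
  by rewrite addr0 -scalerAr ebasM eqxx scalerA.
by rewrite -scalerAr ebasM eq_sym (negbTE nk) scaler0.
Qed.

Lemma s_ebas h g : s * e h g = (sig h * theta w h z g) *: e h (z * g)%g.
Proof.
rewrite /s_elt mulr_suml (bigD1 h) //= big1 => [|k nk].
  by rewrite addr0 -scalerAl ebasM gJz eqxx scalerA.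
by rewrite -scalerAl ebasM gJz (negbTE nk) scaler0.
Qed.

Lemma s_central u : s * u = u * s.
Proof.
rewrite [u]dblE mulr_sumr mulr_suml; apply: eq_bigr => -[h g] _.
by rewrite -scalerAr -scalerAl ebas_s s_ebas [sig h * _]mulrC sig_conj zcent.
Qed.

Lemma s_square : s * s = 1.
Proof.
rewrite {1}/s_elt mulr_suml dbl1E; apply: eq_bigr => g _.
by rewrite -scalerAl ebas_s gJz zz scalerA mulrA -expr2 sig_sq scale1r.
Qed.

Lemma s_elt1 : s_elt P 1%g = 1.
Proof.
rewrite /s_elt dbl1E; apply: eq_bigr => g _.
by rewrite tau_1 ap_nu1 invr1 mulr1 scale1r.
Qed.

Lemma pi_s : pi s = 1.
Proof.
apply/eqP; rewrite -[1]/(pi 1) aq_eq /= /s_ideal.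
rewrite -[s - 1]mul1r -[1 * _]mulr1 !memv_mul ?memvf //.
apply: memv_span; apply/mapP; exists z => //.
by rewrite mem_enum.
Qed.

(** A module of the double on which [s] acts as 1 is a module of the quotient. *)
Section Descend.
Variable Y : rep (Dw w).
Hypothesis Ys : Y s = 1%:M.
Fact rep_ideal0 u : u \in s_ideal P -> Y u = 0.
Proof.
have lk (U V : {vspace H}) :
  (U <= lker (linfun (Y : H -> 'M[F]_(rdim Y))))%VS ->
   (({:H} * U)%VS <= lker (linfun (Y : H -> 'M[F]_(rdim Y))))%VS /\
   ((U * {:H})%VS <= lker (linfun (Y : H -> 'M[F]_(rdim Y))))%VS.
  move=> sU; split; apply/prodvP => x y xU yU; rewrite memv_ker lfunE /= (ractM Y x y).
    by have := subvP sU _ yU; rewrite memv_ker lfunE /= => /eqP->; rewrite mulmx0.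
  by have := subvP sU _ xU; rewrite memv_ker lfunE /= => /eqP->; rewrite mul0mx.
suff K : (s_ideal P <= lker (linfun (Y : H -> 'M[F]_(rdim Y))))%VS.
  by move/(subvP K); rewrite memv_ker lfunE /= => /eqP.
apply: (lk _ fullv _).2; apply: (lk _ fullv _).1.
apply/span_subvP => v /mapP[a]; rewrite mem_enum AE !inE => /orP[]/eqP-> ->.
  by rewrite s_elt1 subrr mem0v.
by rewrite memv_ker lfunE /= linearB /= Ys (ract1 Y) subrr.
Qed.
Definition descend_act (q : DwA P) : 'M[F]_(rdim Y) := Y (aq_repr q).
Lemma descend_pi u : descend_act (pi u) = Y u.
Proof.
apply/eqP; rewrite -subr_eq0 -linearB; apply/eqP/rep_ideal0.
exact: (aq_reprP (s_ideal2 P) u).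
Qed.
Fact descend_linear : linear descend_act.
Proof.
move=> a p q; elim/(@aq_ind _ _ (s_ideal2 P)): p => u; elim/(@aq_ind _ _ (s_ideal2 P)): q => v.
have -> : a *: pi u + pi v = pi (a *: u + v) by rewrite aq_piD -aq_piZ.
by rewrite !descend_pi linearP.
Qed.
HB.instance Definition _ := GRing.isLinear.Build F (DwA P) 'M[F]_(rdim Y) *:%R descend_act descend_linear.
Fact descend1 : descend_act 1 = 1%:M.
Proof. by rewrite [1]/(pi 1) descend_pi (ract1 Y). Qed.
Fact descendM a b : descend_act (a * b) = descend_act a *m descend_act b.
Proof.
elim/(@aq_ind _ _ (s_ideal2 P)): a => u; elim/(@aq_ind _ _ (s_ideal2 P)): b => v.
have -> : pi u * pi v = pi (u * v) by rewrite -aq_piM.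
by rewrite !descend_pi (ractM Y u v).
Qed.
Definition descend : rep (DwA P) := MkRep descend1 descendM.
Lemma descend_simple : simple_rep Y -> simple_rep descend.
Proof.
move=> [Y0 sY]; split=> // U stU; apply: sY => h.
by have := stU (pi h); rewrite /= descend_pi.
Qed.
End Descend.

(** On a simple module of the double [s] acts as 1 or as [-1]. In the first case
    the module comes from the quotient, in the second [1 + s] acts as 0. *)
Lemma quotient_semisimple u :
  (forall Y : rep (DwA P), simple_rep Y -> Y (pi u) = 0) -> u * (1 + s) = 0.
Proof.
move=> u0; apply: dbl_semisimple => Y sY.
rewrite (ractM Y) linearD /= (ract1 Y).
have [||Ys|Ys] := @simple_scalar _ _ Y (Y s) 1 (-1) sY.
- by move=> h; rewrite -!(ractM Y) s_central.
- rewrite raddfN opprK mulmxBl !mulmxDr mul1mx !mulmx1 -(ractM Y) s_square (ract1 Y).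
  by rewrite [1%:M + _]addrC subrr.
- have := u0 _ (descend_simple Ys sY); rewrite /= (descend_pi Ys) => ->.
  by rewrite mul0mx.
by rewrite Ys raddfN /= subrr mulmx0.
Qed.

(** The R-matrix is the sum of the [e_g 1] tensored with [grp g]. *)
Definition grp (x : gT) : H := \sum_h e h x.

Lemma grp_ebas h g : grp h * e g 1%g = e (g ^ h^-1)%g h.
Proof.
rewrite /grp mulr_suml (bigD1 (g ^ h^-1)%g) //= big1 => [|k nk].
  by rewrite addr0 ebasM conjgKV eqxx theta_1r scale1r mulg1.
rewrite ebasM; case: eqP => // E; rewrite -E conjgK eqxx in nk => //.
Qed.
Lemma ebas_grp h g : e h 1%g * grp g = e h g.
Proof.
rewrite /grp mulr_sumr (bigD1 h) //= big1 => [|k nk].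
  by rewrite addr0 ebasM conjg1 eqxx theta_1l scale1r mul1g.
by rewrite ebasM conjg1 eq_sym (negbTE nk).
Qed.

Lemma pi_sum I (r : seq I) (Q : pred I) (f : I -> H) :
  pi (\sum_(i <- r | Q i) f i) = \sum_(i <- r | Q i) pi (f i).
Proof.
apply: (big_morph _ (@aq_piD _ _ (s_ideal2 P))).
by rewrite -(subrr (0 : H)) aq_piB subrr.
Qed.

Lemma act_piM (X : rep (DwA P)) u v : X (pi u) *m X (pi v) = X (pi (u * v)).
Proof. by rewrite -(ractM X) -[pi u * pi v]/(aq_mul _ _) aq_piM. Qed.

Lemma universal_R (V W : rep (DwA P)) : tens2_act V W (qh_R (DwA P)) =
  \sum_g (V (pi (e g 1%g)) *t W (pi (grp g))).
Proof.
rewrite /tens2_act /= /dbl_R big_map big_image /=.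
rewrite -(pair_bigA _ (fun g h => V (pi (e g 1%g)) *t W (pi (e h g)))) /=.
by apply: eq_bigr => g _; rewrite /grp pi_sum linear_sum tens_sumr.
Qed.

Lemma double_braiding (X Y : rep (DwA P)) : braiding Y X *m braiding X Y =
  \sum_h \sum_g (X (pi (e (g ^ h^-1)%g h)) *t Y (pi (e h g))).
Proof.
rewrite /braiding !universal_R mulmx_sumr.
rewrite (eq_bigr (fun h => (X (pi (grp h)) *t Y (pi (e h 1%g))) *m flip_mx F (rdim Y) (rdim X)));
  last by move=> h _; rewrite flip_tens.
rewrite -mulmx_suml mulmxA -[_ *m _ *m flip_mx _ _ _]mulmxA flipK mulmx1 mulmx_suml.
apply: eq_bigr => h _; rewrite mulmx_sumr; apply: eq_bigr => g _.
by rewrite tensmx_mul !act_piM grp_ebas ebas_grp.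
Qed.

Lemma coef_sum (I : finType) (f : I -> H) p : (\sum_i f i) p = \sum_i f i p.
Proof. by apply: (big_morph (fun u : H => u p)) => [u v|]; rewrite ffunE. Qed.

Lemma counit_iso (X : rep (DwA P)) : simple_rep X ->
  (forall u, X (pi u) = (dbl_eps u)%:M) -> iso_rep X (unit_rep (DwA P)).
Proof.
move=> [X0 sX] Xeps; have n1 : rdim X = 1%N.
  have [|d0|] := sX (delta_mx (Ordinal X0) (Ordinal X0)).
  - by move=> q; rewrite -[q](aq_reprK (J := s_ideal2 P)) Xeps tr_scalar_mx mul_mx_scalar scalemx_sub.
  - have /matrixP/(_ (Ordinal X0) (Ordinal X0)) := d0.
    by rewrite !mxE !eqxx => /eqP; rewrite oner_eq0.
  by rewrite /row_full mxrank_delta => /eqP.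
exists (const_mx 1), (const_mx 1); split.
- apply/matrixP => i j; rewrite !mxE (eq_bigr (fun=> 1)) => [|k _]; last by rewrite !mxE mulr1.
  by rewrite sumr_const card_ord n1 !ord1 eqxx.
- apply/matrixP => i j; rewrite !mxE big_ord1 !mxE mulr1.
  by rewrite (_ : i = j) ?eqxx //; apply/val_inj; move: i j; rewrite n1 => i j; rewrite !ord1.
move=> q; rewrite -[q](aq_reprK (J := s_ideal2 P)) Xeps /= /unit_act /=.
by rewrite (dblq_eps_pi P) mul_scalar_mx mul_mx_scalar.
Qed.

Lemma iso_counit (X : rep (DwA P)) (u : H) : iso_rep X (unit_rep (DwA P)) -> X (pi u) = (dbl_eps u)%:M.
Proof.
move=> [f [g [_ gf E]]]; have := E (pi u) => /(congr1 (mulmx g)).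
rewrite mulmxA gf mul1mx => ->; rewrite /= /unit_act /= (dblq_eps_pi P).
by rewrite mul_scalar_mx -scalemxAr gf scale_scalar_mx mulr1.
Qed.

Lemma counit_transparent (X : rep (DwA P)) : (forall u, X (pi u) = (dbl_eps u)%:M) -> transparent X.
Proof.
move=> Xeps Y _; rewrite double_braiding.
rewrite (eq_bigr (fun h => 1%:M *t Y (pi (e h 1%g)))) => [|h _].
  rewrite -tens_sumr -(linear_sum Y) /= -pi_sum -dbl1E (ract1 Y).
  apply/matrixP => i j; rewrite !mxE -(inj_eq (can_inj (@mxtens_unindexK _ _)) i j) -natrM mulnb.
  by case: (mxtens_unindex i) (mxtens_unindex j) => [a b] [c d]; rewrite xpair_eqE.
rewrite (bigD1 1%g) //= big1 ?addr0 => [|g g1].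
  by rewrite Xeps dbl_eps_ebas /= conj1g eqxx.
rewrite Xeps dbl_eps_ebas /= (_ : (g ^ h^-1 == 1)%g = false) ?scalar_mx0 ?raddf0.
  by apply/matrixP => i j; rewrite !mxE ?mul0rn mul0r.
by apply/negbTE; rewrite conjg_eq1.
Qed.

Section Transparent.
Variable X : rep (DwA P).
Hypotheses (sX : simple_rep X) (tX : transparent X).

(** Fix a matrix entry. Transparency of [X] says that a certain element [q] acts as
    0 on all simple modules of the quotient: its coefficient at [e_h t] is the
    entry of [e_(t ^ h^-1) h] acting on [X], minus that of the identity if
    [t = 1]. Hence [q * (1 + s) = 0], and this is the coefficient at [e_h t]. *)
Lemma transparent_coef h t :
  X (pi (e (t ^ h^-1)%g h)) + (sig (h ^ (t * z))%g * theta w h (t * z) z) *: X (pi (e ((t * z) ^ h^-1)%g h))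
  = (t == 1%g)%:R%:M + (sig (h ^ (t * z))%g * theta w h (t * z) z * (t == z)%:R)%:M.
Proof.
apply/matrixP => i j.
pose q : H := [ffun p : gT * gT => (X (pi (e (p.2 ^ p.1^-1)%g p.1)) i j - (i == j)%:R * (p.2 == 1%g)%:R) : F^o].
have : q * (1 + s) = 0.
  apply: quotient_semisimple => Y sY; apply/matrixP => k l.
  have := tX sY; rewrite double_braiding.
  move/matrixP/(_ (mxtens_index (i, k)) (mxtens_index (j, l))).
  rewrite summxE => E.
  have -> : Y (pi q) k l = \sum_h \sum_g q (h, g) * Y (pi (e h g)) k l.
    rewrite {1}[q]dblE pi_sum linear_sum summxE pair_bigA /=.
    by apply: eq_bigr => -[h' g] _; rewrite -aq_piZ linearZ mxE.
  rewrite (eq_bigr (fun h => \sum_g X (pi (e (g ^ h^-1)%g h)) i j * Y (pi (e h g)) k l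
     - (i == j)%:R * Y (pi (e h 1%g)) k l)) => [|h' _]; last first.
    rewrite [X in _ - X](_ : _ = \sum_g (i == j)%:R * (g == 1%g)%:R * Y (pi (e h' g)) k l); last first.
      rewrite (bigD1 1%g) //= eqxx mulr1 big1 ?addr0 // => g /negbTE->.
      by rewrite mulr0 mul0r.
    by rewrite -sumrB; apply: eq_bigr => g _; rewrite ffunE /= mulrBl.
  rewrite sumrB -mulr_sumr.
  have -> : \sum_h Y (pi (e h 1%g)) k l = (k == l)%:R.
    by rewrite -summxE -(linear_sum Y) /= -pi_sum -dbl1E (ract1 Y) mxE.
  rewrite [RHS]mxE; apply/eqP; rewrite subr_eq0; apply/eqP.
  rewrite -[RHS]natrM mulnb.
  transitivity ((1%:M : 'M[F]_(rdim X * rdim Y)) (mxtens_index (i, k)) (mxtens_index (j, l))).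
    rewrite -E; apply: eq_bigr => h' _; rewrite summxE; apply: eq_bigr => g _.
    by rewrite tensmxE.
  by rewrite mxE (inj_eq (can_inj (@mxtens_indexK _ _))) xpair_eqE.
have zV : (z^-1 = z)%g by apply: (mulgI z); rewrite mulgV zz.
move/ffunP/(_ (h, t)); rewrite mulrDr mulr1.
have -> : (q + q * s) (h, t) = q (h, t) + (q * s) (h, t) by rewrite ffunE.
have -> : (q * s) (h, t) = sig (h ^ (t * z))%g * (q (h, (t * z)%g) * theta w h (t * z) z).
  rewrite /s_elt mulr_sumr coef_sum (bigD1 (h ^ (t * z))%g) //= big1 => [|k nk].
    by rewrite addr0 -scalerAr ffunE mul_ebas_coef zV eqxx.
  by rewrite -scalerAr ffunE mul_ebas_coef zV eq_sym (negbTE nk) [LHS]mulr0.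
have tz1 : (t * z == 1)%g = (t == z).
  by rewrite -(inj_eq (mulIg z) t z) zz.
rewrite !ffunE /= tz1 !mxE.
set a := X _ _ _; set b := X _ _ _; set c := sig _; set d := theta _ _ _ _.
case: (i == j); rewrite ?mulr1n ?mulr0n ?mul1r ?mul0r => E.
  transitivity (a - (t == 1%g)%:R + c * ((b - (t == z)%:R) * d) +
    ((t == 1%g)%:R + c * d * (t == z)%:R)); first by ring.
  by rewrite [X in X + _]E add0r.
transitivity (a - 0 + c * ((b - 0) * d)); first by ring.
by rewrite E addr0.
Qed.

Lemma theta_zzz : theta w z z z = w (z, z, z).
Proof. by rewrite /theta !zJ mulfK ?Z3_neq0. Qed.

Let E t := X (pi (e t 1%g)).
Let E_sq t : E t *m E t = E t.
Proof. by rewrite /E act_piM ebasM conjg1 eqxx theta_1l scale1r mul1g. Qed.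
Let E_ortho t t' : t != t' -> E t *m E t' = 0.
Proof.
move=> /negbTE tt'; rewrite /E act_piM ebasM conjg1 tt'.
by rewrite -(subrr (0 : H)) aq_piB subrr linear0.
Qed.
Let E_grp t h : X (pi (e t h)) = E t *m X (pi (grp h)).
Proof. by rewrite /E act_piM ebas_grp. Qed.

Let E_pair t : E t + E (t * z)%g = (t == 1%g)%:R%:M + (t == z)%:R%:M.
Proof.
have := transparent_coef 1%g t.
by rewrite !conj1g sig1 theta1g mul1r scale1r !invg1 !conjg1 mul1r.
Qed.

(** [E t] and [E (t * z)] are orthogonal idempotents with sum 0. *)
Lemma transparent_support t : t != 1%g -> t != z -> E t = 0.
Proof.
move=> /negbTE t1 /negbTE tz; have := E_pair t; rewrite t1 tz !scalar_mx0 addr0.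
move/eqP; rewrite addr_eq0 => /eqP Et.
rewrite -E_sq {2}Et mulmxN E_ortho ?oppr0 //.
by rewrite -{1}[t]mulg1 (inj_eq (mulgI t)) eq_sym.
Qed.

(** By Schur's lemma [e_1] acts as 0 or as 1. If it acts as 0 then [e_z] acts as 1,
    and comparing [transparent_coef] at [h = z] with the action of [s] as 1 gives
    [w (z, z, z) = 1]. Otherwise [transparent_coef] at [t = 1] makes all of [G] act
    trivially. *)
Lemma transparent_unit : w (z, z, z) != 1 -> iso_rep X (unit_rep (DwA P)).
Proof.
move=> wzzz; have E1z : E 1%g + E z = 1%:M.
  by have := E_pair 1%g; rewrite mul1g eqxx eq_sym (negbTE z1) scalar_mx0 addr0.
have [||E1|E1] := @simple_scalar _ _ X (E 1%g) 0 1 sX.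
- move=> q; rewrite -[q](aq_reprK (J := s_ideal2 P)) /E !act_piM; congr (X (pi _)).
  rewrite [aq_repr q]dblE mulr_sumr mulr_suml; apply: eq_bigr => -[h g] _.
  rewrite -scalerAr -scalerAl !ebasM conjg1 conjg_eq1 eq_sym theta_1l theta_1r mul1g mulg1.
  by case: eqP => // ->.
- by rewrite scalar_mx0 subr0 mulmxBr mulmx1 E_sq subrr.
- have Ez : E z = 1%:M by rewrite -E1z E1 scalar_mx0 add0r.
  have zc := transparent_coef z 1%g.
  rewrite !conj1g !mul1g eqxx eq_sym (negbTE z1) !zJ mulr0 scalar_mx0 addr0 theta_zzz E_grp E1 in zc.
  rewrite scalar_mx0 mul0mx add0r in zc.
  have : X (pi s) = sig z *: X (pi (e z z)).
    rewrite /s_elt pi_sum linear_sum (bigD1 z) //= big1 ?addr0 => [|k kz].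
      by rewrite -aq_piZ linearZ.
    rewrite -aq_piZ linearZ /= E_grp; have [->|k1] := eqVneq k 1%g.
      by rewrite E1 scalar_mx0 mul0mx scaler0.
    by rewrite transparent_support // mul0mx scaler0.
  rewrite pi_s (ract1 X) => sz; move: zc; rewrite mulrC -scalerA -sz.
  have [X0 _] := sX => /matrixP/(_ (Ordinal X0) (Ordinal X0)).
  by rewrite !mxE eqxx mulr1 => /eqP; rewrite (negbTE wzzz).
have Ez : E z = 0 by apply: (@addrI _ (E 1%g)); rewrite E1z addr0 E1.
apply: counit_iso => // u.
have grp1 h : X (pi (e 1%g h)) = 1%:M.
  have := transparent_coef h 1%g; rewrite !conj1g !mul1g eqxx eq_sym (negbTE z1).
  by rewrite mulr0 scalar_mx0 addr0 zJ [X (pi (e z h))]E_grp Ez mul0mx scaler0 addr0.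
rewrite {1}[u]dblE pi_sum linear_sum /dbl_eps raddf_sum /=.
rewrite (eq_bigr (fun p => (fun h g => X (pi (u (h, g) *: e h g))) p.1 p.2)) => [|[h g] _ //].
rewrite -(pair_bigA _ (fun h g => X (pi (u (h, g) *: e h g)))) /= (bigD1 1%g) //= [X in _ + X]big1 ?addr0.
  by apply: eq_bigr => g _; rewrite -aq_piZ linearZ /= grp1 scale_scalar_mx mulr1.
move=> h h1; rewrite big1 // => g _; rewrite -aq_piZ linearZ /= E_grp.
have [->|hz] := eqVneq h z; first by rewrite Ez mul0mx scaler0.
by rewrite transparent_support // mul0mx scaler0.
Qed.
End Transparent.

(** The line supported at [z], on which [x] acts by [sig x]. *)
Definition line_act (u : H) : 'M[F]_1 := (\sum_x u (z, x) * sig x)%:M.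
Fact line_linear : linear line_act.
Proof.
move=> a u v; rewrite /line_act scale_scalar_mx -raddfD; congr (_%:M).
rewrite mulr_sumr -big_split; apply: eq_bigr => x _ /=.
by rewrite !ffunE [LHS]mulrDl; congr (_ + _); exact/esym/mulrA.
Qed.
HB.instance Definition _ := GRing.isLinear.Build F H 'M[F]_1 *:%R line_act line_linear.
Lemma line_ebas h g : line_act (e h g) = ((h == z)%:R * sig g)%:M.
Proof.
rewrite /line_act (bigD1 g) //= big1 ?addr0 => [|x xg].
  by rewrite ebasE xpair_eqE eqxx andbT eq_sym.
by rewrite ebasE xpair_eqE (negbTE xg) andbF mul0r.
Qed.
Fact line1 : line_act 1 = 1%:M.
Proof.
rewrite dbl1E linear_sum (bigD1 z) //= big1 ?addr0 => [|h hz].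
  by rewrite line_ebas eqxx mul1r sig1.
by rewrite line_ebas (negbTE hz) mul0r scalar_mx0.
Qed.
Fact lineM u v : line_act (u * v) = line_act u *m line_act v.
Proof.
rewrite {1}[u]dblE mulr_suml linear_sum [u in RHS]dblE linear_sum mulmx_suml.
apply: eq_bigr => -[h g] _; rewrite {1}[v]dblE mulr_sumr linear_sum [v in RHS]dblE linear_sum mulmx_sumr.
apply: eq_bigr => -[k y] _.
rewrite -scalerAr -scalerAl !linearZ /= -scalemxAl; congr (_ *: (_ *: _)).
rewrite ebasM !line_ebas -scalar_mxM; have [->|hz] := eqVneq h z; last first.
  by rewrite !mul0r; case: eqP => _; rewrite ?linear0 ?scalar_mx0 // linearZ /= line_ebas (negbTE hz) mul0r scalar_mx0 scaler0.
rewrite zJ eq_sym; have [_|kz] := eqVneq k z; last by rewrite mul0r mulr0 linear0 scalar_mx0.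
by rewrite linearZ /= line_ebas eqxx !mul1r scale_scalar_mx sig_mul.
Qed.
Definition line_rep : rep (Dw w) := @MkRep F (Dw w) 1 line_act line1 lineM.

Lemma line_s : w (z, z, z) = 1 -> line_rep s = 1%:M.
Proof.
move=> wzzz; rewrite /= /s_elt linear_sum (bigD1 z) //= big1 ?addr0 => [|h hz].
  rewrite linearZ /= line_ebas eqxx mul1r scale_scalar_mx -expr2.
  by have := sig_sq z; rewrite theta_zzz wzzz mulr1 => ->.
by rewrite linearZ /= line_ebas (negbTE hz) mul0r scalar_mx0 scaler0.
Qed.

Lemma line_simple : simple_rep line_rep.
Proof.
split=> // U _; have [->|U0] := eqVneq U 0; [by left | right].
by rewrite /row_full eqn_leq rank_leq_col lt0n mxrank_eq0.
Qed.

(** If [w (z, z, z) = 1], the line descends to the quotient and its double braiding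
    with [Y] is the action of [s] on [Y], which is the identity. *)
Theorem modular_iff : modular (DwA P) <-> w (z, z, z) <> 1.
Proof.
split=> [mod wzzz|/eqP wzzz X sX].
  pose L := descend (line_s wzzz).
  have LE h g : L (pi (e h g)) = ((h == z)%:R * sig g)%:M.
    by rewrite -line_ebas; exact: (descend_pi (line_s wzzz)).
  have sL : simple_rep L by apply/descend_simple/line_simple.
  have tL : transparent L.
    move=> Y sY; rewrite double_braiding.
    rewrite (eq_bigr (fun h => (1%:M : 'M[F]_1) *t (sig h *: Y (pi (e h z))))) => [|h _].
      rewrite -tens_sumr.
      have -> : \sum_h sig h *: Y (pi (e h z)) = Y (pi s).
        by rewrite /s_elt pi_sum linear_sum; apply: eq_bigr => h _; rewrite -aq_piZ linearZ.
      rewrite pi_s (ract1 Y).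
      apply/matrixP => i j; rewrite !mxE -(inj_eq (can_inj (@mxtens_unindexK _ _)) i j) -natrM mulnb.
      by case: (mxtens_unindex i) (mxtens_unindex j) => [a b] [c d]; rewrite xpair_eqE.
    rewrite (bigD1 z) //= big1 ?addr0 => [|g gz].
      rewrite zJ LE eqxx mul1r.
      by apply/matrixP => i j; rewrite !mxE; ring.
    rewrite LE (_ : (g ^ h^-1 == z)%g = false) ?mul0r.
      by apply/matrixP => i j; rewrite !mxE ?mul0rn mul0r.
    by apply: contraNF gz => /eqP E; rewrite -(conjgKV h g) E zJ.
  have /iso_counit := (mod L sL).1 tL => /(_ (e 1%g 1%g)).
  rewrite LE dbl_eps_ebas eqxx eq_sym (negbTE z1) mul0r.
  move/matrixP/(_ 0 0); rewrite !mxE eqxx => /esym/eqP.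
  by rewrite oner_eq0.
split=> [tX|iX]; first exact: transparent_unit.
by apply: counit_transparent => u; apply: iso_counit.
Qed.
End Quotient.

From mathcomp Require Import complex.
From mathcomp Require Import finmap boolp classical_sets cardinality reals.

(** * The multiplicative group of a field as coefficients *)

Section UnitGroup.
Variable F : fieldType.
Record unitgrp := UnitGrp { uval : F; _ : uval != 0 }.
HB.instance Definition _ := [isSub for uval].
HB.instance Definition _ := [Choice of unitgrp by <:].
Implicit Types a b c : unitgrp.
Lemma uval_neq0 a : uval a != 0. Proof. by case: a. Qed.
Definition ug_mul a b := UnitGrp (mulf_neq0 (uval_neq0 a) (uval_neq0 b)).
Lemma ug_inv_subproof a : (uval a)^-1 != 0. Proof. by rewrite invr_eq0 uval_neq0. Qed.
Definition ug_inv a := UnitGrp (ug_inv_subproof a).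
Definition ug_one := UnitGrp (oner_neq0 F).
Fact ug_mulA : associative ug_mul.
Proof. by move=> a b c; apply: val_inj; rewrite /= mulrA. Qed.
Fact ug_mulC : commutative ug_mul.
Proof. by move=> a b; apply: val_inj; rewrite /= mulrC. Qed.
Fact ug_mul1 : left_id ug_one ug_mul.
Proof. by move=> a; apply: val_inj; rewrite /= mul1r. Qed.
Fact ug_mulV : left_inverse ug_one ug_inv ug_mul.
Proof. by move=> a; apply: val_inj; rewrite /= mulVf ?uval_neq0. Qed.
HB.instance Definition _ := GRing.isZmodule.Build unitgrp ug_mulA ug_mulC ug_mul1 ug_mulV.

Lemma uval_inj : injective uval. Proof. exact: val_inj. Qed.
Lemma uvalD a b : uval (a + b) = uval a * uval b. Proof. by []. Qed.
Lemma uvalN a : uval (- a) = (uval a)^-1. Proof. by []. Qed.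
Lemma uval0 : uval 0 = 1. Proof. by []. Qed.
Lemma uvalMn a n : uval (a *+ n) = uval a ^+ n.
Proof. by elim: n => // n IH; rewrite mulrS exprS uvalD IH. Qed.
End UnitGroup.

Section ClosedUnits.
Variable F : numClosedFieldType.
Local Notation M := (unitgrp F).

Lemma unitgrp_div (n : nat) (m : M) : (0 < n)%N -> exists m', m' *+ n = m.
Proof.
move=> n0; have r0 : n.-root (uval m) != 0 by rewrite rootC_eq0 ?uval_neq0.
by exists (UnitGrp r0); apply: uval_inj; rewrite uvalMn /= rootCK.
Qed.

Lemma m1_neq0 : (-1 : F) != 0. Proof. by rewrite oppr_eq0 oner_neq0. Qed.
Definition uhalf : M := UnitGrp m1_neq0.
Lemma uhalf_neq0 : uhalf != 0.
Proof. by rewrite -(inj_eq (@uval_inj F)) /= lt_eqF // (lt_trans (ltrN10 _)) ?ltr01. Qed.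

Lemma unitgrp_tor2 (m : M) : m *+ 2 = 0 -> m = 0 \/ m = uhalf.
Proof.
move/(congr1 (@uval F)); rewrite uvalMn uval0 => /eqP; rewrite sqrf_eq1 => /orP[]/eqP E; [left|right];
  exact: uval_inj.
Qed.

Lemma sqrtC_neq0 (m : M) : sqrtC (uval m) != 0.
Proof. by rewrite sqrtC_eq0 uval_neq0. Qed.
Fixpoint uzeta_succ n : M := if n is n'.+1 then UnitGrp (sqrtC_neq0 (uzeta_succ n')) else uhalf.
Definition uzeta n : M := if n is n'.+1 then uzeta_succ n' else 0.
Lemma uzetaS n : uzeta n.+1 *+ 2 = uzeta n.
Proof.
by case: n => [|n]; apply: uval_inj; rewrite uvalMn /= ?sqrrN ?expr1n ?sqrtCK.
Qed.
End ClosedUnits.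

(** * Classes of degree three *)

Section Bridge.
Variables (gT : finGroupType) (F : fieldType).
Local Notation M := (unitgrp F).
Local Notation K := [set: gT]%G.

Implicit Types v w : Z3 gT F.

Definition cochain w x y t : M := UnitGrp (Z3_neq0 w (x, y, t)).

Lemma cochain_cocycle w : cocycle3_on K (cochain w).
Proof. by move=> x y t s _ _ _ _; apply: uval_inj; rewrite !uvalD /= Z3E. Qed.

Lemma cochainD v w x y t : cochain (v + w) x y t = cochain v x y t + cochain w x y t.
Proof. by apply: uval_inj; rewrite uvalD /= !ffunE. Qed.

Lemma cochain0 x y t : cochain 0 x y t = 0.
Proof. by apply: uval_inj; rewrite /= !ffunE. Qed.

Lemma of_cochain_subproof (c : gT -> gT -> gT -> M) : cocycle3_on K c ->
  cocycle3 [ffun p : gT * gT * gT => uval (c p.1.1 p.1.2 p.2)].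
Proof.
move=> cz; apply/andP; split; first by apply/forallP => p; rewrite ffunE uval_neq0.
do 4!apply/forallP => ?; rewrite !ffunE /= -!uvalD cz ?inE //.
Qed.
Definition of_cochain c (cz : cocycle3_on K c) : Z3 gT F := MkZ3 (of_cochain_subproof cz).
Lemma of_cochainK c (cz : cocycle3_on K c) x y t : cochain (of_cochain cz) x y t = c x y t.
Proof. by apply: uval_inj; rewrite /= ffunE. Qed.

Lemma cobound_B3 w : cobound3_on K (cochain w) <-> w \in @B3 gT F.
Proof.
split=> [[f fE]|/asboolP[f [f0 fE]]].
  apply/asboolP; exists (fun x y => uval (f x y)); split=> [x y|x y t]; first exact: uval_neq0.
  by have /(congr1 (@uval F)) := fE x y t (finset.in_setT _) (finset.in_setT _) (finset.in_setT _).
exists (fun x y => UnitGrp (f0 x y)) => x y t _ _ _; apply: uval_inj.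
by rewrite /= fE.
Qed.

Lemma class3_eq v w : class3 v = class3 w <-> cohomologous3 K (cochain v) (cochain w).
Proof.
have E : (class3 v == class3 w) = (v - w \in @B3 gT F) by rewrite Quotient.idealrBE.
split=> [/eqP|C].
  rewrite E => /cobound_B3[f fE]; exists f => x y t Kx Ky Kt; rewrite -fE //.
  by apply: uval_inj; rewrite /= !ffunE.
apply/eqP; rewrite E; apply/cobound_B3; have [f fE] := C; exists f => x y t Kx Ky Kt.
by rewrite -fE //; apply: uval_inj; rewrite /= !ffunE.
Qed.

Lemma class3D v w : class3 (v + w) = class3 v + class3 w.
Proof. by rewrite /class3 raddfD. Qed.
Lemma class3Mn w n : class3 (w *+ n) = class3 w *+ n.
Proof. by rewrite /class3 raddfMn. Qed.
Lemma class3_surj (u : H3 gT F) : exists w, u = class3 w.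
Proof. by exists (generic_quotient.repr (u : Quotient.quot _)); rewrite /class3 reprK. Qed.
Lemma cochainMn w n x y t : cochain (w *+ n) x y t = cochain w x y t *+ n.
Proof.
elim: n => [|n IH]; first by rewrite !mulr0n cochain0.
by rewrite !mulrS cochainD IH.
Qed.
End Bridge.

(** * Classes that contain a 2-generator *)

Section Classes.
Variables (F : numClosedFieldType) (gT : finGroupType) (z : gT).
Local Notation M := (unitgrp F).
Local Notation K := [set: gT]%G.
Local Notation half := (uhalf F).
Local Notation H := (H3 gT F).
Hypotheses (oz : #[z]%g = 2%N) (zuniq : forall u, #[u]%g = 2%N -> u = z).
Let Kz : z \in K. Proof. by rewrite inE. Qed.
Let zu u : u \in K -> #[u]%g = 2%N -> u = z. Proof. by move=> _; exact: zuniq. Qed.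

Definition class_sign (u : H) : M :=
  involution_sign z (cochain (generic_quotient.repr (u : Quotient.quot _))).

Lemma class_signE (w : Z3 gT F) : class_sign (class3 w) = involution_sign z (cochain w).
Proof.
apply: (involution_sign_cohom Kz oz); apply/class3_eq.
by rewrite /class3 reprK.
Qed.

Lemma class_signD u v : class_sign (u + v) = class_sign u + class_sign v.
Proof.
have [w ->] := class3_surj u; have [w' ->] := class3_surj v.
by rewrite -class3D !class_signE /involution_sign !cochainD; zmod.
Qed.

Lemma class_signMn u n : class_sign (u *+ n) = class_sign u *+ n.
Proof.
have [w ->] := class3_surj u.
by rewrite -class3Mn !class_signE /involution_sign !cochainMn -!mulrnBl.
Qed.

Lemma class_sign_cases u : class_sign u = 0 \/ class_sign u = half.
Proof.
have [w ->] := class3_surj u; apply: unitgrp_tor2; rewrite class_signE.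
exact: (involution_sign_tor2 Kz oz (cochain_cocycle w)).
Qed.

Lemma class_signN u : class_sign (- u) = class_sign u.
Proof.
have E : class_sign (- u) + class_sign u = 0.
  rewrite -class_signD addNr -(mulr0n 0) class_signMn //.
have E2 : class_sign u *+ 2 = 0.
  by case: (class_sign_cases u) => ->; rewrite ?mul0rn // (half2 (zeta := uzeta F)) // => n; exact: uzetaS.
rewrite mulr2n in E2; zlin (zadd E (zopp E2)).
Qed.

Let uz0 : uzeta F 0 = 0. Proof. by []. Qed.
Let uz1 : uzeta F 1 = half. Proof. by []. Qed.

Lemma exists_class_sign : exists c, class_sign c = half.
Proof.
have [w wz ws] := exists_sign (@unitgrp_div F) (uhalf_neq0 F) (@unitgrp_tor2 F) uz0 uz1
   (@uzetaS F) Kz oz zu.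
exists (class3 (of_cochain wz)); rewrite class_signE -ws /involution_sign.
by rewrite !of_cochainK.
Qed.

Lemma class_sign0 u : class_sign u = 0 -> exists v, u = v *+ 2.
Proof.
have [w ->] := class3_surj u; rewrite class_signE => w0.
have [v vz vE] := sign0_divide (@unitgrp_div F) (uhalf_neq0 F) (@unitgrp_tor2 F) uz0 uz1
   (@uzetaS F) Kz oz zu (cochain_cocycle w) w0.
exists (class3 (of_cochain vz)); rewrite -class3Mn; apply/class3_eq.
have [f fE] := vE; exists f => x y t Kx Ky Kt; rewrite -fE //.
by rewrite cochainMn of_cochainK.
Qed.

Lemma class_exponent (u : H) : u *+ #|K| = 0.
Proof.
have [w ->] := class3_surj u.
have -> : (0 : H) = class3 (0 : Z3 gT F) by rewrite /class3 raddf0.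
rewrite -class3Mn; apply/class3_eq.
have [f fE] := cobound3_exponent (cochain_cocycle w); exists f => x y t Kx Ky Kt.
by rewrite -fE // cochainMn cochain0 subr0.
Qed.

Let half_odd n : odd n -> half *+ n = half.
Proof.
have h2 : half *+ 2 = 0 by rewrite (half2 uz0 uz1 (@uzetaS F)).
by move=> od; rewrite -(odd_double_half n) od -muln2 mulnC mulrnDr mulrnA h2 mul0rn addr0.
Qed.

Let class_signZ u (n : int) : class_sign u = 0 -> class_sign (u *~ n) = 0.
Proof.
by move=> u0; case: n => n; rewrite ?NegzE ?mulrNz ?class_signN -pmulrn class_signMn u0 mul0rn.
Qed.

(** Classes of trivial sign are doubles, so [t] or [t - u] is a double; iterate. *)
Lemma generates_mod_pow2 u v k : class_sign u = half ->
  exists (j : int) (t : H), v = u *~ j + t *+ 2 ^ k.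
Proof.
move=> us; elim: k => [|k [j [t ->]]]; first by exists 0, v; rewrite mulr0z add0r.
have [t0|th] := class_sign_cases t.
  by have [t' ->] := class_sign0 t0; exists j, t'; rewrite expnS mulrnA.
have [|t' tE] := @class_sign0 (t - u).
  rewrite class_signD class_signN us th -mulr2n (half2 uz0 uz1 (@uzetaS F)) //.
exists (j + (2 ^ k)%N%:Z), t'.
rewrite mulrzDr -pmulrn -addrA; congr (_ + _).
by rewrite expnS mulrnA -tE mulrnBl addrC subrK.
Qed.

Theorem contains_two_generatorE (u : H) : contains_two_generator u <-> class_sign u = half.
Proof.
(* [b] is the odd part of [|G|]: multiplication by [b] maps into the 2-part. *)
have [b cb NE] := pfactor_coprime (isT : prime 2) (cardG_gt0 K).
rewrite coprime2n in cb; set a := logn 2 _ in NE.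
have in2 (v : H) : in_2part (v *+ b) by exists a; rewrite -mulrnA -NE class_exponent.
(* The class [c *+ b] of the 2-part has nontrivial sign and is a multiple of [u]. *)
split=> [[n [_ ngen]]|us].
  have [c cs] := exists_class_sign.
  have [l lE] := ngen _ (in2 c).
  have [u0|//] := class_sign_cases u.
  have : class_sign (c *+ b) = 0 by rewrite lE -mulrzA class_signZ.
  by rewrite class_signMn cs half_odd // => /eqP; rewrite (negbTE (uhalf_neq0 F)).
(* An element killed by [2 ^ k] is a multiple of its multiple by [b]. *)
exists b%:Z; rewrite -pmulrn; split=> [|v [k vk]]; first exact: in2.
have [j [t tE]] : exists (j : int) (t : H), v = (u *+ b) *~ j + t *+ 2 ^ a.
  by apply: generates_mod_pow2; rewrite class_signMn us half_odd.
have vb : v *+ b = (u *+ b) *~ (j * b%:Z).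
  by rewrite tE mulrnDl -(mulrnA t) mulnC -NE class_exponent addr0 mulrzA -pmulrn.
have [s _ sE] := Bezoutl b (expn_gt0 2 k : (0 < 2 ^ k)%N = true).
have cop : coprime (2 ^ k) b by rewrite coprimeXl // coprime2n.
have v1 : v *+ (1 + s * b) = 0.
  move: sE; rewrite (eqP cop) => /dvdnP[q ->].
  by rewrite mulnC mulrnA vk mul0rn.
exists (- (j * b%:Z * s%:Z)); move: v1; rewrite mulrnDr mulr1n mulnC mulrnA vb.
by rewrite mulrNz !mulrzA -!pmulrn => /eqP; rewrite addr_eq0 => /eqP.
Qed.

Lemma class_sign_trans c : class_sign c = half ->
  forall u, class_sign (u + c) = half <-> class_sign u <> half.
Proof.
move=> cs u; rewrite class_signD cs; have h0 := uhalf_neq0 F.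
have [->|->] := class_sign_cases u.
  by split=> // _; rewrite ?add0r // => E; rewrite -E eqxx in h0.
rewrite -mulr2n (half2 uz0 uz1 (@uzetaS F)); by split=> E; [rewrite -E eqxx in h0 | case: E].
Qed.
End Classes.

(** Every class is represented by a cocycle with values in the roots of unity of
    order dividing [|G|]: divide by [|G|] a primitive of [|G|] times the
    cocycle. *)
Lemma finite_H3 (F : numClosedFieldType) (gT : finGroupType) :
  finite_set [set: H3 gT F]%classic.
Proof.
pose N := #|[set: gT]%G|; have N0 : (0 < N)%N := cardG_gt0 [set: gT]%G.
have [rs rsE] := closed_field_poly_normal ('X^N - 1 : {poly F}).
have rsP x : x ^+ N = 1 -> x \in rs.
  move=> xN; have : root ('X^N - 1) x by rewrite rootE !hornerE ?hornerXn xN subrr.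
  rewrite rsE rootZ ?root_prod_XsubC // lead_coef_eq0 -size_poly_eq0.
  by rewrite size_XnsubC // N0.
pose T := {ffun gT * gT * gT -> seq_sub rs}.
pose code (t : T) : H3 gT F :=
  if insub [ffun p => ssval (t p)] is Some w then class3 w else 0.
apply: (@sub_finite_set _ _ (range code)); last exact/finite_image/finite_finset.
move=> u _; have [w ->] := class3_surj u.
have [f fE] := cobound3_exponent (cochain_cocycle w).
have /choice[h hE] : forall xy : gT * gT, exists m : unitgrp F, m *+ N = f xy.1 xy.2.
  by move=> xy; apply: unitgrp_div.
pose v x y t := cochain w x y t - (h (y, t) + h (x, (y * t)%g) - (h ((x * y)%g, t) + h (x, y))).
have vcoh : cohomologous3 [set: gT] (cochain w) v.
  exists (fun x y => h (x, y)) => x y t _ _ _; rewrite /v; zmod.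
have vz : cocycle3_on [set: gT]%G v.
  apply: cocycle3B; first exact: cochain_cocycle.
  by move=> x y t s _ _ _ _; rewrite !mulgA; zmod.
have vN x y t : v x y t *+ N = 0.
  rewrite mulrnBl fE ?finset.in_setT // mulrnBl !mulrnDl !hE /=; zmod.
have vr p : uval (v p.1.1 p.1.2 p.2) \in rs.
  by apply: rsP; rewrite -uvalMn vN.
exists [ffun p => SeqSub (vr p)] => //; rewrite /code.
have -> : [ffun p => ssval ([ffun p => SeqSub (vr p)] p)] = Z3fun (of_cochain vz).
  by apply/ffunP => p; rewrite !ffunE.
rewrite valK; apply/class3_eq; apply: cohom3_sym.
have [g gE] := vcoh; exists g => x y t Kx Ky Kt; rewrite -gE //.
by rewrite of_cochainK.
Qed.

(** Translation by a class of nontrivial sign is a bijection of the classes that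
    contain a 2-generator with the other ones. *)
Lemma card_contains_two_generator (F : numClosedFieldType) (gT : finGroupType) (z : gT) :
  #[z]%g = 2%N -> (forall u, #[u]%g = 2%N -> u = z) ->
  (2 * #|` fset_set [set u : H3 gT F | contains_two_generator u]%classic|)%N =
     #|` fset_set [set: H3 gT F]%classic|.
Proof.
move=> oz zuniq.
pose A := [set u : H3 gT F | class_sign z u = uhalf F]%classic.
have -> : [set u : H3 gT F | contains_two_generator u]%classic = A.
  by apply/seteqP; split=> u /(contains_two_generatorE oz zuniq).
have finA (B : set (H3 gT F)) : finite_set B by apply: sub_finite_set (finite_H3 F gT).
have [c cs] := exists_class_sign F oz zuniq.
have tr := class_sign_trans oz cs.
have AC : (~` A = (fun u => u + c) @` A)%classic.
  apply/seteqP; split=> [u nu|_ [u us <-] /tr //].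
  exists (u - c); last by rewrite subrK.
  rewrite /A /=; have [s0|//] := class_sign_cases oz (u - c); case: nu.
  by rewrite /A /= -[u](subrK c); apply/tr; rewrite s0 => /esym/eqP; rewrite (negbTE (uhalf_neq0 F)).
have -> : [set: H3 gT F]%classic = (A `|` ~` A)%classic by rewrite setUv.
rewrite fset_setU // cardfsU -fset_setI // setICr fset_set0.
rewrite cardfs0 subn0 AC fset_set_image // card_imfset /= ?mul2n ?addnn //.
exact: addIr.
Qed.

(** * Admissibility and the theorem *)

Section Assembly.
Variables (F : numClosedFieldType) (gT : finGroupType) (A : {group gT}) (z : gT).
Hypotheses (AE : A :=: [set 1%g; z]) (oz : #[z]%g = 2%N).
Hypothesis zuniq : forall u : gT, #[u]%g = 2%N -> u = z.
Local Notation K := [set: gT]%G.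
Variable w : nZ3 gT F.

Let Kx (x : gT) : x \in K. Proof. by rewrite inE. Qed.
Let z1 : z != 1%g. Proof. by rewrite -order_gt1 oz. Qed.
Let zz : (z * z = 1)%g. Proof. by rewrite -[RHS](expg_order z) oz. Qed.
Let zJ x : (z ^ x = z)%g. Proof. by apply: zuniq; rewrite orderJ. Qed.
Let zC x : (z * x = x * z)%g. Proof. by rewrite conjgC zJ. Qed.
Let Jz x : (x ^ z = x)%g. Proof. by rewrite conjgE -zC mulKg. Qed.

Lemma cochain_normalized : normalized K (cochain w).
Proof.
by move=> x y _ _; have [a b c] := nZ3P w x y; split; apply: uval_inj.
Qed.

Lemma contains_iff : contains_two_generator (class3 w) <-> w (z, z, z) <> 1.
Proof.
rewrite (contains_two_generatorE oz zuniq) class_signE //.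
have [e1 _ _] := cochain_normalized (Kx z) (Kx z).
have [_ _ e2] := cochain_normalized (Kx z) (Kx z).
rewrite /involution_sign e1 e2 !subr0; split=> [E wz|nw].
  have := uhalf_neq0 F; rewrite -E => /eqP; apply; apply: uval_inj.
  by rewrite /= wz.
have := @normalized_torsion gT (unitgrp F) K z (Kx z) oz (cochain w) (cochain_cocycle w) cochain_normalized.
by case/unitgrp_tor2 => // /(congr1 (@uval F)) /= E; case: nw.
Qed.

(** Extend [tau] and [nu] from [z] to [A] by the trivial cochain at [1]. *)
Lemma admissible : omega_admissible w A.
Proof.
have [tau [nu [tauE nuM nuE]]] := admissible_exists (@unitgrp_div F) (uhalf_neq0 F) (@unitgrp_tor2 F) (erefl _) (erefl _)
   (@uzetaS F) (Kx z) oz (fun u _ => zuniq (u:=u)) (cochain_cocycle w) cochain_normalized.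
have AP a : a \in A -> a = 1%g \/ a = z by rewrite AE !inE => /orP[]/eqP; [left|right].
have tE x y : uval (tau x) * uval (tau y) / uval (tau (x * y)%g) = theta w z x y.
  have /(congr1 (@uval F)) := tauE x y (Kx x) (Kx y).
  by rewrite /slant !uvalD !uvalN /= /theta !zJ.
have nE g : uval (nu g) * uval (nu g) = theta w g z z * uval (tau g) * uval (tau g).
  have /(congr1 (@uval F)) := nuE g (Kx g).
  rewrite /slant2 !mulr2n !uvalD uvalN /= /theta zz conjg1 Jz => ->.
  by rewrite !mulrA.
have nu1 : nu 1%g = 0.
  by apply: (@addrI _ (nu 1%g)); rewrite -nuM ?Kx // mulg1 addr0.
have t1 : uval (tau 1%g) = 1.
  have := tE 1%g 1%g; rewrite mulg1 mulfK ?uval_neq0 // theta_1r //.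
pose T a x := if a == z then uval (tau x) else 1.
pose Nu a x := if a == z then uval (nu x) else 1.
have T1 x : T 1%g x = 1 by rewrite /T eq_sym (negbTE z1).
have N1 x : Nu 1%g x = 1 by rewrite /Nu eq_sym (negbTE z1).
have Tz x : T z x = uval (tau x) by rewrite /T eqxx.
have Nz x : Nu z x = uval (nu x) by rewrite /Nu eqxx.
unshelve refine (ex_intro _ (@AdmPair gT F w A T Nu _ _ _ _ _ _ _) I).
- apply/fintype.subsetP => a Aa; rewrite inE; apply/andP; split.
    apply/centerP; split=> [|y _]; first exact: Kx.
    by case: (AP a Aa) => ->; rewrite ?zC // /commute mul1g mulg1.
  apply/asboolP; case: (AP a Aa) => ->.
    exists (fun=> 1); split=> [x|x y]; first exact: oner_neq0.
    have [a1 _ a3] := nZ3P w x y; have [_ b2 _] := nZ3P w x y.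
    by rewrite /gamma !conjg1 a1 a3 b2 !mul1r.
  exists (fun x => uval (tau x)); split=> [x|x y]; first exact: uval_neq0.
  by rewrite tE /gamma /theta !Jz !zJ [w (x, y, z) * _]mulrC.
- by move=> a _ x; rewrite /T; case: ifP => _; rewrite ?uval_neq0 ?oner_neq0.
- by move=> a _; rewrite /T; case: ifP.
- move=> a /AP[]-> x y; last by rewrite !Tz tE.
  by rewrite !T1 theta1g mulr1 divr1.
- move=> a /AP[]->; last first.
    by split=> [x|x y]; rewrite !Nz ?uval_neq0 // nuM ?Kx.
  by split=> [x|x y]; rewrite !N1 ?mulr1 ?oner_neq0.
- by move=> g; rewrite N1.
move=> a b /AP[]-> /AP[]-> g; rewrite ?mul1g ?mulg1 ?zz ?T1 ?N1 ?Tz ?Nz ?theta_1l ?theta_1r ?mul1r ?mulr1 ?divr1 //.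
- by rewrite !divff ?uval_neq0.
- by rewrite !divff ?uval_neq0.
Qed.
End Assembly.

Local Open Scope classical_set_scope.

Theorem mainTheorem1 (R : realType) (gT : finGroupType) (A : {group gT})
  (cardA : #|A| = 2%N)
  (uniqA : forall B : {group gT}, #|B| = 2%N -> B :=: A) :
  (forall w : nZ3 gT R[i],
     (contains_two_generator (class3 w) -> omega_admissible w A) /\
     (forall P : admissible_pair w A,
        modular (DwA P) <-> contains_two_generator (class3 w)))
  /\
  (finite_set [set: H3 gT R[i]] /\
   (2 * #|` fset_set [set u : H3 gT R[i] | contains_two_generator u]|)%N =
     #|` fset_set [set: H3 gT R[i]]|).
Proof.
have [z Az z1] : exists2 z, z \in A & z != 1%g.
  by apply/trivgPn; rewrite -cardG_gt1 cardA.
have AE : A :=: [set 1%g; z]%SET.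
  apply/esym/eqP; rewrite eqEcard cardA cards2 eq_sym z1 andbT.
  by apply/fintype.subsetP => x; rewrite !inE => /orP[]/eqP->.
have oz : #[z]%g = 2%N.
  apply/eqP; rewrite eqn_leq order_gt1 z1 andbT -cardA orderE subset_leq_card //.
  by rewrite cycle_subG.
have zuniq (u : gT) : #[u]%g = 2%N -> u = z.
  move=> ou; have : u \in A by rewrite -(uniqA <[u]>%G) ?cycle_id.
  rewrite AE !inE => /orP[/eqP u1|/eqP//].
  by move: ou; rewrite u1 order1.
split=> [w|].
  split=> [_|P]; first exact: (admissible AE oz zuniq).
  exact: iff_trans (@modular_iff gT R[i] w A P z AE z1) (iff_sym (contains_iff oz zuniq w)).
split; first exact: finite_H3.
exact: (@card_contains_two_generator R[i] gT z oz zuniq).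
Qed.
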